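(* Let $\mathfrak s$ be a symmetry jet on a manifold $M$, let $\nabla=\nabla^{\mathfrak s}$, and let $\xi\in\mathcal B^{(1)}$. Then the affine $(1,1,1)$-jet $\mathbb S(\xi)$ is the unique affine $(1,1,1)$-jet (with respect to $\nabla$) whose first order part is $\xi$.
   Context: All objects are smooth. $\mathcal B^{(1)}$ is the Lie groupoid over $M$ of linear isomorphisms $\xi:T_xM\to T_yM$, source $\alpha(\xi)=x$, target $\beta(\xi)=y$; $-I_x=-\mathrm{id}_{T_xM}$. A local bisection of a Lie groupoid $G\rightrightarrows M$ is a section $b:U\to G$ of $\alpha$ over an open $U$ with $b^0:=\beta\circ b$ a diffeomorphism onto an open set; the $1$-jets $j^1_xb$ of local bisections of $G$ form a Lie groupoid over $M$. $\mathcal B^{(1,1)}_{nh}$ (resp. $\mathcal B^{(1,1,1)}_{nh}$) is the groupoid of $1$-jets of local bisections of $\mathcal B^{(1)}$ (resp. of $\mathcal B^{(1,1)}_{nh}$). On $\mathcal B^{(1,1)}_{nh}$: $p(j^1_xb)=b(x)$, $p_*(j^1_xb)=(b^0)_{*_x}$; $\mathcal B^{(1,1)}_{sh}=\{p=p_*\}$. On $\mathcal B^{(1,1,1)}_{nh}$: $p(j^1_xb)=b(x)$, $p_*(j^1_xb)=j^1_x(p\circ b)$, $p_{**}(j^1_xb)=j^1_x(p_*\circ b)$; $\mathcal B^{(1,1,1)}=\{\eta: p(\eta)=p_*(\eta)=p_{**}(\eta)\in\mathcal B^{(1,1)}_{sh}\}$. The first order part of $\eta\in\mathcal B^{(1,1,1)}$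 is $p(p(\eta))\in\mathcal B^{(1)}$. A symmetry jet is a smooth section $\mathfrak s:M\to\mathcal B^{(1,1)}_{sh}$, $\mathfrak s(x)$ being a jet at $x$ with $p(\mathfrak s(x))=-I_x$. With $(bY)_{b^0(x')}=b(x')Y_{x'}$, the associated connection is $(\nabla^{\mathfrak s}_XY)_x=\frac12[X,Y+s_xY]_x$ where $\mathfrak s(x)=j^1_xs_x$. A $(1,1)$-jet $j^1_xb\in\mathcal B^{(1,1)}_{sh}$ is affine if $b(x)(\nabla_{X_x}Y)=\nabla_{b(x)X_x}(bY)$ for all $X_x,Y$. Each $\xi\in\mathcal B^{(1)}$ has a unique affine extension $S(\xi)\in\mathcal B^{(1,1)}_{sh}$, $p(S(\xi))=\xi$, and $S$ is a Lie groupoid morphism. $\mathbb S(\xi)=j^1_x(S\circ a)\in\mathcal B^{(1,1,1)}$, where $x=\alpha(\xi)$ and $a$ is any local bisection of $\mathcal B^{(1)}$ with $j^1_xa=S(\xi)$. A $(1,1,1)$-jet $\eta$ is affine if $\eta\in\mathcal B^{(1,1,1)}$, its $(1,1)$-part $p(\eta)=p_*(\eta)=p_{**}(\eta)$ is affine, and the following holds. Write $\eta=j^1_x(x'\mapsto j^1_{x'}b_{x'})$, with $b_{x'}$ a smooth family of local bisections of $\mathcal B^{(1)}$ near $x'$ chosen so that $b_{x'}(x')=b_x(x')$, and let $\xi=b_x(x)$. For vector fields $Y,Z$ let $V$ be the local vector field whose value at $y'=b_x^0(x')$ is $\nabla_{b_x(x')Y_{x'}}(b_{x'}Z)$. The condition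 is $\xi(\nabla_{X_x}\nabla_YZ)=\nabla_{\xi X_x}V$ for all vector fields $X,Y,Z$. *)

(* Defs.v *)
From mathcomp Require Export all_boot all_order all_algebra.
From mathcomp Require Export all_classical all_reals all_analysis.
Export numFieldNormedType.Exports.

Set Implicit Arguments.
Unset Strict Implicit.
Unset Printing Implicit Defensive.
Import Order.TTheory GRing.Theory Num.Theory.

Local Open Scope classical_set_scope.
Local Open Scope ring_scope.

(* U is meant to be open; vectors are rows, so that 'D_v f a = v *m 'J f a.  *)
Fixpoint Ck (R : realType) (m l k : nat) (U : set 'rV[R]_m)
    (f : 'rV[R]_m -> 'rV[R]_l) : Prop :=
  if k is k'.+1 then
    (forall a, U a -> differentiable f a) /\
    (forall v : 'rV[R]_m, Ck k' U (fun a => 'D_v f a))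
  else forall a, U a -> {for a, continuous f}.

Definition smooth (R : realType) (m l : nat) (U : set 'rV[R]_m)
    (f : 'rV[R]_m -> 'rV[R]_l) : Prop :=
  open U /\ forall k, Ck k U f.

(* cmap and cinv are total functions, relevant on cdom and on its image only. *)
Record chart (R : realType) (n : nat) (T : topologicalType) := Chart {
  cdom : set T;
  cmap :> T -> 'rV[R]_n;
  cinv : 'rV[R]_n -> T;
  cdom_open : open cdom;
  cimg_open : open (cmap @` cdom);
  cmapK : {in cdom, cancel cmap cinv};
  cmap_cts : forall x, cdom x -> {for x, continuous cmap};
  cinv_cts : forall a, (cmap @` cdom) a -> {for a, continuous cinv} }.

(* chart_at singles out a chart around each point, see tcoord. *)
Record manifold (R : realType) (n : nat) := Manifold {
  msort :> topologicalType;
  atlas : set (chart R n msort);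
  chart_at : msort -> chart R n msort;
  chart_at_atlas : forall x, atlas (chart_at x);
  chart_at_dom : forall x, cdom (chart_at x) x;
  atlas_smooth : forall phi psi, atlas phi -> atlas psi ->
    smooth (phi @` (cdom phi `&` cdom psi)) (psi \o cinv phi);
  manifold_hausdorff : hausdorff_space msort;
  manifold_second_countable : @second_countable msort }.

Section Manifold.
Context {R : realType} {n : nat} (M : manifold R n).
Implicit Types (x y : M) (phi psi : chart R n M) (U W : set M).

Definition smooth_map U (f : M -> M) : Prop :=
  forall phi psi, atlas phi -> atlas psi ->
    let W := U `&` cdom phi `&` f @^-1` cdom psi in
    open W /\ smooth (phi @` W) (psi \o f \o cinv phi).

Definition diffeo_onto_open U (f : M -> M) : Prop :=
  [/\ open U, open (f @` U), smooth_map U f &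
      exists g : M -> M, {in U, cancel f g} /\ smooth_map (f @` U) g].

(* T_xM is 'rV[R]_n, by identifying a tangent vector at x with its components
   in chart_at x. The components of v : T_xM in another chart phi around x are
   v *m tcoord phi x. *)
Definition tcoord phi x : 'M[R]_n :=
  'J (phi \o cinv (chart_at x)) (chart_at x x).

(* The matrix of f_{*x} : T_xM -> T_{f(x)}M. *)
Definition tangent_map (f : M -> M) x : 'M[R]_n :=
  'J (chart_at (f x) \o f \o cinv (chart_at x)) (chart_at x x).

(* A vector field is a function M -> 'rV[R]_n whose value at x is in T_xM. *)
Definition vf_rep phi (X : M -> 'rV[R]_n) (a : 'rV[R]_n) : 'rV[R]_n :=
  X (cinv phi a) *m tcoord phi (cinv phi a).

Definition smooth_vf (X : M -> 'rV[R]_n) : Prop :=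
  forall phi, atlas phi -> smooth (phi @` cdom phi) (vf_rep phi X).

Definition lie_bracket (X Y : M -> 'rV[R]_n) x : 'rV[R]_n :=
  let phi := chart_at x in
  'D_(X x) (vf_rep phi Y) (phi x) - 'D_(Y x) (vf_rep phi X) (phi x).

(* The local vector field near x with constant components v in chart_at x. *)
Definition const_vf x (v : 'rV[R]_n) : M -> 'rV[R]_n :=
  fun x' => v *m invmx (tcoord (chart_at x) x').

(* The data of a Lie groupoid over M on which jets of bisections depend; the
   composition plays no role. The arrows are the elements of garr. The smooth
   structure is given by charts fibred over pairs of charts of M: on the arrows
   with source in cdom phi and target in cdom psi, the coordinates are
   (phi (gsrc g), psi (gtgt g), gcoord phi psi g). *)
Record groupoid := Groupoid {
  gsort : Type;
  garr : set gsort;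
  gsrc : gsort -> M;
  gtgt : gsort -> M;
  gunit : M -> gsort;
  gdim : nat;
  gcoord : chart R n M -> chart R n M -> gsort -> 'rV[R]_gdim }.

Arguments garr : clear implicits.
Arguments gunit : clear implicits.
Arguments gsrc {g}.
Arguments gtgt {g}.
Arguments gcoord {g}.

Section Jets.
Variable G : groupoid.
Implicit Types b : M -> gsort G.

(* The coordinates of a section of gsrc, as a function of those of the source. *)
Definition sec_rep phi psi b (a : 'rV[R]_n) : 'rV[R]_(n + gdim G) :=
  row_mx (psi (gtgt (b (cinv phi a)))) (gcoord phi psi (b (cinv phi a))).

Definition smooth_section U b : Prop :=
  [/\ open U,
      forall x, U x -> garr G (b x) /\ gsrc (b x) = x &
      forall phi psi, atlas phi -> atlas psi ->
        let W := U `&` cdom phi `&` (gtgt \o b) @^-1` cdom psi in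
        open W /\ smooth (phi @` W) (sec_rep phi psi b)].

Definition local_bisection U b : Prop :=
  smooth_section U b /\ diffeo_onto_open U (gtgt \o b).

Definition same_jet x b b' : Prop :=
  b x = b' x /\
  forall phi psi, atlas phi -> atlas psi ->
    cdom phi x -> cdom psi (gtgt (b x)) ->
    'J (sec_rep phi psi b) (phi x) = 'J (sec_rep phi psi b') (phi x).

(* A jet is a point together with a class of local bisections around it. *)
Definition jet_sort : Type := (M * set (set M * (M -> gsort G)))%type.

Definition j1 x b : jet_sort :=
  (x, [set c | [/\ local_bisection c.1 c.2, c.1 x & same_jet x b c.2]]).

Definition jet_arr : set jet_sort :=
  [set z | exists U b, [/\ local_bisection U b, U z.1 & z = j1 z.1 b]].

(* A local bisection, with its domain, whose jet is z. *)
Definition jet_rep (z : jet_sort) : set M * (M -> gsort G) :=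
  @xget {classic (set M * (M -> gsort G))} (setT, gunit G) z.2.

Definition jet_val (z : jet_sort) : gsort G := (jet_rep z).2 z.1.

Definition jet_groupoid : groupoid := {|
  gsort := jet_sort;
  garr := jet_arr;
  gsrc := fst;
  gtgt := fun z => gtgt (jet_val z);
  gunit := fun x => j1 x (gunit G);
  gdim := gdim G + n * (n + gdim G);
  gcoord := fun phi psi z =>
    row_mx (gcoord phi psi (jet_val z))
           (mxvec ('J (sec_rep phi psi (jet_rep z).2) (phi z.1))) |}.

End Jets.

(* For h : G -> H over M, this maps j^1_x b to j^1_x (h o b). *)
Definition jet_map (G H : groupoid) (h : gsort G -> gsort H)
    (z : gsort (jet_groupoid G)) : gsort (jet_groupoid H) :=
  j1 z.1 (h \o (jet_rep z).2).

(* A linear map T_xM -> T_yM acts on row vectors by v |-> v *m lmx. *)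
Record linmap := Linmap { lsrc : M; ltgt : M; lmx : 'M[R]_n }.

Definition B1 : groupoid := {|
  gsort := linmap;
  garr := [set xi | lmx xi \in unitmx];
  gsrc := lsrc;
  gtgt := ltgt;
  gunit := fun x => Linmap x x 1%:M;
  gdim := n * n;
  gcoord := fun phi psi xi =>
    mxvec (invmx (tcoord phi (lsrc xi)) *m lmx xi *m tcoord psi (ltgt xi)) |}.

Definition app (xi : gsort B1) (v : 'rV[R]_n) : 'rV[R]_n := v *m lmx xi.

Definition B11 : groupoid := jet_groupoid B1.
Definition B111 : groupoid := jet_groupoid B11.

Definition p11 : gsort B11 -> gsort B1 := @jet_val B1.
Definition pstar11 (z : gsort B11) : gsort B1 :=
  let b0 := gtgt \o (jet_rep z).2 in Linmap z.1 (b0 z.1) (tangent_map b0 z.1).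

Definition p111 : gsort B111 -> gsort B11 := @jet_val B11.
Definition pstar111 : gsort B111 -> gsort B11 := @jet_map B11 B1 p11.
Definition pstarstar111 : gsort B111 -> gsort B11 := @jet_map B11 B1 pstar11.

Definition semiholonomic : set (gsort B11) :=
  [set z | garr B11 z /\ p11 z = pstar11 z].

Definition jets111 : set (gsort B111) :=
  [set eta | [/\ garr B111 eta, p111 eta = pstar111 eta,
                 p111 eta = pstarstar111 eta & semiholonomic (p111 eta)]].

Definition first_order_part (eta : gsort B111) : gsort B1 := p11 (p111 eta).

Definition symmetry_jet (s : M -> gsort B11) : Prop :=
  @smooth_section B11 setT s /\
  forall x, semiholonomic (s x) /\ p11 (s x) = Linmap x x (- 1%:M).

(* The local vector field bY on the image of b^0, b being defined on U. *)
Definition push U (b : M -> gsort B1) (Y : M -> 'rV[R]_n) : M -> 'rV[R]_n :=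
  fun y' => let x' := xget y' [set x' | U x' /\ gtgt (b x') = y'] in
            app (b x') (Y x').

Section Connection.
Variable s : M -> gsort B11.

Definition nabla (X Y : M -> 'rV[R]_n) : M -> 'rV[R]_n := fun x =>
  let sx := jet_rep (s x) in
  2^-1 *: lie_bracket X (fun x' => Y x' + push sx.1 sx.2 Y x') x.

(* (nabla X Y) x depends on X x only, so v : T_xM may be extended by any local
   vector field. *)
Definition nabla_at x (v : 'rV[R]_n) (Y : M -> 'rV[R]_n) : 'rV[R]_n :=
  nabla (const_vf x v) Y x.

Definition affine11 (z : gsort B11) : Prop :=
  let x := z.1 in let U := (jet_rep z).1 in let b := (jet_rep z).2 in
  semiholonomic z /\
  forall (v : 'rV[R]_n) (Y : M -> 'rV[R]_n), smooth_vf Y ->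
    app (b x) (nabla_at x v Y) =
    nabla_at (gtgt (b x)) (app (b x) v) (push U b Y).

(* The affine extension of xi. *)
Definition affine_ext (xi : gsort B1) : gsort B11 :=
  @xget {classic (gsort B11)} (gunit B11 (gsrc xi))
    [set z | affine11 z /\ p11 z = xi].

Definition affine_ext2 (xi : gsort B1) : gsort B111 :=
  let x := gsrc xi in
  @xget {classic (gsort B111)} (gunit B111 x)
    [set eta | exists U (a : M -> gsort B1),
       [/\ local_bisection U a, U x, j1 x a = affine_ext xi
         & eta = @j1 B11 x (affine_ext \o a)]].

(* Smoothness of (x', z) |-> b x' z on the set of all (x', z) with W x' and
   U x' z, which has to be open. *)
Definition smooth_family W (U : M -> set M) (b : M -> M -> gsort B1) : Prop :=
  forall phi1 phi2 psi, atlas phi1 -> atlas phi2 -> atlas psi ->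
    let Omega := [set q : M * M | [/\ W q.1, U q.1 q.2, cdom phi1 q.1,
                    cdom phi2 q.2 & cdom psi (gtgt (b q.1 q.2))]] in
    open Omega /\
    smooth [set row_mx (phi1 q.1) (phi2 q.2) | q in Omega]
      (fun a : 'rV[R]_(n + n) =>
         sec_rep phi2 psi (b (cinv phi1 (lsubmx a))) (rsubmx a)).

Definition affine111 (eta : gsort B111) : Prop :=
  let x := eta.1 in
  [/\ jets111 eta, affine11 (p111 eta) &
  exists (W : set M) (U : M -> set M) (b : M -> M -> gsort B1),
    [/\ W x /\ W `<=` U x,
        (forall x', W x' -> local_bisection (U x') (b x') /\ U x' x'),
        smooth_family W U b /\ (forall x', W x' -> b x' x' = b x x'),
        @local_bisection B11 W (fun x' => j1 x' (b x')) /\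
        eta = @j1 B11 x (fun x' => j1 x' (b x')) &
        forall X Y Z : M -> 'rV[R]_n,
          smooth_vf X -> smooth_vf Y -> smooth_vf Z ->
          let xi := b x x in
          let V := fun y' =>
            let x' := xget y' [set x' | W x' /\ gtgt (b x x') = y'] in
            nabla_at y' (app (b x x') (Y x')) (push (U x') (b x') Z) in
          app xi (nabla X (nabla Y Z) x) =
          nabla_at (gtgt xi) (app xi (X x)) V]].

End Connection.
End Manifold.

Arguments garr {R n M} g.
Arguments gunit {R n M} g.
Arguments B1 {R n} M.
Arguments B11 {R n} M.
Arguments B111 {R n} M.

(* Main.v *)
Require Import Defs.
From HB Require Import structures.

(* In charts phi around x and psi around y, a local bisection of B1 is a pair
   (beta, B): a map beta of the base and a matrix-valued function B. The
   connection of the symmetry jet s is nabla_v Y = D_v Y + Gamma(v, Y) with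
   Gamma(v, w) = - w D_v S / 2, where S is the matrix part of s(x). A jet at x
   is affine exactly when D_v beta = v B and
     w D_v B = Gamma_x(v, w) B - Gamma_y(v B, w B),
   so that xi determines its affine extension, through a smooth formula; bump
   vector fields provide enough test fields for the converse.

   For existence, the bisections b_{x'} with coordinates affine about x', and
   jet S(a(x')) there, form a smooth family. Since each of them is affine, the
   field V of the definition is the image under a of nabla_Y Z, and the third
   order condition is the affineness of j^1_x a applied to nabla_Y Z.

   For uniqueness, let beta(x', .), B(x', .) represent b_{x'}, J the derivative
   of beta(x', .) at x', and N the one of B(x', .). The equality of p and p_**
   says that J - B vanishes to first order at x. Hence V and the image of
   nabla_Y Z under b_x differ, up to a term vanishing to first order, by
   Z (N(Y) - A(Y)), where A is the value of N for affine jets; the third order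
   condition says that N - A, which vanishes at x, has zero derivative there. *)

Set Implicit Arguments.
Unset Strict Implicit.
Unset Printing Implicit Defensive.
Import Order.TTheory GRing.Theory Num.Theory.

Local Open Scope classical_set_scope.
Local Open Scope ring_scope.

(** * Calculus of matrix-valued functions *)

Section Calculus.
Context {R : realType}.

(** The formula for Gamma comes from s acting by -1 at x: the field Y + sY vanishes there, so its
    bracket with X reduces to a derivative along X, which changes charts as a tensor and may be
    computed in any chart. The obstacle in the uniqueness proof is that, for x' different from x,
    the jet of b_{x'} at x' is not known to be affine or even semiholonomic: J and B differ. The
    field b_{x'}Z is then differentiated along Y B, which has to be rewritten as (Y + d) J with d =
    Y (B - J) J^-1. Both d and its derivative vanish at x, the value by affineness of the
    (1,1)-part, the derivative by the equality of p and p_**. Jets are classes and S is obtained by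
    choice, so nothing is known of the representative that [jet_rep] returns beyond its jet.
    Statements are moved to a convenient bisection with the same jet by comparing Jacobians of
    [srep]. The affine condition thus becomes one equation on such a Jacobian, with right-hand side
    [affJ]; this makes S smooth and compatible with jets. *)

Lemma open_near_eq (T : topologicalType) (S : Type) (U : set T) (f g : T -> S) a :
  open U -> U a -> (forall b, U b -> f b = g b) -> \forall b \near a, f b = g b.
Proof.
move=> oU Ua fg; have Un : nbhs a U by apply: open_nbhs_nbhs.
by apply: filterS Un => b Ub; exact: fg.
Qed.

Lemma differentiable_lin p q p' q' (L : {linear 'M[R]_(p, q) -> 'M[R]_(p', q')}) B :
  differentiable L B.
Proof.
rewrite (_ : (L : _ -> _) = \sum_i \sum_j (fun x : 'M[R]_(p, q) => x i j *: L (delta_mx i j))).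
  apply: differentiable_sum => i; apply: differentiable_sum => j.
  by apply: differentiableZl; exact: differentiable_coord.
apply/funext => x; rewrite fct_sumE {1}(matrix_sum_delta x) linear_sum.
by apply: eq_bigr => i _; rewrite fct_sumE linear_sum; apply: eq_bigr => j _; rewrite linearZ.
Qed.

Section Differentiable.
Context {V : normedModType R}.

Lemma differentiable_mx p q (f : V -> 'M[R]_(p, q)) a :
  (forall i j, differentiable (fun x => f x i j) a) -> differentiable f a.
Proof.
move=> df.
have -> : f = \sum_i \sum_j (fun x => f x i j *: delta_mx i j).
  apply/funext => x; rewrite fct_sumE {1}(matrix_sum_delta (f x)).
  by apply: eq_bigr => i _; rewrite fct_sumE.
apply: differentiable_sum => i; apply: differentiable_sum => j.
exact: differentiableZl.
Qed.

Lemma differentiable_mxE p q (f : V -> 'M[R]_(p, q)) a :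
  differentiable f a <-> forall i j, differentiable (fun x => f x i j) a.
Proof.
split; last exact: differentiable_mx.
move=> df i j; apply: (@differentiable_comp _ _ _ _ f (fun N : 'M[R]_(p, q) => N i j)) => //.
exact: differentiable_coord.
Qed.

Lemma derive_mxE p q (f : V -> 'M[R]_(p, q)) a v i j :
  differentiable f a -> ('D_v f a) i j = 'D_v (fun x => f x i j) a.
Proof. by move=> df; rewrite derive_mx ?mxE //; exact: diff_derivable. Qed.

Lemma derive_comp (W X : normedModType R) (f : V -> W) (g : W -> X) a v :
  differentiable f a -> differentiable g (f a) ->
  'D_v (g \o f) a = 'D_('D_v f a) g (f a).
Proof.
move=> df dg; rewrite !deriveE //; last exact: differentiable_comp.
by rewrite diff_comp.
Qed.

Lemma differentiable_near (W : normedModType R) (f g : V -> W) a :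
  (\forall b \near a, f b = g b) -> differentiable f a -> differentiable g a.
Proof.
move=> fg df.
have fga : f a = g a by exact: nbhs_singleton fg.
have fg0 : \forall h \near (0 : V), f (h + a) = g (h + a).
  by move: fg; rewrite (near_shift 0 a) /=; apply: filterS => h; rewrite subr0.
have /diff_locallyP[dfc dfo] := df.
(* Differentiability is a property of the germ: the expansion of [f] at [a], with the same
   differential, serves for [g]. *)
suff e : g \o shift a = cst (g a) + 'd f a +o_ (0 : V) id.
  by apply/diff_locallyP; rewrite (diff_unique dfc e).
apply/eqaddoP => e e0; move/eqaddoP/(_ e e0) : dfo => H.
near=> h.
have -> : (g \o shift a - (cst (g a) + 'd f a)) h = (f \o shift a - (cst (f a) + 'd f a)) h.
  by rewrite !fctE /= fga (near fg0 h).
by near: h.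
Unshelve. all: by end_near. Qed.

Lemma differentiable_mulmx p q r (A : V -> 'M[R]_(p, q)) (B : V -> 'M[R]_(q, r)) a :
  differentiable A a -> differentiable B a ->
  differentiable (fun x => A x *m B x) a.
Proof.
move=> /differentiable_mxE dA /differentiable_mxE dB.
apply/differentiable_mxE => i j.
rewrite (_ : (fun x => _) = \sum_k ((fun x => A x i k) * (fun x => B x k j))); last first.
  by apply/funext => x; rewrite fct_sumE mxE.
by apply: differentiable_sum => k; exact: differentiableM.
Qed.

Lemma derive_mulmx p q r (A : V -> 'M[R]_(p, q)) (B : V -> 'M[R]_(q, r)) a v :
  differentiable A a -> differentiable B a ->
  'D_v (fun x => A x *m B x) a = 'D_v A a *m B a + A a *m 'D_v B a.
Proof.
move=> dA dB; apply/matrixP => i j.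
rewrite derive_mxE; last exact: differentiable_mulmx.
have /differentiable_mxE dA' := dA; have /differentiable_mxE dB' := dB.
rewrite (_ : (fun x => _) = \sum_k ((fun x => A x i k) * (fun x => B x k j))); last first.
  by apply/funext => x; rewrite fct_sumE mxE.
rewrite derive_sum; last by move=> k; apply: diff_derivable; exact: differentiableM.
rewrite !mxE -big_split; apply: eq_bigr => k _ /=.
rewrite deriveM; [|exact: diff_derivable..].
rewrite (derive_mxE v _ _ dA) (derive_mxE v _ _ dB) addrC; congr (_ + _).
by rewrite /GRing.scale /= mulrC.
Qed.

Lemma differentiable_row_mx p q1 q2 (A : V -> 'M[R]_(p, q1)) (B : V -> 'M[R]_(p, q2)) a :
  differentiable A a -> differentiable B a ->
  differentiable (fun x => row_mx (A x) (B x)) a.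
Proof.
move=> /differentiable_mxE dA /differentiable_mxE dB.
apply/differentiable_mxE => i j; case: (splitP j) => k jk.
  rewrite (_ : (fun x => _) = fun x => A x i k) //.
  by apply/funext => x; rewrite (_ : j = lshift _ k) ?row_mxEl //; exact: val_inj.
rewrite (_ : (fun x => _) = fun x => B x i k) //.
by apply/funext => x; rewrite (_ : j = rshift _ k) ?row_mxEr //; exact: val_inj.
Qed.

Lemma derive_row_mx p q1 q2 (A : V -> 'M[R]_(p, q1)) (B : V -> 'M[R]_(p, q2)) a v :
  differentiable A a -> differentiable B a ->
  'D_v (fun x => row_mx (A x) (B x)) a = row_mx ('D_v A a) ('D_v B a).
Proof.
move=> dA dB; have dAB := differentiable_row_mx dA dB.
apply/matrixP => i j; rewrite derive_mxE //; case: (splitP j) => k jk.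
  rewrite (_ : j = lshift _ k) ?row_mxEl; last exact: val_inj.
  rewrite (derive_mxE v _ _ dA); congr ('D_v _ a); apply/funext => x.
  by rewrite row_mxEl.
rewrite (_ : j = rshift _ k) ?row_mxEr; last exact: val_inj.
rewrite (derive_mxE v _ _ dB); congr ('D_v _ a); apply/funext => x.
by rewrite row_mxEr.
Qed.

Lemma differentiable_lin_comp p q p' q' (L : {linear 'M[R]_(p, q) -> 'M[R]_(p', q')})
    (A : V -> 'M[R]_(p, q)) a :
  differentiable A a -> differentiable (fun x => L (A x)) a.
Proof. by move=> dA; apply: (differentiable_comp dA); exact: differentiable_lin. Qed.

Lemma derive_lin_comp p q p' q' (L : {linear 'M[R]_(p, q) -> 'M[R]_(p', q')})
    (A : V -> 'M[R]_(p, q)) a v :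
  differentiable A a -> 'D_v (fun x => L (A x)) a = L ('D_v A a).
Proof.
move=> dA; have dL := differentiable_lin L.
rewrite (derive_comp v dA (dL _)) deriveE ?diff_lin //.
by move=> B; exact: differentiable_continuous.
Qed.

End Differentiable.
End Calculus.

(** * Smooth scalar functions on open sets of row vectors *)

Section ScalarSmooth.
Context {R : realType} {m : nat}.
Implicit Types (U : set 'rV[R]_m) (f g : 'rV[R]_m -> R).

(** Scalar counterpart of [Ck]: products and inverses make sense here, and [mxsmooth] carries them
    to matrices entry by entry. *)
Fixpoint scalar_Ck (k : nat) U f : Prop :=
  if k is k'.+1 then
    (forall a, U a -> differentiable f a) /\
    (forall v : 'rV[R]_m, scalar_Ck k' U (fun a => 'D_v f a))
  else forall a, U a -> {for a, continuous f}.

Definition scalar_smooth U f := forall k, scalar_Ck k U f.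

Lemma scalar_Ck_ext k U f g : open U -> (forall a, U a -> f a = g a) ->
  scalar_Ck k U f -> scalar_Ck k U g.
Proof.
move=> oU; elim: k f g => [|k IH] f g fg /=.
  move=> cf a Ua; have := cf a Ua.
  rewrite /prop_for /continuous_at (fg a Ua); apply: cvg_trans.
  apply: (@near_eq_cvg _ _ _ (nbhs_filter a)).
  by apply: (open_near_eq oU Ua) => b /fg.
case=> df Df; split=> [a Ua|v].
  by apply: differentiable_near (df a Ua); exact: open_near_eq oU Ua fg.
apply: IH (Df v) => a Ua; apply: near_eq_derive; exact: open_near_eq oU Ua fg.
Qed.

Lemma scalar_CkS k U f : scalar_Ck k.+1 U f -> scalar_Ck k U f.
Proof.
elim: k f => [|k IH] f [df Df].
  by move=> a Ua; apply: differentiable_continuous; exact: df.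
by split=> // v; exact: (IH _ (Df v)).
Qed.

Lemma scalar_Ck_sub k U U' f : U' `<=` U -> scalar_Ck k U f -> scalar_Ck k U' f.
Proof.
move=> UU; elim: k f => [|k IH] f; first by move=> cf a /UU; exact: cf.
by case=> df Df; split=> [a /UU|v]; [exact: df|exact: (IH _ (Df v))].
Qed.

Lemma scalar_Ck_cst k U c : scalar_Ck k U (fun=> c).
Proof.
elim: k c => [|k IH] c /=; first by move=> a _; exact: cst_continuous.
split=> [a _|v]; first exact: differentiable_cst.
suff -> : (fun a : 'rV[R]_m => 'D_v (fun=> c) a) = fun=> 0 by [].
by apply/funext => a; rewrite derive_cst.
Qed.

Lemma scalar_CkD k U f g : open U -> scalar_Ck k U f -> scalar_Ck k U g ->
  scalar_Ck k U (fun a => f a + g a).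
Proof.
move=> oU; elim: k f g => [|k IH] f g.
  by move=> cf cg a Ua; apply: continuousD; [exact: cf|exact: cg].
case=> df Df [dg Dg]; split=> [a Ua|v].
  by apply: differentiableD; [exact: df|exact: dg].
apply: scalar_Ck_ext (IH _ _ (Df v) (Dg v)) => // a Ua.
by rewrite deriveD //; apply: diff_derivable; [exact: df|exact: dg].
Qed.

(** The Leibniz rule multiplies a derivative of one factor by the other factor itself, whose order
    is first lowered by [scalar_CkS]. *)
Lemma scalar_CkM k U f g : open U -> scalar_Ck k U f -> scalar_Ck k U g ->
  scalar_Ck k U (fun a => f a * g a).
Proof.
move=> oU; elim: k f g => [|k IH] f g.
  by move=> cf cg a Ua; apply: continuousM; [exact: cf|exact: cg].
move=> Cf Cg; have [df Df] := Cf; have [dg Dg] := Cg; split=> [a Ua|v].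
  by apply: differentiableM; [exact: df|exact: dg].
have C1 := IH _ _ (scalar_CkS Cf) (Dg v); have C2 := IH _ _ (scalar_CkS Cg) (Df v).
apply: scalar_Ck_ext (scalar_CkD oU C1 C2) => // a Ua.
by rewrite deriveM //; apply: diff_derivable; [exact: df|exact: dg].
Qed.

(** The derivative of 1/f is -(1/f)^2 times that of f, so order k of 1/f yields order k+1. *)
Lemma scalar_Ck_inv k U f : open U -> (forall a, U a -> f a != 0) ->
  scalar_Ck k U f -> scalar_Ck k U (fun a => (f a)^-1).
Proof.
move=> oU f0; elim: k => [|k IH].
  by move=> cf a Ua; apply: continuousV; [exact: f0|exact: cf].
move=> Cf; have [df Df] := Cf; have If := IH (scalar_CkS Cf); split=> [a Ua|v].
  by apply: differentiableV; [exact: df|exact: f0].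
have C := scalar_CkM oU (scalar_CkM oU (scalar_Ck_cst k U (-1)) (scalar_CkM oU If If)) (Df v).
apply: scalar_Ck_ext C => // a Ua.
rewrite deriveV ?f0 //; last by apply: diff_derivable; exact: df.
by rewrite /GRing.scale /= expr2 invfM mulN1r.
Qed.

Lemma scalar_smooth_ext U f g : open U -> (forall a, U a -> f a = g a) ->
  scalar_smooth U f -> scalar_smooth U g.
Proof. by move=> oU fg Cf k; exact: scalar_Ck_ext oU fg (Cf k). Qed.

Lemma scalar_smooth_sub U U' f : U' `<=` U -> scalar_smooth U f -> scalar_smooth U' f.
Proof. by move=> UU Cf k; exact: scalar_Ck_sub UU (Cf k). Qed.

Lemma scalar_smooth_cst U c : scalar_smooth U (fun=> c).
Proof. by move=> k; exact: scalar_Ck_cst. Qed.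

Lemma scalar_smoothD U f g : open U -> scalar_smooth U f -> scalar_smooth U g ->
  scalar_smooth U (fun a => f a + g a).
Proof. by move=> oU Cf Cg k; exact: scalar_CkD. Qed.

Lemma scalar_smoothM U f g : open U -> scalar_smooth U f -> scalar_smooth U g ->
  scalar_smooth U (fun a => f a * g a).
Proof. by move=> oU Cf Cg k; exact: scalar_CkM. Qed.

Lemma scalar_smoothN U f : open U -> scalar_smooth U f -> scalar_smooth U (fun a => - f a).
Proof.
move=> oU Cf; apply: scalar_smooth_ext (scalar_smoothM oU (scalar_smooth_cst U (-1)) Cf) => // a _.
by rewrite mulN1r.
Qed.

Lemma scalar_smoothV U f : open U -> (forall a, U a -> f a != 0) ->
  scalar_smooth U f -> scalar_smooth U (fun a => (f a)^-1).
Proof. by move=> oU f0 Cf k; exact: scalar_Ck_inv. Qed.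

Lemma scalar_smooth_sum U (I : Type) (r : seq I) (P : pred I) (F : I -> 'rV[R]_m -> R) :
  open U -> (forall i, scalar_smooth U (F i)) ->
    scalar_smooth U (fun a => \sum_(i <- r | P i) F i a).
Proof.
move=> oU CF; elim: r => [|i r IH].
  by apply: scalar_smooth_ext (scalar_smooth_cst U 0) => // a _; rewrite big_nil.
have C : scalar_smooth U (fun a => if P i then F i a + \sum_(i <- r | P i) F i a
    else \sum_(i <- r | P i) F i a).
  by case: (P i) => //; exact: scalar_smoothD.
by apply: scalar_smooth_ext C => // a _; rewrite big_cons.
Qed.

Lemma scalar_smooth_prod U (I : Type) (r : seq I) (P : pred I) (F : I -> 'rV[R]_m -> R) :
  open U -> (forall i, scalar_smooth U (F i)) ->
    scalar_smooth U (fun a => \prod_(i <- r | P i) F i a).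
Proof.
move=> oU CF; elim: r => [|i r IH].
  by apply: scalar_smooth_ext (scalar_smooth_cst U 1) => // a _; rewrite big_nil.
have C : scalar_smooth U (fun a => if P i then F i a * \prod_(i <- r | P i) F i a
    else \prod_(i <- r | P i) F i a).
  by case: (P i) => //; exact: scalar_smoothM.
by apply: scalar_smooth_ext C => // a _; rewrite big_cons.
Qed.

Lemma scalar_smooth_diff U f a : scalar_smooth U f -> U a -> differentiable f a.
Proof. by move=> /(_ 1%N)[df _]; exact: df. Qed.

Lemma scalar_smooth_derive U f v : scalar_smooth U f -> scalar_smooth U (fun a => 'D_v f a).
Proof. by move=> Cf k; case: (Cf k.+1) => _; exact. Qed.

Lemma scalar_smooth_coord U i j : scalar_smooth U (fun a => a i j).
Proof.
case=> [|k]; first by move=> a _; exact: coord_continuous.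
split=> [a _|v]; first exact: differentiable_coord.
suff -> : (fun a : 'rV[R]_m => 'D_v (fun b : 'rV[R]_m => b i j) a) = fun=> v i j.
  exact: scalar_Ck_cst.
apply/funext => a; have di : differentiable (@id 'rV[R]_m) a by [].
by have := derive_mxE v i j di; rewrite derive_id.
Qed.

End ScalarSmooth.

Section ScalarComp.
Context {R : realType} {m n : nat}.

Lemma derive_comp_coord (f : 'rV[R]_m -> 'rV[R]_n) (g : 'rV[R]_n -> R) a v :
  differentiable f a -> differentiable g (f a) ->
  'D_v (g \o f) a = \sum_i 'D_v (fun x => f x 0 i) a * 'D_('e_i) g (f a).
Proof.
move=> df dg; rewrite derive_comp //.
rewrite deriveE // {1}(row_sum_delta ('D_v f a)) linear_sum.
apply: eq_bigr => i _; rewrite linearZ /= -(derive_mxE v 0 i df) (deriveE 'e_i dg).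
by [].
Qed.

Lemma scalar_smooth_comp (U : set 'rV[R]_m) (U' : set 'rV[R]_n) f g :
  open U -> (forall a, U a -> U' (f a)) ->
  (forall i, scalar_smooth U (fun a => f a 0 i)) -> scalar_smooth U' g ->
    scalar_smooth U (fun a => g (f a)).
Proof.
move=> oU UU Cf Cg k.
have df a : U a -> differentiable f a.
  move=> Ua; apply/differentiable_mxE => i j; rewrite ord1.
  exact: scalar_smooth_diff (Cf j) Ua.
have {Cg} := Cg k; elim: k g => [|k IH] g.
  move=> cg a Ua; apply: continuous_comp; last by apply: cg; exact: UU.
  by apply: differentiable_continuous; exact: df.
case=> dg Dg; split=> [a Ua|v].
  by apply: (@differentiable_comp _ _ _ _ f g); [exact: df|apply: dg; exact: UU].
have C : scalar_Ck k U (fun a => \sum_i 'D_v (fun x => f x 0 i) a * 'D_('e_i) g (f a)).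
  (* [scalar_smooth_sum] asks for all orders, whereas the induction hypothesis gives order k only;
     the sum is therefore treated by induction on its list of indices. *)
  have [r ->] : exists r, index_enum 'I_n = r by eexists.
  elim: r => [|i r IHr].
    by apply: scalar_Ck_ext (scalar_Ck_cst k U 0) => // a _; rewrite big_nil.
  have C1 := scalar_CkM oU (scalar_smooth_derive v (Cf i) k) (IH _ (Dg 'e_i)).
  by apply: scalar_Ck_ext (scalar_CkD oU C1 IHr) => // a _; rewrite big_cons.
apply: scalar_Ck_ext C => // a Ua.
by rewrite -derive_comp_coord //; [exact: df|apply: dg; exact: UU].
Qed.

End ScalarComp.

(** * Smooth matrix-valued functions, entry by entry *)

Section MatrixSmooth.
Context {R : realType} {m : nat}.
Implicit Types (U : set 'rV[R]_m).

Definition mxsmooth p q U (A : 'rV[R]_m -> 'M[R]_(p, q)) :=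
  forall i j, scalar_smooth U (fun a => A a i j).

Lemma mxsmooth_ext p q U (A B : 'rV[R]_m -> 'M[R]_(p, q)) :
  open U -> (forall a, U a -> A a = B a) -> mxsmooth U A -> mxsmooth U B.
Proof.
by move=> oU AB CA i j; apply: scalar_smooth_ext (CA i j) => // a Ua; rewrite AB.
Qed.

Lemma mxsmooth_sub p q U U' (A : 'rV[R]_m -> 'M[R]_(p, q)) :
  U' `<=` U -> mxsmooth U A -> mxsmooth U' A.
Proof. by move=> UU CA i j; exact: scalar_smooth_sub UU (CA i j). Qed.

Lemma mxsmooth_diff p q U (A : 'rV[R]_m -> 'M[R]_(p, q)) a :
  mxsmooth U A -> U a -> differentiable A a.
Proof. by move=> CA Ua; apply/differentiable_mxE => i j;
  exact: scalar_smooth_diff (CA i j) Ua. Qed.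

Lemma mxsmooth_derive p q U (A : 'rV[R]_m -> 'M[R]_(p, q)) v :
  open U -> mxsmooth U A -> mxsmooth U (fun a => 'D_v A a).
Proof.
move=> oU CA i j; apply: scalar_smooth_ext (scalar_smooth_derive v (CA i j)) => // a Ua.
by rewrite derive_mxE //; exact: mxsmooth_diff CA Ua.
Qed.

Lemma smoothE l U (f : 'rV[R]_m -> 'rV[R]_l) :
  smooth U f <-> open U /\ mxsmooth U f.
Proof.
split=> [[oU Cf]|[oU Cf]]; split => //.
  (* Order k of an entry is drawn from order k+1 of the map: at each level the map is then
     differentiable, which passes to the entries and gives continuity at level 0. *)
  move=> i j k; rewrite ord1 {i}; have {Cf} := Cf k.+1.
  elim: k f => [|k IH] f [df Df]; first last.
    have dfj a : U a -> differentiable (fun a => f a 0 j) a.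
      by move=> /df /differentiable_mxE.
    split=> // v; apply: scalar_Ck_ext (IH _ (Df v)) => // a Ua.
    by rewrite derive_mxE //; exact: df.
  move=> a /df /differentiable_mxE dfj.
  exact: differentiable_continuous.
move=> k; elim: k f Cf => [|k IH] f Cf.
  by move=> a Ua; apply: differentiable_continuous; exact: mxsmooth_diff Cf Ua.
split=> [a|v]; first exact: mxsmooth_diff.
by apply: IH; exact: mxsmooth_derive.
Qed.

Lemma mxsmooth_cst p q U (B : 'M[R]_(p, q)) : mxsmooth U (fun=> B).
Proof. by move=> i j; exact: scalar_smooth_cst. Qed.

Lemma mxsmooth_id U : mxsmooth U id.
Proof. by move=> i j; exact: scalar_smooth_coord. Qed.

Lemma mxsmoothD p q U (A B : 'rV[R]_m -> 'M[R]_(p, q)) : open U ->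
  mxsmooth U A -> mxsmooth U B -> mxsmooth U (fun a => A a + B a).
Proof.
move=> oU CA CB i j; apply: scalar_smooth_ext (scalar_smoothD oU (CA i j) (CB i j)) => // a _.
by rewrite mxE.
Qed.

Lemma mxsmoothZ p q U f (A : 'rV[R]_m -> 'M[R]_(p, q)) : open U ->
  scalar_smooth U f -> mxsmooth U A -> mxsmooth U (fun a => f a *: A a).
Proof.
move=> oU Cf CA i j; apply: scalar_smooth_ext (scalar_smoothM oU Cf (CA i j)) => // a _.
by rewrite mxE.
Qed.

Lemma mxsmoothN p q U (A : 'rV[R]_m -> 'M[R]_(p, q)) : open U ->
  mxsmooth U A -> mxsmooth U (fun a => - A a).
Proof.
move=> oU CA i j; apply: scalar_smooth_ext (scalar_smoothN oU (CA i j)) => // a _.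
by rewrite mxE.
Qed.

Lemma mxsmoothB p q U (A B : 'rV[R]_m -> 'M[R]_(p, q)) : open U ->
  mxsmooth U A -> mxsmooth U B -> mxsmooth U (fun a => A a - B a).
Proof. by move=> oU CA CB; apply: mxsmoothD => //; exact: mxsmoothN. Qed.

Lemma mxsmoothM p q r U (A : 'rV[R]_m -> 'M[R]_(p, q)) (B : 'rV[R]_m -> 'M[R]_(q, r)) :
  open U -> mxsmooth U A -> mxsmooth U B -> mxsmooth U (fun a => A a *m B a).
Proof.
move=> oU CA CB i j.
apply: scalar_smooth_ext (scalar_smooth_sum (F :=
  fun k a => A a i k * B a k j) _ _ oU _) => //.
  by move=> a _; rewrite mxE.
by move=> k; exact: scalar_smoothM.
Qed.

Lemma mxsmooth_sum p q U (I : Type) (r : seq I) (P : pred I)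
    (F : I -> 'rV[R]_m -> 'M[R]_(p, q)) : open U ->
  (forall i, mxsmooth U (F i)) -> mxsmooth U (fun a => \sum_(i <- r | P i) F i a).
Proof.
move=> oU CF i j.
apply: scalar_smooth_ext (scalar_smooth_sum (F := fun k a => F k a i j) r P oU _) => //.
  by move=> a _; rewrite summxE.
by move=> k; exact: CF.
Qed.

Lemma mxsmooth_lin p q p' q' U (L : {linear 'M[R]_(p, q) -> 'M[R]_(p', q')})
    (A : 'rV[R]_m -> 'M[R]_(p, q)) :
  open U -> mxsmooth U A -> mxsmooth U (fun a => L (A a)).
Proof.
move=> oU CA.
apply: (@mxsmooth_ext _ _ _ (fun a => \sum_i \sum_j A a i j *: L (delta_mx i j))) => //.
  move=> a _; rewrite [in RHS](matrix_sum_delta (A a)) linear_sum.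
  by apply: eq_bigr => i _; rewrite linear_sum; apply: eq_bigr => j _; rewrite linearZ.
do 2![apply: mxsmooth_sum => // ?]; apply: mxsmoothZ => //; exact: mxsmooth_cst.
Qed.

Lemma mxsmooth_row_mx p q1 q2 U (A : 'rV[R]_m -> 'M[R]_(p, q1))
    (B : 'rV[R]_m -> 'M[R]_(p, q2)) : open U ->
  mxsmooth U A -> mxsmooth U B -> mxsmooth U (fun a => row_mx (A a) (B a)).
Proof.
move=> oU CA CB i j; case: (splitP j) => k jk.
  rewrite (_ : j = lshift _ k); last exact: val_inj.
  by apply: scalar_smooth_ext (CA i k) => // a _; rewrite row_mxEl.
rewrite (_ : j = rshift _ k); last exact: val_inj.
by apply: scalar_smooth_ext (CB i k) => // a _; rewrite row_mxEr.
Qed.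

Lemma scalar_smooth_det p U (A : 'rV[R]_m -> 'M[R]_p) : open U ->
  mxsmooth U A -> scalar_smooth U (fun a => \det (A a)).
Proof.
move=> oU CA; apply: scalar_smooth_sum => // s; apply: scalar_smoothM => //;
  first exact: scalar_smooth_cst.
by apply: scalar_smooth_prod => // i; exact: CA.
Qed.

(** Cramer's rule: the inverse is the adjugate over the determinant, both polynomial in the
    entries. *)
Lemma mxsmooth_inv p U (A : 'rV[R]_m -> 'M[R]_p) : open U ->
  (forall a, U a -> A a \in unitmx) ->
  mxsmooth U A -> mxsmooth U (fun a => invmx (A a)).
Proof.
move=> oU uA CA.
apply: (@mxsmooth_ext _ _ _ (fun a => (\det (A a))^-1 *: \adj (A a))) => //.
  by move=> a Ua; rewrite /invmx uA.
apply: mxsmoothZ => //.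
  apply: scalar_smoothV => //; last exact: scalar_smooth_det.
  by move=> a /uA; rewrite unitmxE unitfE.
move=> i j; apply: (@scalar_smooth_ext _ _ _ (fun a => cofactor (A a) j i)) => //.
  by move=> a _; rewrite mxE.
apply: scalar_smoothM => //; first exact: scalar_smooth_cst.
apply: scalar_smooth_det => // k l.
by apply: scalar_smooth_ext (CA (lift j k) (lift i l)) => // a _; rewrite !mxE.
Qed.

End MatrixSmooth.

Lemma mxsmooth_comp (R : realType) m n p q (U : set 'rV[R]_m) (U' : set 'rV[R]_n)
    (f : 'rV[R]_m -> 'rV[R]_n) (A : 'rV[R]_n -> 'M[R]_(p, q)) :
  open U -> (forall a, U a -> U' (f a)) -> mxsmooth U f -> mxsmooth U' A ->
  mxsmooth U (fun a => A (f a)).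
Proof.
move=> oU UU Cf CA i j; apply: (@scalar_smooth_comp _ _ _ U U' f (fun b => A b i j)) => //.
Qed.

Lemma open_unitmx (R : realType) m p (U : set 'rV[R]_m) (A : 'rV[R]_m -> 'M[R]_p) :
  open U -> mxsmooth U A -> open [set a | U a /\ A a \in unitmx].
Proof.
move=> oU CA; rewrite openE => a [Ua uA]; rewrite /interior.
have cd : {for a, continuous (fun a => \det (A a))}.
  by apply: differentiable_continuous; exact: scalar_smooth_diff (scalar_smooth_det oU CA) Ua.
have d0 : \det (A a) != 0 by rewrite -unitfE -unitmxE.
have N0 : nbhs (\det (A a)) [set x : R | x != 0].
  apply: open_nbhs_nbhs; split => //; exact: open_neq.
have NU : nbhs a U by exact: open_nbhs_nbhs.
near=> b; split; first by near: b.
by rewrite unitmxE unitfE; near: b; exact: cd N0.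
Unshelve. all: by end_near. Qed.

(* Sealed copies of the directional derivative and of the Jacobian: testing the
   convertibility of two unfolded derivatives does not terminate in practice. *)
HB.lock Definition ddir (R : realType) (m p q : nat) (f : 'rV[R]_m -> 'M[R]_(p, q))
  (a v : 'rV[R]_m) : 'M[R]_(p, q) := 'D_v f a.
HB.lock Definition jac (R : realType) (m l : nat) (f : 'rV[R]_m -> 'rV[R]_l)
  (a : 'rV[R]_m) : 'M[R]_(m, l) := 'J f a.

Section Jacobian.
Context {R : realType}.

Lemma ddirE m p q (f : 'rV[R]_m -> 'M[R]_(p, q)) a v : 'D_v f a = ddir f a v.
Proof. by rewrite unlock. Qed.

Lemma jacE m l (f : 'rV[R]_m -> 'rV[R]_l) a : 'J f a = jac f a.
Proof. by rewrite unlock. Qed.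

Section Matrix.
Context {m p q : nat}.
Implicit Types (A B : 'rV[R]_m -> 'M[R]_(p, q)).

Lemma ddirD A B a v : differentiable A a -> differentiable B a ->
  ddir (fun x => A x + B x) a v = ddir A a v + ddir B a v.
Proof. by move=> dA dB; rewrite unlock deriveD //; exact: diff_derivable. Qed.

Lemma ddirB A B a v : differentiable A a -> differentiable B a ->
  ddir (fun x => A x - B x) a v = ddir A a v - ddir B a v.
Proof. by move=> dA dB; rewrite unlock deriveB //; exact: diff_derivable. Qed.

Lemma ddir_cst (C : 'M[R]_(p, q)) (a : 'rV[R]_m) v : ddir (fun=> C) a v = 0.
Proof. by rewrite unlock derive_cst. Qed.

Lemma ddir0 A a : ddir A a 0 = 0.
Proof. by rewrite unlock derive0. Qed.

Lemma ddir_scaler A a k v : differentiable A a ->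
  ddir A a (k *: v) = k *: ddir A a v.
Proof. by move=> dA; rewrite unlock !deriveE // linearZ. Qed.

Lemma ddir_near A B a v : (\forall x \near a, A x = B x) -> ddir A a v = ddir B a v.
Proof. by move=> AB; rewrite unlock; exact: near_eq_derive. Qed.

Lemma ddir_lin p' q' (L : {linear 'M[R]_(p, q) -> 'M[R]_(p', q')}) A a v :
  differentiable A a -> ddir (fun x => L (A x)) a v = L (ddir A a v).
Proof. by move=> dA; rewrite unlock derive_lin_comp. Qed.

Lemma mxsmooth_ddir (U : set 'rV[R]_m) A v :
  open U -> mxsmooth U A -> mxsmooth U (fun a => ddir A a v).
Proof. by move=> oU CA; rewrite unlock; exact: mxsmooth_derive. Qed.

(** Smoothness of a derivative is built into [scalar_Ck] for constant directions only; this
    expansion reduces a variable direction to them. *)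
Lemma ddir_sum_delta A a v : differentiable A a ->
  ddir A a v = \sum_i v 0 i *: ddir A a 'e_i.
Proof.
move=> dA; rewrite unlock deriveE // {1}(row_sum_delta v) linear_sum.
by apply: eq_bigr => i _; rewrite linearZ deriveE.
Qed.

Lemma mxsmooth_ddir_fun (U : set 'rV[R]_m) A (v : 'rV[R]_m -> 'rV[R]_m) :
  open U -> mxsmooth U A -> mxsmooth U v -> mxsmooth U (fun a => ddir A a (v a)).
Proof.
move=> oU CA Cv.
apply: (@mxsmooth_ext _ _ _ _ _ (fun a => \sum_i v a 0 i *: ddir A a 'e_i)) => //.
  by move=> a Ua; rewrite -ddir_sum_delta //; exact: mxsmooth_diff CA Ua.
apply: mxsmooth_sum => // i; apply: mxsmoothZ => //; exact: mxsmooth_ddir.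
Qed.

End Matrix.

Lemma ddir_id m (a v : 'rV[R]_m) : ddir id a v = v.
Proof. by rewrite unlock derive_id. Qed.

Lemma ddirM m p q r (A : 'rV[R]_m -> 'M[R]_(p, q)) (B : 'rV[R]_m -> 'M[R]_(q, r)) a v :
  differentiable A a -> differentiable B a ->
  ddir (fun x => A x *m B x) a v = ddir A a v *m B a + A a *m ddir B a v.
Proof. by move=> dA dB; rewrite unlock derive_mulmx. Qed.

Lemma ddir_row_mx m p q1 q2 (A : 'rV[R]_m -> 'M[R]_(p, q1))
    (B : 'rV[R]_m -> 'M[R]_(p, q2)) a v :
  differentiable A a -> differentiable B a ->
  ddir (fun x => row_mx (A x) (B x)) a v = row_mx (ddir A a v) (ddir B a v).
Proof. by move=> dA dB; rewrite unlock derive_row_mx. Qed.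

Lemma ddir_comp m n p q (f : 'rV[R]_m -> 'rV[R]_n) (A : 'rV[R]_n -> 'M[R]_(p, q)) a v :
  differentiable f a -> differentiable A (f a) ->
  ddir (fun x => A (f x)) a v = ddir A (f a) (ddir f a v).
Proof. by move=> df dA; rewrite unlock; exact: derive_comp. Qed.

Lemma mul_jac m n (f : 'rV[R]_m -> 'rV[R]_n) a v :
  differentiable f a -> v *m jac f a = ddir f a v.
Proof. by move=> df; rewrite !unlock deriveEjacobian. Qed.

Lemma mul_rV_eqP m n (A B : 'M[R]_(m, n)) :
  (forall v : 'rV_m, v *m A = v *m B) -> A = B.
Proof. by move=> AB; apply/row_matrixP => i; rewrite !rowE. Qed.

Lemma jac_eqP m n (f g : 'rV[R]_m -> 'rV[R]_n) a b :
  differentiable f a -> differentiable g b ->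
  jac f a = jac g b <-> forall v, ddir f a v = ddir g b v.
Proof.
move=> df dg; split=> [Jfg v|Dfg]; first by rewrite -!mul_jac // Jfg.
by apply: mul_rV_eqP => v; rewrite !mul_jac.
Qed.

Lemma jac_comp m n p (f : 'rV[R]_m -> 'rV[R]_n) (g : 'rV[R]_n -> 'rV[R]_p) a :
  differentiable f a -> differentiable g (f a) ->
  jac (fun x => g (f x)) a = jac f a *m jac g (f a).
Proof.
move=> df dg; apply: mul_rV_eqP => v.
rewrite mulmxA !mul_jac //; first exact: ddir_comp.
exact: (differentiable_comp df dg).
Qed.

Lemma jac_near m n (f g : 'rV[R]_m -> 'rV[R]_n) a :
  (\forall b \near a, f b = g b) -> differentiable f a -> jac f a = jac g a.
Proof.
move=> fg df; have dg := differentiable_near fg df.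
by apply/jac_eqP => // v; exact: ddir_near.
Qed.

Lemma jac_id m (a : 'rV[R]_m) : jac id a = 1%:M.
Proof. by apply: mul_rV_eqP => v; rewrite mulmx1 mul_jac ?ddir_id. Qed.

Lemma mxsmooth_jac m n (U : set 'rV[R]_m) (f : 'rV[R]_m -> 'rV[R]_n) :
  open U -> mxsmooth U f -> mxsmooth U (fun a => jac f a).
Proof.
move=> oU Cf i j; apply: scalar_smooth_ext (mxsmooth_ddir 'e_i oU Cf 0 j) => // a Ua.
by rewrite -mul_jac; [rewrite -rowE mxE|exact: mxsmooth_diff Cf Ua].
Qed.

End Jacobian.

(** * Charts *)

Lemma open_within_preimage (S T : topologicalType) (A : set S) (f : S -> T) (B : set T) :
  open A -> (forall x, A x -> {for x, continuous f}) -> open B -> open (A `&` f @^-1` B).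
Proof.
move=> oA cf oB; rewrite openE => x [Ax Bx]; rewrite /interior.
apply: filterI; first exact: open_nbhs_nbhs.
by apply: (cf x Ax); exact: open_nbhs_nbhs.
Qed.

(* Sealed for the same reason as ddir and jac. *)
HB.lock Definition tc (R : realType) (n : nat) (M : manifold R n)
  (phi : chart R n M) (x : M) : 'M[R]_n := tcoord phi x.
HB.lock Definition vrep (R : realType) (n : nat) (M : manifold R n)
  (phi : chart R n M) (X : M -> 'rV[R]_n) : 'rV[R]_n -> 'rV[R]_n := vf_rep phi X.
HB.lock Definition srep (R : realType) (n : nat) (M : manifold R n) (G : groupoid M)
  (phi psi : chart R n M) (b : M -> gsort G) : 'rV[R]_n -> 'rV[R]_(n + gdim G) :=
  sec_rep phi psi b.
HB.lock Definition sjet (R : realType) (n : nat) (M : manifold R n) (G : groupoid M)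
  (x : M) (b c : M -> gsort G) : Prop := same_jet x b c.
HB.lock Definition jet1 (R : realType) (n : nat) (M : manifold R n) (G : groupoid M)
  (x : M) (b : M -> gsort G) : jet_sort G := j1 x b.

Section Charts.
Context {R : realType} {n : nat} (M : manifold R n).
Implicit Types (x : M) (phi psi theta chi : chart R n M).

Lemma chartK phi x : cdom phi x -> cinv phi (phi x) = x.
Proof. by move=> px; apply: cmapK; rewrite inE. Qed.

Lemma cimgP phi a : (phi @` cdom phi) a -> cdom phi (cinv phi a) /\ phi (cinv phi a) = a.
Proof. by move=> [x px <-]; rewrite chartK. Qed.

Lemma chart_imgE phi (W : set M) : W `<=` cdom phi ->
  phi @` W = (phi @` cdom phi) `&` cinv phi @^-1` W.
Proof.
move=> WU; apply/seteqP; split=> a /=.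
  by move=> [x Wx <-]; rewrite chartK; [split => //; exists x|]; auto.
by move=> [/cimgP[_ e] Wa]; exists (cinv phi a).
Qed.

Lemma open_chart_img phi (W : set M) : open W -> W `<=` cdom phi -> open (phi @` W).
Proof.
move=> oW WU; rewrite chart_imgE //; apply: open_within_preimage => //.
  exact: cimg_open.
exact: cinv_cts.
Qed.

Lemma open_chart_preim phi (O : set 'rV[R]_n) : open O -> open (cdom phi `&` phi @^-1` O).
Proof.
move=> oO; apply: open_within_preimage => //; first exact: cdom_open.
exact: cmap_cts.
Qed.

Definition tr phi psi (a : 'rV[R]_n) : 'rV[R]_n := psi (cinv phi a).
Definition overlap phi psi : set 'rV[R]_n := phi @` (cdom phi `&` cdom psi).
Definition jtr phi psi x : 'M[R]_n := jac (tr phi psi) (phi x).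

Lemma overlapP phi psi x : cdom phi x -> cdom psi x -> overlap phi psi (phi x).
Proof. by move=> ? ?; exists x. Qed.

Lemma overlapE phi psi a : overlap phi psi a ->
  [/\ cdom phi (cinv phi a), cdom psi (cinv phi a) & phi (cinv phi a) = a].
Proof. by case=> x [px qx] <-; rewrite chartK. Qed.

Lemma open_overlap phi psi : open (overlap phi psi).
Proof.
by apply: open_chart_img; [apply: openI; exact: cdom_open|move=> x []].
Qed.

Lemma tr_smooth phi psi : atlas phi -> atlas psi ->
  mxsmooth (overlap phi psi) (tr phi psi).
Proof. by move=> aphi apsi; have /smoothE[] := atlas_smooth aphi apsi. Qed.

Lemma tr_diff phi psi x : atlas phi -> atlas psi -> cdom phi x -> cdom psi x ->
  differentiable (tr phi psi) (phi x).
Proof.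
by move=> aphi apsi px qx; apply: mxsmooth_diff (tr_smooth _ _) (overlapP _ _).
Qed.

Lemma near_chart phi x (W : set M) : cdom phi x -> nbhs x W ->
  \forall a \near phi x, W (cinv phi a).
Proof.
move=> px; rewrite -{1}(chartK px) => Wx.
by apply: (cinv_cts (c := phi)) Wx; exists x.
Qed.

Lemma near_cimg phi x : cdom phi x -> \forall a \near phi x, (phi @` cdom phi) a.
Proof.
by move=> px; apply: open_nbhs_nbhs; split; [exact: cimg_open|exists x].
Qed.

(** Chain rule for transition maps. Vectors are rows, so the change of coordinates applied first
    stands on the left. *)
Lemma jtr_comp phi psi theta x : atlas phi -> atlas psi -> atlas theta ->
  cdom phi x -> cdom psi x -> cdom theta x ->
  jtr phi psi x *m jtr psi theta x = jtr phi theta x.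
Proof.
move=> aphi apsi atheta px qx rx.
have e : psi x = tr phi psi (phi x) by rewrite /tr chartK.
rewrite /jtr e -jac_comp; [|exact: tr_diff|by rewrite -e; exact: tr_diff].
apply: jac_near.
  have N := near_chart px (open_nbhs_nbhs (conj (cdom_open psi) qx)).
  by near=> a; rewrite /tr chartK //; near: a.
apply: (differentiable_comp (f := tr phi psi) (g := tr psi theta)).
  exact: tr_diff.
by rewrite -e; exact: tr_diff.
Unshelve. all: by end_near. Qed.

Lemma jtr_id phi x : atlas phi -> cdom phi x -> jtr phi phi x = 1%:M.
Proof.
move=> aphi px; rewrite /jtr -(jac_id (phi x)); apply: jac_near; last exact: tr_diff.
have N := near_cimg px.
by near=> a; rewrite /tr; apply: (cimgP _).2; near: a.
Unshelve. all: by end_near. Qed.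

Lemma jtrV phi psi x : atlas phi -> atlas psi -> cdom phi x -> cdom psi x ->
  jtr phi psi x *m jtr psi phi x = 1%:M.
Proof. by move=> *; rewrite jtr_comp ?jtr_id. Qed.

Lemma jtr_unit phi psi x : atlas phi -> atlas psi -> cdom phi x -> cdom psi x ->
  jtr phi psi x \in unitmx.
Proof. by move=> *; apply: (mulmx1_unit (jtrV _ _ _ _)).1 => //; eauto. Qed.

Lemma tcoordE phi x : tcoord phi x = tc phi x.
Proof. by rewrite unlock. Qed.

Lemma vf_repE phi X : vf_rep phi X = vrep phi X.
Proof. by rewrite unlock. Qed.

Lemma vrepE phi (X : M -> 'rV[R]_n) a : vrep phi X a = X (cinv phi a) *m tc phi (cinv phi a).
Proof. by rewrite unlock -tcoordE. Qed.

Lemma tcE phi x : tc phi x = jtr (chart_at x) phi x.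
Proof. by rewrite unlock /tcoord jacE. Qed.

Lemma tc_unit phi x : atlas phi -> cdom phi x -> tc phi x \in unitmx.
Proof.
move=> ? ?; rewrite tcE; apply: jtr_unit => //.
  exact: chart_at_atlas.
exact: chart_at_dom.
Qed.

Lemma tc_chart_at x : tc (chart_at x) x = 1%:M.
Proof. by rewrite tcE jtr_id //; [exact: chart_at_atlas|exact: chart_at_dom]. Qed.

Lemma tc_jtr phi psi x : atlas phi -> atlas psi -> cdom phi x -> cdom psi x ->
  tc phi x *m jtr phi psi x = tc psi x.
Proof.
move=> *; rewrite !tcE jtr_comp //.
  exact: chart_at_atlas.
exact: chart_at_dom.
Qed.

Lemma invmx_tc phi psi x : atlas phi -> atlas psi -> cdom phi x -> cdom psi x ->
  invmx (tc phi x) *m tc psi x = jtr phi psi x.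
Proof.
move=> ? ? ? ?; rewrite -(tc_jtr (phi := phi) (psi := psi)) // mulKmx //.
exact: tc_unit.
Qed.

Lemma mxsmooth_jtr phi psi : atlas phi -> atlas psi ->
  mxsmooth (overlap phi psi) (fun a => jac (tr phi psi) a).
Proof. by move=> *; apply: mxsmooth_jac; [exact: open_overlap|exact: tr_smooth]. Qed.

Lemma vrep_at phi (X : M -> 'rV[R]_n) x : cdom phi x ->
  vrep phi X (phi x) = X x *m tc phi x.
Proof. by move=> px; rewrite vrepE chartK. Qed.

Lemma vrep_tr phi psi (X : M -> 'rV[R]_n) a : atlas phi -> atlas psi ->
  overlap phi psi a ->
  vrep phi X a = vrep psi X (tr phi psi a) *m jac (tr psi phi) (tr phi psi a).
Proof.
move=> aphi apsi /overlapE[pa qa ea].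
by rewrite !vrepE /tr chartK // -mulmxA (tc_jtr apsi aphi).
Qed.

End Charts.

(** * Bump functions *)

Section FlatFunction.
Context {R : realType}.

(** The powers of 1/t are carried along so that the family is closed under differentiation; [flat 0]
    is the usual flat function exp(-1/t). *)
Definition flat (k : nat) (t : R) : R :=
  if 0 < t then t^-1 ^+ k * expR (- t^-1) else 0.

(** The exponential series gives exp(u) >= u^(k+2) / (k+2)! at u = 1/t. Two more powers than k leave
    a factor t^2, enough for the derivative at 0 to vanish. *)
Lemma flat_bound k t : 0 < t -> flat k t <= (k.+2)`!%:R * t ^+ 2.
Proof.
move=> t0; rewrite /flat t0 expRN.
have := @expR_ge1Dxn R t^-1 k.+1; rewrite invr_ge0 => /(_ (ltW t0)) h.
have f0 : 0 < (k.+2)`!%:R :> R by rewrite ltr0n fact_gt0.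
rewrite ler_pdivrMr ?expR_gt0 //.
have {h} : t^-1 ^+ k.+2 <= (k.+2)`!%:R * expR t^-1.
  rewrite mulrC -ler_pdivrMr //; apply: le_trans h; rewrite lerDr; exact: ler01.
move=> h; have t2 : 0 < t ^+ 2 by rewrite exprn_gt0.
rewrite mulrAC (_ : t^-1 ^+ k = t^-1 ^+ k.+2 * t ^+ 2); first by rewrite ler_pM2r.
by rewrite -addn2 exprD -mulrA -exprMn mulVf ?gt_eqF // expr1n mulr1.
Qed.

Lemma flat_ge0 k t : 0 <= flat k t.
Proof.
rewrite /flat; case: ifP => // t0.
by rewrite mulr_ge0 ?expR_ge0 // exprn_ge0 // invr_ge0 ltW.
Qed.

Lemma is_derive_flat (k : nat) (t : R) :
  is_derive t (1 : R) (flat k : R -> R) (- k%:R * flat k.+1 t + flat k.+2 t).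
Proof.
have [t0|t0|->] := ltrgtP t 0.
- have e j : flat j t = 0 by rewrite /flat (lt_gtF t0).
  rewrite !e mulr0 addr0.
  apply: (@near_eq_is_derive _ _ _ (cst 0)).
  have : \forall x \near t, x < 0 by exact: lt_nbhsl.
  by apply: filterS => x x0; rewrite /flat (lt_gtF x0).
- have e j : flat j t = t^-1 ^+ j * expR (- t^-1) by rewrite /flat t0.
  rewrite !e.
  have tn0 : t != 0 by rewrite gt_eqF.
  have dV : is_derive t 1 (fun t : R => t^-1) (- t^-1 ^+ 2).
    have := @is_deriveV R id t 1 1 tn0 (is_derive_id _ _).
    by rewrite /GRing.scale /= mulr1 exprVn.
  have dE : is_derive t 1 (fun t => expR (- t^-1)) (t^-1 ^+ 2 * expR (- t^-1)).
    have dN : is_derive t 1 (fun t : R => - t^-1) (t^-1 ^+ 2).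
      by have := is_deriveN dV; rewrite opprK.
    have := @is_derive1_comp R expR (fun t : R => - t^-1) t _ _ (is_derive_expR _) dN.
    by rewrite mulrC.
  have dX : is_derive t 1 (fun t : R => t^-1 ^+ k) (- k%:R * t^-1 ^+ k.+1).
    have -> : (fun t : R => t^-1 ^+ k) = (fun t => t^-1) ^+ k.
      by apply/funext => x; rewrite exprfctE.
    apply: (is_derive_eq (is_deriveX k dV)).
    case: k => [|k]; first by rewrite mul0r scale0r oppr0 mul0r.
    rewrite /GRing.scale /= mulNr mulrN -mulrA; congr (- (_ * _)).
    by rewrite -exprD addn2.
  apply: near_eq_is_derive (is_derive_eq (is_deriveM dX dE) _).
    have : \forall x \near t, 0 < x by exact: lt_nbhsr.
    by apply: filterS => x x0; rewrite /flat x0.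
  rewrite /GRing.scale /= addrC; congr (_ + _).
    by rewrite mulrC -!mulrA.
  by rewrite mulrA -exprD addn2.
- have fl0 j : flat j 0 = 0 by rewrite /flat ltxx.
  rewrite !fl0 mulr0 addr0.
  (* For h > 0 the quotient is at most (k+2)! h by [flat_bound]; for h < 0 it is 0. *)
  have lim : h^-1 *: (flat k (h *: 1 + 0) - flat k 0) @[h --> (0 : R)^'] --> (0 : R).
    apply/cvgrPdist_le => e e0.
    set C : R := (k.+2)`!%:R.
    have C0 : 0 < C by rewrite ltr0n fact_gt0.
    have eC : 0 < e / C by rewrite divr_gt0.
    near=> h.
    rewrite sub0r normrN addr0 fl0 subr0 /GRing.scale /= mulr1 normrM.
    have h0 : h != 0 by near: h; exact: nbhs_dnbhs_neq.
    rewrite (ger0_norm (flat_ge0 k h)).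
    have [hp|hn] := ltP 0 h; last first.
      by rewrite /flat ltNge hn /= mulr0 ltW.
    rewrite normfV ler_pdivrMl ?normr_gt0 //.
    apply: le_trans (flat_bound k hp) _.
    rewrite expr2 mulrA gtr0_norm // [h * e]mulrC ler_pM2r //.
    rewrite mulrC -ler_pdivlMr //; apply/ltW.
    rewrite -[h]gtr0_norm //.
    by near: h; exact: dnbhs0_lt.
  split; first by apply/cvg_ex; exists 0.
  exact: cvg_lim lim.
Unshelve. all: by end_near. Qed.

End FlatFunction.

Section Bump.
Context {R : realType} {m : nat}.

(** The induction on the order has to be uniform in k, since one derivative of [flat k] involves
    [flat k.+1] and [flat k.+2]. *)
Lemma scalar_smooth_flat (U : set 'rV[R]_m) (f : 'rV[R]_m -> R) k : open U ->
  scalar_smooth U f ->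
  scalar_smooth U (fun a => flat k (f a)).
Proof.
move=> oU Cf j.
have dflat i t : differentiable (flat i : R -> R) t.
  by apply/derivable1_diffP; have [] := is_derive_flat i t.
have dfa a : U a -> differentiable f a by exact: scalar_smooth_diff.
elim: j k => [|j IH] k.
  move=> a Ua; apply: differentiable_continuous.
  by apply: (@differentiable_comp _ _ _ _ f (flat k)) => //; exact: dfa.
split=> [a Ua|v].
  by apply: (@differentiable_comp _ _ _ _ f (flat k)) => //; exact: dfa.
have C1 := scalar_CkM oU (scalar_Ck_cst j U (- k%:R)) (IH k.+1).
have C := scalar_CkM oU (scalar_smooth_derive v Cf j) (scalar_CkD oU C1 (IH k.+2)).
apply: scalar_Ck_ext C => // a Ua.
have [_ e] := is_derive_flat k (f a); rewrite -e.
rewrite -[LHS]/('D_v f a *: 'D_1 (flat k : R -> R) (f a)).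
have -> : 'D_v (fun a => flat k (f a)) a = 'D_('D_v f a) (flat k : R -> R) (f a).
  by apply: (@derive_comp _ _ _ _ f (flat k)) => //; exact: dfa.
rewrite !(deriveE _ (dflat _ _)) -linearZ /=; congr ('d _ _ _).
by rewrite /GRing.scale /= mulr1.
Qed.

(** Each clause of [scalar_Ck] concerns one point at a time, so smoothness glues over a cover. *)
Lemma scalar_Ck_setU (U U' : set 'rV[R]_m) k f : scalar_Ck k U f -> scalar_Ck k U' f ->
  scalar_Ck k (U `|` U') f.
Proof.
elim: k f => [|k IH] f; first by move=> c c' a [/c|/c'].
by move=> [d D] [d' D']; split=> [a [/d|/d']|v] //; exact: (IH _ (D v) (D' v)).
Qed.

(** The squared Euclidean distance is used because it is polynomial; it dominates the square of the
    maximum norm, the norm of the library on matrices, whence [bump_support]. *)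
Definition bump (r : R) (c a : 'rV[R]_m) : R :=
  flat 0 (r ^+ 2 - \sum_i (a 0 i - c 0 i) ^+ 2).

Lemma scalar_smooth_bump (U : set 'rV[R]_m) r c : open U -> scalar_smooth U (bump r c).
Proof.
move=> oU; apply: scalar_smooth_flat => //; apply: scalar_smoothD => //;
  first exact: scalar_smooth_cst.
apply: scalar_smoothN => //; apply: scalar_smooth_sum => // i.
have C : scalar_smooth U (fun a => a 0 i - c 0 i).
  by apply: scalar_smoothD => //; [exact: scalar_smooth_coord|exact: scalar_smooth_cst].
by apply: scalar_smooth_ext (scalar_smoothM oU C C).
Qed.

Lemma bump_center r c : 0 < r -> bump r c c != 0.
Proof.
move=> r0; rewrite /bump big1 => [|i _]; last by rewrite subrr expr2 mulr0.
by rewrite subr0 /flat exprn_gt0 // expr0 mul1r expR_eq0.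
Qed.

Lemma bump_support r c a : 0 < r -> bump r c a != 0 -> `|a - c| <= r.
Proof.
move=> r0; rewrite /bump /flat; case: ifP => [|_]; last by rewrite eqxx.
rewrite subr_gt0 => lt _.
rewrite [leLHS]/Num.Def.normr /= mx_normrE; apply: bigmax_le; first exact: ltW.
move=> [i j] _ /=; rewrite !mxE (ord1 i).
have r0' := ltW r0; rewrite -(@ler_pXn2r _ 2) ?nnegrE ?normr_ge0 //.
rewrite real_normK ?num_real //; apply: le_trans (ltW lt).
rewrite (bigD1 j) //= lerDl; apply: sumr_ge0 => k _; exact: sqr_ge0.
Qed.

End Bump.

Section BumpFields.
Context {R : realType} {n : nat} (M : manifold R n).
Implicit Types (x y z : M) (phi psi chi : chart R n M).

(** The field with constant components in the chart is multiplied by a bump function and extended by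
    zero. Global fields with a prescribed value at x are the test fields of the affine
    conditions. *)
Lemma vf_extension x (w : 'rV[R]_n) : exists Y, smooth_vf Y /\ Y x = w.
Proof.
set phi := chart_at x.
have aphi : atlas phi by exact: chart_at_atlas.
have px : cdom phi x by exact: chart_at_dom.
(* Half the radius of an open ball inside the chart image leaves room for a closed ball, which is
   compact. *)
have [r r0 rU] : exists2 r : R, 0 < r &
    [set a | `|a - phi x| <= r] `<=` phi @` cdom phi.
  have /nbhs_ballP[e /= e0 eU] := near_cimg px.
  exists (e / 2); first by rewrite divr_gt0.
  move=> a /= ae; apply: eU; rewrite -ball_normE /= -normrN opprB.
  by apply: le_lt_trans ae _; rewrite ltr_pdivrMr // mulr_natr mulr2n ltrDl.
set K := [set a | `|a - phi x| <= r] in rU.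
have cK : compact K.
  apply: bounded_closed_compact; last first.
    have -> : K = closed_ball_ Num.norm (phi x) r.
      by apply/funext => a; rewrite /K /closed_ball_ /= -normrN opprB.
    exact: closed_closed_ball_.
  exists (r + `|phi x|); split; first by rewrite num_real.
  move=> C rC a Ka; rewrite /= -(subrK (phi x) a).
  apply: le_trans (ler_normD _ _) _; apply: ltW; apply: le_lt_trans rC.
  by rewrite lerD2r.
(* Hausdorffness enters here: the compact ball is closed in all of M, not only in the chart domain,
   so its complement is open and the extension by zero is smooth there. *)
have clK : closed (cinv phi @` K).
  apply: compact_closed; first exact: manifold_hausdorff.
  apply: continuous_compact => //; apply: continuous_in_subspaceT => a.
  by rewrite inE => Ka; apply: cinv_cts; exact: rU.
pose c := (bump r (phi x) (phi x))^-1.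
pose Y z : 'rV[R]_n := if `[< cdom phi z >]
  then (c * bump r (phi x) (phi z)) *: (w *m invmx (tc phi z)) else 0.
exists Y; split; last first.
  rewrite /Y asboolT // mulVf ?bump_center // scale1r.
  by rewrite tc_chart_at invmx1 mulmx1.
move=> chi achi; rewrite vf_repE.
have oO1 := @open_overlap _ _ _ chi phi.
pose W := cdom chi `&` ~` (cinv phi @` K).
have oW : open W by apply: openI; [exact: cdom_open|exact: closed_openC].
have oO2 : open (chi @` W) by apply: open_chart_img => // z [].
(* The chart image is covered by two open sets: the overlap with [phi], where the bump formula
   holds, and the complement of the ball, where the field is zero. *)
have -> : chi @` cdom chi = overlap chi phi `|` chi @` W.
  apply/seteqP; split=> a; last first.
    by case=> -[z [qz _] <-]; exists z.
  move=> [z qz <-]; have [pz|npz] := pselect (cdom phi z).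
    by left; exact: overlapP.
  right; exists z => //; split=> // -[b Kb] e; apply: npz; rewrite -e.
  by have [] := cimgP (rU _ Kb).
apply/smoothE; split; first exact: openU.
move=> i j k; apply: scalar_Ck_setU; move: i j k.
  change (mxsmooth (overlap chi phi) (vrep chi Y)).
  apply: (@mxsmooth_ext _ _ _ _ _ (fun a => (c * bump r (phi x) (tr chi phi a)) *:
      (w *m jac (tr phi chi) (tr chi phi a)))) => //.
    move=> a /overlapE[qa pa ea].
    by rewrite vrepE /Y asboolT // -scalemxAl -mulmxA invmx_tc //.
  have Ct := tr_smooth achi aphi.
  have Ot a : overlap chi phi a -> overlap phi chi (tr chi phi a).
    by move=> /overlapE[qa pa _]; exact: overlapP.
  apply: mxsmoothZ => //.
    apply: scalar_smoothM => //; first exact: scalar_smooth_cst.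
    by apply: (scalar_smooth_comp (U' := setT)) => //; apply: scalar_smooth_bump; exact: openT.
  apply: mxsmoothM => //; first exact: mxsmooth_cst.
  exact: mxsmooth_comp oO1 Ot Ct (mxsmooth_jtr aphi achi).
change (mxsmooth (chi @` W) (vrep chi Y)).
apply: (@mxsmooth_ext _ _ _ _ _ (fun=> 0)) => //; last exact: mxsmooth_cst.
move=> a [z [qz nKz] <-]; rewrite vrep_at // /Y.
have [pz|npz] := pselect (cdom phi z); last by rewrite asboolF // mul0mx.
rewrite asboolT //; have [->|b0] := eqVneq (bump r (phi x) (phi z)) 0.
  by rewrite mulr0 scale0r mul0mx.
exfalso; apply: nKz; exists (phi z); last by rewrite chartK.
exact: bump_support r0 b0.
Qed.

End BumpFields.

(** * Jets of bisections in coordinates *)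

Section Diffeo.
Context {R : realType} {n : nat} (M : manifold R n).
Implicit Types (x y : M) (phi psi : chart R n M) (U W : set M) (f : M -> M).

Definition chart_dom U f phi psi : set M := U `&` cdom phi `&` f @^-1` cdom psi.

(** The inverse supplied by [diffeo_onto_open], read in charts. The last clause says that every
    coordinate near that of f(x) comes from a point z of U, so identities along f become identities
    near the image point. *)
Lemma diffeo_inverse U f x phi psi : diffeo_onto_open U f -> atlas phi -> atlas psi ->
  U x -> cdom phi x -> cdom psi (f x) ->
  exists G : 'rV[R]_n -> 'rV[R]_n, [/\ G (psi (f x)) = phi x,
    differentiable G (psi (f x)),
    (forall z, U z -> cdom phi z -> cdom psi (f z) -> G (psi (f z)) = phi z) &
    \forall c \near psi (f x), exists z,
      [/\ U z, cdom phi z, cdom psi (f z), c = psi (f z) & G c = phi z]].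
Proof.
move=> [oU ofU _ [g [gK sg]]] aphi apsi Ux px qx.
have gK' z : U z -> g (f z) = z by move=> Uz; apply: gK; rewrite inE.
have [oW /smoothE[opW sW]] := sg _ _ apsi aphi; set W' := _ `&` _ in oW opW sW.
have W'x : W' (f x) by rewrite /W'; split => /=; rewrite ?gK' //; split => //; exists x.
exists (phi \o g \o cinv psi); split.
- by rewrite /= chartK // gK'.
- by apply: mxsmooth_diff sW _; exists (f x).
- by move=> z Uz pz qz; rewrite /= chartK // gK'.
have N := near_chart qx (open_nbhs_nbhs (conj oW W'x)).
have N' := near_cimg qx.
near=> c.
have [_ ec] : cdom psi (cinv psi c) /\ psi (cinv psi c) = c by apply: cimgP; near: c.
have : W' (cinv psi c) by near: c.
move=> [[[z Uz efz] qc] /=]; rewrite -efz gK' // => pz.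
by exists z; rewrite ?efz; split => //; rewrite -efz gK'.
Unshelve. all: by end_near. Qed.

Lemma open_chart_dom U f phi psi : diffeo_onto_open U f -> atlas phi -> atlas psi ->
  open (chart_dom U f phi psi).
Proof. by move=> [_ _ sf _] aphi apsi; have [] := sf _ _ aphi apsi. Qed.

Lemma diffeo_rep_diff U f x phi psi : diffeo_onto_open U f -> atlas phi -> atlas psi ->
  U x -> cdom phi x -> cdom psi (f x) ->
  differentiable (fun a => psi (f (cinv phi a))) (phi x).
Proof.
move=> [_ _ sf _] aphi apsi Ux px qx; have [oW /smoothE[opW sW]] := sf _ _ aphi apsi.
by apply: mxsmooth_diff sW _; exists x.
Qed.

Lemma near_chart_dom U f x phi psi : diffeo_onto_open U f -> atlas phi -> atlas psi ->
  U x -> cdom phi x -> cdom psi (f x) ->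
  \forall a \near phi x, chart_dom U f phi psi (cinv phi a).
Proof.
move=> df aphi apsi Ux px qx; apply: near_chart => //.
by apply: open_nbhs_nbhs; split; [exact: open_chart_dom|].
Qed.

Lemma diffeo_jac_inverse U f x phi psi (G : 'rV[R]_n -> 'rV[R]_n) :
  diffeo_onto_open U f -> atlas phi -> atlas psi ->
  U x -> cdom phi x -> cdom psi (f x) ->
  differentiable G (psi (f x)) ->
  (forall z, U z -> cdom phi z -> cdom psi (f z) -> G (psi (f z)) = phi z) ->
  jac (fun a => psi (f (cinv phi a))) (phi x) *m jac G (psi (f x)) = 1%:M.
Proof.
move=> df aphi apsi Ux px qx dG GK.
have e : psi (f x) = psi (f (cinv phi (phi x))) by rewrite chartK.
have dF := diffeo_rep_diff df aphi apsi Ux px qx.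
rewrite e -(jac_comp (f := fun a => psi (f (cinv phi a)))) -?e //.
rewrite -(jac_id (phi x)); apply: jac_near; last first.
  by apply: (differentiable_comp (f := fun a => psi (f (cinv phi a)))); rewrite -?e.
have N := near_chart_dom df aphi apsi Ux px qx; have N' := near_cimg px.
near=> a.
have [_ ea] : cdom phi (cinv phi a) /\ phi (cinv phi a) = a by apply: cimgP; near: a.
have [[Ua pa] qa] : chart_dom U f phi psi (cinv phi a) by near: a.
by rewrite GK.
Unshelve. all: by end_near. Qed.

Lemma diffeo_inj U f x y : diffeo_onto_open U f -> U x -> U y -> f x = f y -> x = y.
Proof.
move=> [_ _ _ [g [gK _]]] Ux Uy e.
by rewrite -(gK x) ?inE // e gK ?inE.
Qed.

End Diffeo.

(** * Jets of bisections of an arbitrary groupoid *)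

Section GenericJets.
Context {R : realType} {n : nat} (M : manifold R n) (G : groupoid M).
Implicit Types (x y : M) (phi psi : chart R n M) (U W : set M) (b c : M -> gsort G).

Lemma sjetE x b c : sjet x b c <->
  b x = c x /\ forall phi psi, atlas phi -> atlas psi ->
    cdom phi x -> cdom psi (gtgt (b x)) ->
    jac (srep phi psi b) (phi x) = jac (srep phi psi c) (phi x).
Proof. by rewrite !unlock. Qed.

Lemma sjet_refl x b : sjet x b b.
Proof. by apply/sjetE. Qed.

Lemma j1E x b : j1 x b = jet1 x b.
Proof. by rewrite unlock. Qed.

Lemma sec_repE phi psi b : sec_rep phi psi b = srep phi psi b.
Proof. by rewrite unlock. Qed.

Lemma jet1_mem x b d :
  (jet1 x b).2 d <-> [/\ local_bisection d.1 d.2, d.1 x & sjet x b d.2].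
Proof. by rewrite !unlock. Qed.

Lemma sjet_sym x b c : sjet x b c -> sjet x c b.
Proof.
move=> /sjetE[e J]; apply/sjetE.
by split=> // phi psi aphi apsi px; rewrite -e => qx; rewrite J.
Qed.

Lemma sjet_trans x b c d : sjet x b c -> sjet x c d -> sjet x b d.
Proof.
move=> /sjetE[e J] /sjetE[e' J']; apply/sjetE.
split=> [|phi psi aphi apsi px qx]; first by rewrite e.
by rewrite J // J' // -e.
Qed.

Lemma jet1_src x b : (jet1 x b).1 = x.
Proof. by rewrite unlock. Qed.

Lemma jet1_eq x b c : sjet x b c -> jet1 x b = jet1 x c.
Proof.
move=> bc; rewrite (surjective_pairing (jet1 x b)) (surjective_pairing (jet1 x c)).
rewrite !jet1_src; congr pair; apply/seteqP.
split=> d /jet1_mem[lb dx jd]; apply/jet1_mem; apply: And3 lb dx _.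
  exact: sjet_trans (sjet_sym bc) jd.
exact: sjet_trans bc jd.
Qed.

Lemma jet1_inj U x b c : local_bisection U b -> U x -> jet1 x b = jet1 x c -> sjet x b c.
Proof.
move=> lb Ux e; apply: sjet_sym.
have : (jet1 x b).2 (U, b) by apply/jet1_mem; apply: And3 lb Ux _; exact: sjet_refl.
by rewrite e => /jet1_mem[_ _]; exact.
Qed.

(** The chosen representative shares the jet of [b] and nothing more; [b] itself shows that the
    class is inhabited. *)
Lemma jet_rep_jet1 U x b : local_bisection U b -> U x ->
  let c := jet_rep (jet1 x b) in
  [/\ local_bisection c.1 c.2, c.1 x & sjet x b c.2].
Proof.
move=> lb Ux c; apply/jet1_mem; rewrite /c /jet_rep; apply: (@xgetI {classic (set M * (M ->
  gsort G))} _ _ (U, b)).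
by apply/jet1_mem; apply: And3 lb Ux _; exact: sjet_refl.
Qed.

Lemma jet_val_jet1 U x b : local_bisection U b -> U x -> jet_val (jet1 x b) = b x.
Proof. by move=> lb Ux; have [_ _ /sjetE[e _]] := jet_rep_jet1 lb Ux;
  rewrite /jet_val jet1_src e. Qed.

Lemma jet_arr_jet1 U x b : local_bisection U b -> U x -> jet_arr (jet1 x b).
Proof. by move=> lb Ux; exists U, b; rewrite jet1_src j1E. Qed.

Lemma jet_repP z : jet_arr (G := G) z ->
  [/\ local_bisection (jet_rep z).1 (jet_rep z).2, (jet_rep z).1 z.1
    & z = jet1 z.1 (jet_rep z).2].
Proof.
move=> [U [b [lb Uz]]]; rewrite j1E => ez.
have := jet_rep_jet1 lb Uz; rewrite -ez => -[l u j]; apply: And3 l u _.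
by rewrite {1}ez; exact: jet1_eq.
Qed.

Lemma section_smooth U b phi psi : smooth_section U b -> atlas phi -> atlas psi ->
  let W := chart_dom U (fun x => gtgt (b x)) phi psi in
  [/\ open W, open (phi @` W) & mxsmooth (phi @` W) (srep phi psi b)].
Proof. by move=> [_ _ sb] aphi apsi; have [? /smoothE[]] := sb _ _ aphi apsi;
  rewrite sec_repE. Qed.

Lemma section_diff U b x phi psi : smooth_section U b -> atlas phi -> atlas psi ->
  U x -> cdom phi x -> cdom psi (gtgt (b x)) ->
  differentiable (srep phi psi b) (phi x).
Proof.
move=> sb aphi apsi Ux px qx; have [_ _ sW] := section_smooth sb aphi apsi.
by apply: mxsmooth_diff sW _; exists x.
Qed.

Lemma section_src U b x : smooth_section U b -> U x -> gsrc (b x) = x.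
Proof. by move=> [_ + _] Ux => /(_ x Ux)[]. Qed.

Lemma section_arr U b x : smooth_section U b -> U x -> garr G (b x).
Proof. by move=> [_ + _] Ux => /(_ x Ux)[]. Qed.

Lemma sjet_jac x b c phi psi : sjet x b c -> atlas phi -> atlas psi ->
  cdom phi x -> cdom psi (gtgt (b x)) ->
  jac (srep phi psi b) (phi x) = jac (srep phi psi c) (phi x).
Proof. by move=> /sjetE[_ J]; exact: J. Qed.

End GenericJets.

(** * Bisections of [B1] in a pair of charts *)

Section LinearFrames.
Context {R : realType} {n : nat} (M : manifold R n).
Implicit Types (x y z : M) (phi psi : chart R n M) (U W : set M) (b : M -> gsort (B1 M)).

Definition lmat phi psi (xi : gsort (B1 M)) : 'M[R]_n :=
  invmx (tc phi (lsrc xi)) *m lmx xi *m tc psi (ltgt xi).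
(** [bas] and [mat] are the maps beta and B of the overview. *)
Definition bas phi psi b (a : 'rV[R]_n) : 'rV[R]_n := psi (ltgt (b (cinv phi a))).
Definition mat phi psi b (a : 'rV[R]_n) : 'M[R]_n := lmat phi psi (b (cinv phi a)).

Lemma srep_B1 phi psi b :
  srep phi psi b = fun a => row_mx (bas phi psi b a) (mxvec (mat phi psi b a)).
Proof.
rewrite -sec_repE; apply/funext => a.
by rewrite /sec_rep /bas /mat /lmat -!tcoordE.
Qed.

Lemma bas_at phi psi b x : cdom phi x -> bas phi psi b (phi x) = psi (ltgt (b x)).
Proof. by move=> px; rewrite /bas chartK. Qed.

Lemma mat_at phi psi b x : cdom phi x -> mat phi psi b (phi x) = lmat phi psi (b x).
Proof. by move=> px; rewrite /mat chartK. Qed.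

Lemma mxsmooth_srep_B1 (O : set 'rV[R]_n) phi psi b : open O ->
  mxsmooth O (srep phi psi b) <->
  mxsmooth O (bas phi psi b) /\ mxsmooth O (mat phi psi b).
Proof.
move=> oO; rewrite srep_B1; split=> [C|[C1 C2]]; last first.
  by apply: mxsmooth_row_mx => //; exact: (mxsmooth_lin mxvec).
split.
  apply: mxsmooth_ext oO _ (mxsmooth_lin lsubmx oO C) => a _.
  by rewrite /= row_mxKl.
have C' := mxsmooth_lin vec_mx oO (mxsmooth_lin rsubmx oO C).
by apply: mxsmooth_ext oO _ C' => a _; rewrite /= row_mxKr mxvecK.
Qed.

Lemma ddir_srep_B1 phi psi b a v : differentiable (bas phi psi b) a ->
  differentiable (mat phi psi b) a ->
  ddir (srep phi psi b) a v =
  row_mx (ddir (bas phi psi b) a v) (mxvec (ddir (mat phi psi b) a v)).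
Proof.
move=> d1 d2; rewrite srep_B1 ddir_row_mx //.
  by rewrite (ddir_lin mxvec).
exact: (differentiable_lin_comp mxvec).
Qed.

Lemma lmat_unit phi psi (xi : gsort (B1 M)) : garr (B1 M) xi ->
  atlas phi -> atlas psi -> cdom phi (lsrc xi) -> cdom psi (ltgt xi) ->
  lmat phi psi xi \in unitmx.
Proof.
move=> uxi aphi apsi px qy; rewrite /lmat unitmx_mul; apply/andP; split; last exact: tc_unit.
by rewrite unitmx_mul unitmx_inv; apply/andP; split; [exact: tc_unit|exact: uxi].
Qed.

Section AtPoint.
Variables (U : set M) (b : M -> gsort (B1 M)) (x : M) (phi psi : chart R n M).
Hypotheses (lb : local_bisection U b) (Ux : U x) (aphi : atlas phi)
  (apsi : atlas psi) (px : cdom phi x) (qx : cdom psi (ltgt (b x))).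

Let db : diffeo_onto_open U (fun z => ltgt (b z)) := proj2 lb.

Lemma bas_diff : differentiable (bas phi psi b) (phi x).
Proof. exact: (diffeo_rep_diff db). Qed.

Lemma mat_diff : differentiable (mat phi psi b) (phi x).
Proof.
have [_ opW /mxsmooth_srep_B1[] // _ sW] := section_smooth lb.1 aphi apsi.
by apply: mxsmooth_diff sW _; exists x.
Qed.

Lemma section_lsrc z : U z -> lsrc (b z) = z.
Proof. exact: (section_src lb.1). Qed.

Lemma section_unit z : U z -> lmx (b z) \in unitmx.
Proof. exact: (section_arr lb.1). Qed.

(** With G the local inverse of f in coordinates, K coincides with H o G near the image point, and
    the Jacobians of f and G cancel. It serves for fields on the target that are known only through
    their values at the points f(z). *)
Lemma diffeo_transport p q f (H K : 'rV[R]_n -> 'M[R]_(p, q)) :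
  diffeo_onto_open U f -> cdom psi (f x) ->
  (forall z, U z -> cdom phi z -> cdom psi (f z) -> K (psi (f z)) = H (phi z)) ->
  differentiable H (phi x) ->
  differentiable K (psi (f x)) /\
  forall v, ddir K (psi (f x)) (v *m jac (fun a => psi (f (cinv phi a))) (phi x)) =
            ddir H (phi x) v.
Proof.
move=> df qfx KH dH.
have [G [Gx dG GK N]] := diffeo_inverse df aphi apsi Ux px qfx.
have KHG : \forall c \near psi (f x), H (G c) = K c.
  by apply: filterS N => c [z [Uz pz qz -> ->]]; rewrite KH.
have dHG : differentiable (fun c => H (G c)) (psi (f x)).
  by apply: (differentiable_comp (f := G)) => //; rewrite Gx.
split=> [|v]; first exact: differentiable_near KHG dHG.
rewrite -(ddir_near _ KHG) ddir_comp ?Gx // -(mul_jac _ dG) -mulmxA.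
by rewrite (diffeo_jac_inverse df) // mulmx1.
Qed.

Lemma lmx_tc : lmx (b x) *m tc psi (ltgt (b x)) =
  tc phi x *m lmat phi psi (b x).
Proof.
by rewrite /lmat section_lsrc // -mulmxA mulKVmx // tc_unit.
Qed.

Lemma app_tc v : app (b x) v *m tc psi (ltgt (b x)) =
  v *m tc phi x *m lmat phi psi (b x).
Proof. by rewrite /app -!mulmxA lmx_tc. Qed.

(** [tangent_map] is taken in the preferred charts of x and f(x); any other coordinate expression of
    f factors through it by transition maps. *)
Lemma tangent_map_rep f : diffeo_onto_open U f -> cdom psi (f x) ->
  jac (fun a => psi (f (cinv phi a))) (phi x) =
  invmx (tc phi x) *m tangent_map f x *m tc psi (f x).
Proof.
move=> df qfx; set chi := chart_at x; set chi' := chart_at (f x).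
have achi : atlas chi by exact: chart_at_atlas.
have achi' : atlas chi' by exact: chart_at_atlas.
have cx : cdom chi x by exact: chart_at_dom.
have cfx : cdom chi' (f x) by exact: chart_at_dom.
rewrite -[invmx _]mulmx1 -(tc_chart_at x) invmx_tc // tcE.
rewrite /tangent_map jacE /jtr.
set h := chi' \o f \o cinv chi.
have dh : differentiable h (chi x) by exact: (diffeo_rep_diff df).
have e1 : chi x = tr phi chi (phi x) by rewrite /tr chartK.
have e2 : chi' (f x) = h (tr phi chi (phi x)) by rewrite -e1 /h /= chartK.
have d1 : differentiable (tr phi chi) (phi x) by exact: tr_diff.
have d2 : differentiable (tr chi' psi) (chi' (f x)) by exact: tr_diff.
rewrite -/chi' e1 e2 -(jac_comp d1); last by rewrite -e1.
have d12 : differentiable (fun a => h (tr phi chi a)) (phi x).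
  by apply: (differentiable_comp d1); rewrite -e1.
rewrite -(jac_comp d12); last by rewrite -e2.
apply/esym/jac_near; last by apply: (differentiable_comp d12); rewrite -e2.
have N1 := near_chart_dom df aphi apsi Ux px qfx.
have N2 := near_chart_dom df aphi achi' Ux px cfx.
have N3 := near_chart px (open_nbhs_nbhs (conj (cdom_open chi) cx)).
near=> a.
have [_ q1] : chart_dom U f phi psi (cinv phi a) by near: a.
have [_ q2] : chart_dom U f phi chi' (cinv phi a) by near: a.
have q3 : cdom chi (cinv phi a) by near: a.
by rewrite /h /tr /= chartK // chartK.
Unshelve. all: by end_near. Qed.

(** [push] recovers the source point by choice; injectivity of the base map forces that choice to be
    z. *)
Lemma push_at Y z : U z -> push U b Y (ltgt (b z)) = app (b z) (Y z).
Proof.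
move=> Uz; rewrite /push /=; set S := [set x' | _].
have [Uz' e] : S (xget (ltgt (b z)) S) by apply: (@xgetI _ _ S z).
by rewrite (diffeo_inj db Uz' Uz e).
Qed.

End AtPoint.

Lemma push_rep U b Y z phi psi : local_bisection U b -> U z -> atlas phi ->
  cdom phi z -> cdom psi (ltgt (b z)) ->
  vrep psi (push U b Y) (psi (ltgt (b z))) = vrep phi Y (phi z) *m mat phi psi b (phi z).
Proof.
move=> lb Uz aphi pz qz.
rewrite !vrep_at // (push_at lb) // mat_at //.
exact: (app_tc psi lb Uz aphi pz).
Qed.

(** Product rule for the components of Y times the matrix part of b, carried to the target; the
    directions reached are those of the form v J. *)
Lemma push_ddir U b Y x phi psi : local_bisection U b -> U x -> atlas phi -> atlas psi ->
  cdom phi x -> cdom psi (ltgt (b x)) ->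
  differentiable (vrep phi Y) (phi x) ->
  differentiable (vrep psi (push U b Y)) (psi (ltgt (b x))) /\
  forall v, ddir (vrep psi (push U b Y)) (psi (ltgt (b x)))
                 (v *m jac (bas phi psi b) (phi x)) =
    ddir (vrep phi Y) (phi x) v *m lmat phi psi (b x) +
    Y x *m tc phi x *m ddir (mat phi psi b) (phi x) v.
Proof.
move=> lb Ux aphi apsi px qx dY.
have dm := mat_diff lb Ux aphi apsi px qx.
have [] := @diffeo_transport U x phi psi Ux aphi apsi px _ _ (fun z => ltgt (b z))
  (fun a => vrep phi Y a *m mat phi psi b a) (vrep psi (push U b Y)) lb.2 qx.
- by move=> z Uz pz qz; rewrite (push_rep Y lb Uz aphi pz qz).
- exact: differentiable_mulmx.
- move=> dK DK; split => // v; rewrite DK ddirM // mat_at // vrep_at //.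
Qed.

End LinearFrames.

(** * Jets of order (1,1) in charts, and semiholonomy *)

Section SecondOrderCoordinates.
Context {R : realType} {n : nat} (M : manifold R n).
Implicit Types (x y z : M) (phi psi : chart R n M) (U W : set M) (b : M -> gsort (B1 M)).

Lemma srep_B11 phi psi (e : M -> gsort (B11 M)) a :
  srep phi psi e a =
  row_mx (psi (ltgt (jet_val (e (cinv phi a)))))
    (row_mx (mxvec (lmat phi psi (jet_val (e (cinv phi a)))))
      (mxvec (jac (srep phi psi (jet_rep (e (cinv phi a))).2)
                  (phi (e (cinv phi a)).1)))).
Proof. by rewrite -sec_repE /sec_rep /lmat -!tcoordE -jacE -sec_repE. Qed.

(** The representative inside [srep] enters through its value and Jacobian alone, so it may be
    replaced by any b with the same jet. *)
Lemma srep_B11_jet1 phi psi (e : M -> gsort (B11 M)) U b x :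
  atlas phi -> atlas psi ->
  local_bisection U b -> U x -> e x = jet1 x b -> cdom phi x -> cdom psi (ltgt (b x)) ->
  srep phi psi e (phi x) =
  row_mx (bas phi psi b (phi x))
    (row_mx (mxvec (mat phi psi b (phi x))) (mxvec (jac (srep phi psi b) (phi x)))).
Proof.
move=> aphi apsi lb Ux ex px qx.
rewrite srep_B11 chartK // ex (jet_val_jet1 lb Ux) jet1_src.
rewrite bas_at // mat_at //; congr (row_mx _ (row_mx _ (mxvec _))).
have [_ _ J] := jet_rep_jet1 lb Ux.
by rewrite (sjet_jac J).
Qed.

(* Reads off the derivative of the matrix part of a (1,1)-jet from its coordinates. *)
Definition jet_mat (v : 'rV[R]_n) (c : 'rV[R]_(n + gdim (B11 M))) : 'M[R]_n :=
  vec_mx (rsubmx (v *m vec_mx (rsubmx (rsubmx c : 'rV[R]_(n * n + n * (n + n * n)))))).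

Lemma mul_jac_srep U b x phi psi v : local_bisection U b -> U x ->
  atlas phi -> atlas psi -> cdom phi x -> cdom psi (ltgt (b x)) ->
  v *m jac (srep phi psi b) (phi x) =
  row_mx (ddir (bas phi psi b) (phi x) v) (mxvec (ddir (mat phi psi b) (phi x) v)).
Proof.
move=> lb Ux aphi apsi px qx.
rewrite mul_jac; last exact: (section_diff lb.1 aphi apsi Ux px).
rewrite ddir_srep_B1 //; first exact: (bas_diff lb Ux).
exact: (mat_diff lb Ux).
Qed.

Lemma jet_mat_srep phi psi (e : M -> gsort (B11 M)) U b x v :
  atlas phi -> atlas psi ->
  local_bisection U b -> U x -> e x = jet1 x b -> cdom phi x -> cdom psi (ltgt (b x)) ->
  jet_mat v (srep phi psi e (phi x)) = ddir (mat phi psi b) (phi x) v.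
Proof.
move=> aphi apsi lb Ux ex px qx.
rewrite (srep_B11_jet1 (b := b) (U := U)) // /jet_mat row_mxKr row_mxKr mxvecK.
by rewrite (mul_jac_srep _ lb Ux) // row_mxKr mxvecK.
Qed.

Lemma sjet_B1P x b c U W : local_bisection U b -> local_bisection W c -> U x -> W x ->
  sjet x b c <-> b x = c x /\ forall phi psi, atlas phi -> atlas psi ->
    cdom phi x -> cdom psi (ltgt (b x)) ->
    forall v, ddir (bas phi psi b) (phi x) v = ddir (bas phi psi c) (phi x) v /\
              ddir (mat phi psi b) (phi x) v = ddir (mat phi psi c) (phi x) v.
Proof.
move=> lb lc Ux Wx; split=> [/sjetE[e J]|[e J]].
  split=> // phi psi aphi apsi px qx v.
  have qx' : cdom psi (ltgt (c x)) by rewrite -e.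
  have := congr1 (mulmx v) (J phi psi aphi apsi px qx).
  rewrite (mul_jac_srep _ lb Ux) // (mul_jac_srep _ lc Wx) //.
  by move=> /eq_row_mx[-> /(can_inj mxvecK) ->].
apply/sjetE; split=> // phi psi aphi apsi px qx.
have qx' : cdom psi (ltgt (c x)) by rewrite -e.
apply: mul_rV_eqP => v; have [e1 e2] := J phi psi aphi apsi px qx v.
by rewrite (mul_jac_srep _ lb Ux) // (mul_jac_srep _ lc Wx) // e1 e2.
Qed.

Lemma lmat_pstar11 (z : gsort (B11 M)) phi psi : jet_arr z ->
  let b := (jet_rep z).2 in
  atlas phi -> atlas psi -> cdom phi z.1 -> cdom psi (ltgt (b z.1)) ->
  lmat phi psi (pstar11 z) = jac (bas phi psi b) (phi z.1).
Proof.
move=> /jet_repP[lb Uz _] b aphi apsi px qx; rewrite /bas.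
by rewrite (tangent_map_rep Uz aphi apsi px lb.2).
Qed.

Lemma lsrc_pstar11 (z : gsort (B11 M)) : lsrc (pstar11 z) = z.1.
Proof. by []. Qed.

Lemma ltgt_pstar11 (z : gsort (B11 M)) : ltgt (pstar11 z) = ltgt ((jet_rep z).2 z.1).
Proof. by []. Qed.

Lemma semiholonomic_jac (z : gsort (B11 M)) phi psi : semiholonomic z ->
  let b := (jet_rep z).2 in
  atlas phi -> atlas psi -> cdom phi z.1 -> cdom psi (ltgt (b z.1)) ->
  jac (bas phi psi b) (phi z.1) = lmat phi psi (b z.1).
Proof.
move=> [az e] b aphi apsi px qx.
by rewrite -lmat_pstar11 // -e.
Qed.

Lemma lmat_inj phi psi (xi zeta : gsort (B1 M)) : atlas phi -> atlas psi ->
  cdom phi (lsrc xi) -> cdom psi (ltgt xi) ->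
  lsrc xi = lsrc zeta -> ltgt xi = ltgt zeta ->
  lmat phi psi xi = lmat phi psi zeta -> xi = zeta.
Proof.
case: xi => x y A; case: zeta => x' y' B /= aphi apsi px qy ex ey; subst x' y'.
rewrite /lmat /= => e; congr Linmap.
have ux := tc_unit aphi px; have uy := tc_unit apsi qy.
have := congr1 (fun C => tc phi x *m C *m invmx (tc psi y)) e.
by rewrite /= -!mulmxA mulmxV // !mulmx1 !mulKVmx.
Qed.

(** One pair of charts suffices: an arrow with known source and target is determined by its matrix
    in one such pair. *)
Lemma semiholonomic_jet1 U b x phi psi : local_bisection U b -> U x ->
  atlas phi -> atlas psi -> cdom phi x -> cdom psi (ltgt (b x)) ->
  jac (bas phi psi b) (phi x) = lmat phi psi (b x) <-> semiholonomic (jet1 x b).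
Proof.
move=> lb Ux aphi apsi px qx.
have [lc Ux' J] := jet_rep_jet1 lb Ux; have /sjetE[e _] := J.
have /(sjet_B1P lb lc Ux Ux')[_ J'] := J.
have qx' : cdom psi (ltgt ((jet_rep (jet1 x b)).2 x)) by rewrite -e.
have eJ : jac (bas phi psi b) (phi x) = jac (bas phi psi (jet_rep (jet1 x b)).2) (phi x).
  apply/jac_eqP; [exact: (bas_diff lb Ux)|exact: (bas_diff lc Ux')|].
  by move=> v; have [] := J' phi psi aphi apsi px qx v.
have src := section_lsrc lb Ux.
have := @lmat_pstar11 (jet1 x b) phi psi (jet_arr_jet1 lb Ux).
cbv zeta; rewrite jet1_src => /(_ aphi apsi px qx') eP.
rewrite eJ -eP; split=> [H|[_]].
  split; first exact: jet_arr_jet1 lb Ux.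
  rewrite /p11 (jet_val_jet1 lb Ux); apply/esym.
  have s1 : lsrc (pstar11 (jet1 x b)) = x by rewrite lsrc_pstar11 jet1_src.
  have s2 : ltgt (pstar11 (jet1 x b)) = ltgt (b x).
    by rewrite ltgt_pstar11 jet1_src -e.
  by apply: lmat_inj H; rewrite ?s1 ?s2 ?src.
by rewrite /p11 (jet_val_jet1 lb Ux) => ->.
Qed.

End SecondOrderCoordinates.

(** * The connection of a symmetry jet *)

Section SymmetryConnection.
Context {R : realType} {n : nat} (M : manifold R n).
Implicit Types (x y z : M) (phi psi : chart R n M) (U W : set M) (b : M -> gsort (B1 M)).
Implicit Types (X Y Z : M -> 'rV[R]_n).
Variables (s : M -> gsort (B11 M)) (hs : symmetry_jet s).

Lemma symmetry_rep x : let c := jet_rep (s x) in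
  [/\ local_bisection c.1 c.2, c.1 x, c.2 x = Linmap x x (- 1%:M) & s x = jet1 x c.2].
Proof.
move=> c; have [ss /(_ x)[[as_ _] ps]] := hs.
have sx : (s x).1 = x by exact: (section_src ss).
have [lc] := jet_repP as_; rewrite -/c sx => cx e; split=> //.
by rewrite -ps /p11 /jet_val sx.
Qed.

Lemma ltgt_symmetry x : ltgt (jet_val (s x)) = x.
Proof. by have [_ /(_ x)[_]] := hs; rewrite /p11 => ->. Qed.

Lemma lmat_symmetry phi x : atlas phi -> cdom phi x ->
  lmat phi phi ((jet_rep (s x)).2 x) = - 1%:M.
Proof.
move=> aphi px; have [_ _ -> _] := symmetry_rep x.
by rewrite /lmat /= mulmxN mulNmx mulmx1 mulVmx ?tc_unit.
Qed.

Lemma jac_symmetry phi x : atlas phi -> cdom phi x ->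
  jac (bas phi phi (jet_rep (s x)).2) (phi x) = - 1%:M.
Proof.
move=> aphi px; have [lc cx ec e] := symmetry_rep x.
have [_ /(_ x)[ssx _]] := hs.
have sx : (s x).1 = x by rewrite e jet1_src.
have := @semiholonomic_jac _ _ _ (s x) phi phi ssx.
by cbv zeta; rewrite sx lmat_symmetry // => -> //; rewrite ec.
Qed.

(* The Christoffel form of the connection in the chart phi. *)
Definition chris phi (a v w : 'rV[R]_n) : 'rV[R]_n :=
  - (2^-1 *: (w *m jet_mat v (srep phi phi s a))).

Lemma jet_mat_linear k (u v : 'rV[R]_n) (c : 'rV[R]_(n + gdim (B11 M))) :
  jet_mat (k *: u + v) c = k *: jet_mat u c + jet_mat v c.
Proof. by rewrite /jet_mat mulmxDl -scalemxAl !linearP. Qed.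

Lemma chris_linearl phi a k u v w :
  chris phi a (k *: u + v) w = k *: chris phi a u w + chris phi a v w.
Proof.
rewrite /chris jet_mat_linear mulmxDr -scalemxAr scalerDr opprD scalerN.
by rewrite !scalerA mulrC.
Qed.

Lemma symmetry_section_smooth phi : atlas phi ->
  mxsmooth (phi @` cdom phi) (srep phi phi s).
Proof.
move=> aphi; have [_ _] := section_smooth hs.1 aphi aphi.
apply: mxsmooth_sub => a [x px <-]; exists x => //.
by split; [split|rewrite /= ltgt_symmetry].
Qed.

Lemma mxsmooth_chris m (O : set 'rV[R]_m) phi (a v w : 'rV[R]_m -> 'rV[R]_n) :
  open O -> atlas phi -> (forall t, O t -> (phi @` cdom phi) (a t)) ->
  mxsmooth O a -> mxsmooth O v -> mxsmooth O w ->
  mxsmooth O (fun t => chris phi (a t) (v t) (w t)).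
Proof.
move=> oO aphi Oa Ca Cv Cw; apply: mxsmoothN => //; apply: mxsmoothZ => //.
  exact: scalar_smooth_cst.
apply: mxsmoothM => //.
have Cs := mxsmooth_comp oO Oa Ca (symmetry_section_smooth aphi).
apply: (mxsmooth_lin vec_mx oO); apply: (mxsmooth_lin rsubmx oO).
apply: mxsmoothM => //; apply: (mxsmooth_lin vec_mx oO).
by apply: (mxsmooth_lin rsubmx oO (mxsmooth_lin rsubmx oO Cs)).
Qed.

Lemma half_double (u : 'rV[R]_n) : 2^-1 *: (u + u) = u.
Proof.
rewrite -{1 2}[u]scale1r -scalerDl scalerA (_ : 1 + 1 = 2%:R :> R) //.
by rewrite mulVf ?scale1r ?pnatr_eq0.
Qed.

(** Where Y vanishes, the product rule loses the term that differentiates the transition matrix, and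
    the derivative of Y transforms as a tensor. [lie_bracket] lives in the preferred chart; this
    moves it to another one. *)
Lemma vrep_diff phi psi Y x : atlas phi -> atlas psi -> cdom phi x -> cdom psi x ->
  differentiable (vrep phi Y) (phi x) ->
  differentiable (vrep psi Y) (psi x) /\
  (Y x = 0 -> forall v, ddir (vrep psi Y) (psi x) v =
    ddir (vrep phi Y) (phi x) (v *m jtr psi phi x) *m jtr phi psi x).
Proof.
move=> aphi apsi px qx dY.
have e : phi x = tr psi phi (psi x) by rewrite /tr chartK.
have dt : differentiable (tr psi phi) (psi x) by exact: tr_diff.
have dYt : differentiable (fun a => vrep phi Y (tr psi phi a)) (psi x).
  by apply: (differentiable_comp dt); rewrite -e.
have dJt : differentiable (fun a => jac (tr phi psi) (tr psi phi a)) (psi x).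
  apply: (differentiable_comp dt (g := jac (tr phi psi))); rewrite -e.
  exact: mxsmooth_diff (mxsmooth_jtr aphi apsi) (overlapP px qx).
have N : \forall a \near psi x,
    vrep phi Y (tr psi phi a) *m jac (tr phi psi) (tr psi phi a) = vrep psi Y a.
  have oO := open_nbhs_nbhs (conj (@open_overlap _ _ _ psi phi) (overlapP qx px)).
  by apply: filterS oO => a Oa; rewrite (vrep_tr Y apsi aphi Oa).
split=> [|Y0 v].
  by apply: differentiable_near N _; exact: differentiable_mulmx.
rewrite -(ddir_near v N) ddirM // -e vrep_at // Y0 !mul0mx addr0.
by rewrite ddir_comp -?e // -(mul_jac _ dt).
Qed.

(** The field F = Y + sY is zero at x, so [X, F] is D_X F. As s has both matrix part and base
    derivative -1 at x, D_X F = 2 D_X Y - Y D_X S, and the factor 1/2 of [nabla] gives the usual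
    form. *)
Lemma nabla_coord X Y x phi : atlas phi -> cdom phi x ->
  differentiable (vrep phi Y) (phi x) ->
  nabla s X Y x *m tc phi x =
  ddir (vrep phi Y) (phi x) (X x *m tc phi x) +
  chris phi (phi x) (X x *m tc phi x) (Y x *m tc phi x).
Proof.
move=> aphi px dY; have [lc cx ec e] := symmetry_rep x.
rewrite /nabla; set c := jet_rep (s x) in lc cx ec e *.
set F := fun x' => _; pose chi := chart_at x.
have achi : atlas chi by exact: chart_at_atlas.
have chix : cdom chi x by exact: chart_at_dom.
have qx : cdom phi (ltgt (c.2 x)) by rewrite ec.
have F0 : F x = 0.
  rewrite /F; have {2}-> : x = ltgt (c.2 x) by rewrite ec.
  by rewrite (push_at lc) // ec /app /= mulmxN mulmx1 subrr.
have [dP DP] := push_ddir lc cx aphi aphi px qx dY.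
rewrite ec /= in dP DP.
have dF : vrep phi F = fun a => vrep phi Y a + vrep phi (push c.1 c.2 Y) a.
  by apply/funext => a; rewrite !vrepE /F mulmxDl.
have dFx : differentiable (vrep phi F) (phi x) by rewrite dF; exact: differentiableD.
have [dFc DFc] := vrep_diff aphi achi px chix dFx.
rewrite /lie_bracket -/chi !vf_repE !ddirE F0 ddir0 subr0 DFc // -scalemxAl -mulmxA.
have -> : jtr phi chi x *m tc phi x = 1%:M.
  by rewrite tcE -/chi jtrV.
rewrite mulmx1.
have -> : jtr chi phi x = tc phi x by rewrite tcE.
rewrite dF ddirD //; set v := X x *m tc phi x.
(* The base map of the symmetry has derivative -1, so the derivative of sY along v is reached from
   the direction -v. *)
have := DP (- v); rewrite jac_symmetry // mulmxN mulmx1 opprK => ->.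
have := @lmat_symmetry phi x aphi px; rewrite -/c ec => ->.
rewrite mulmxN mulmx1.
have dm : differentiable (mat phi phi c.2) (phi x) by exact: (mat_diff lc cx).
have lin (p q : nat) (A : 'rV[R]_n -> 'M[R]_(p, q)) a : differentiable A a ->
    ddir A a (- v) = - ddir A a v.
  by move=> dA; rewrite -scaleN1r ddir_scaler // scaleN1r.
rewrite !lin // opprK mulmxN addrA scalerBr.
rewrite half_double.
rewrite /chris (jet_mat_srep (b := c.2) (U := c.1)) //.
Qed.

End SymmetryConnection.

(** * Affine (1,1)-jets *)

Section AffineJets.
Context {R : realType} {n : nat} (M : manifold R n).
Implicit Types (x y z : M) (phi psi : chart R n M) (U W : set M) (b : M -> gsort (B1 M)).
Implicit Types (X Y Z : M -> 'rV[R]_n).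
Variables (s : M -> gsort (B11 M)) (hs : symmetry_jet s).

Lemma const_vf_at x v : const_vf x v x = v.
Proof. by rewrite /const_vf tcoordE tc_chart_at invmx1 mulmx1. Qed.

Lemma nabla_at_coord x v Y phi : atlas phi -> cdom phi x ->
  differentiable (vrep phi Y) (phi x) ->
  nabla_at s x v Y *m tc phi x = ddir (vrep phi Y) (phi x) (v *m tc phi x) +
  chris s phi (phi x) (v *m tc phi x) (Y x *m tc phi x).
Proof. by move=> aphi px dY; rewrite /nabla_at (nabla_coord hs) // const_vf_at. Qed.

Lemma mul_tc_inj phi x (v w : 'rV[R]_n) : atlas phi -> cdom phi x ->
  v *m tc phi x = w *m tc phi x -> v = w.
Proof. by move=> aphi px; apply: (can_inj (mulmxK _)); exact: tc_unit. Qed.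

(** The direction u is tied to v by the base derivative J, not by the matrix part of b. The formula
    therefore also covers bisections that are not semiholonomic at x. *)
Lemma nabla_at_push U b x u v Z phi psi : local_bisection U b -> U x ->
  atlas phi -> atlas psi -> cdom phi x -> cdom psi (ltgt (b x)) ->
  differentiable (vrep phi Z) (phi x) ->
  u *m tc psi (ltgt (b x)) = v *m jac (bas phi psi b) (phi x) ->
  nabla_at s (ltgt (b x)) u (push U b Z) *m tc psi (ltgt (b x)) =
  ddir (vrep phi Z) (phi x) v *m lmat phi psi (b x) +
  Z x *m tc phi x *m ddir (mat phi psi b) (phi x) v +
  chris s psi (psi (ltgt (b x))) (u *m tc psi (ltgt (b x)))
    (Z x *m tc phi x *m lmat phi psi (b x)).
Proof.
move=> lb Ux aphi apsi px qx dZ e.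
have [dP DP] := push_ddir lb Ux aphi apsi px qx dZ.
by rewrite nabla_at_coord // {1}e DP (push_at lb) // (app_tc psi lb Ux aphi px).
Qed.

(* The matrix derivative of the affine (1,1)-jet with matrix B from a to c. *)
Definition aff phi psi (a c : 'rV[R]_n) (B : 'M[R]_n) (v w : 'rV[R]_n) : 'rV[R]_n :=
  chris s phi a v w *m B - chris s psi c (v *m B) (w *m B).

Lemma aff_linearl phi psi a c B k u v w :
  aff phi psi a c B (k *: u + v) w = k *: aff phi psi a c B u w + aff phi psi a c B v w.
Proof.
rewrite /aff chris_linearl !mulmxDl -!scalemxAl chris_linearl.
by rewrite scalerBr opprD addrACA.
Qed.

Section AtPoint.
Variables (U : set M) (b : M -> gsort (B1 M)) (x : M) (phi psi : chart R n M).
Hypotheses (lb : local_bisection U b) (Ux : U x) (aphi : atlas phi)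
  (apsi : atlas psi) (px : cdom phi x) (qx : cdom psi (ltgt (b x))).
Hypothesis sem : jac (bas phi psi b) (phi x) = lmat phi psi (b x).
Let B := lmat phi psi (b x).

(** Semiholonomy makes the terms in the derivative of Y cancel; what remains depends on Y through
    its value at x only. *)
Lemma affine_condP v Y : differentiable (vrep phi Y) (phi x) ->
  app (b x) (nabla_at s x v Y) = nabla_at s (ltgt (b x)) (app (b x) v) (push U b Y) <->
  Y x *m tc phi x *m ddir (mat phi psi b) (phi x) (v *m tc phi x) =
  aff phi psi (phi x) (psi (ltgt (b x))) B (v *m tc phi x) (Y x *m tc phi x).
Proof.
move=> dY.
have E : app (b x) v *m tc psi (ltgt (b x)) = v *m tc phi x *m jac (bas phi psi b) (phi x).
  by rewrite sem (app_tc psi lb Ux aphi px).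
have L : app (b x) (nabla_at s x v Y) *m tc psi (ltgt (b x)) =
    (ddir (vrep phi Y) (phi x) (v *m tc phi x) +
     chris s phi (phi x) (v *m tc phi x) (Y x *m tc phi x)) *m B.
  by rewrite (app_tc psi lb Ux aphi px) nabla_at_coord.
have P := nabla_at_push lb Ux aphi apsi px qx dY E.
rewrite E sem -/B in P.
split=> [e|e].
  move: L; rewrite e P mulmxDl -addrA => /addrI e'.
  by rewrite /aff -e' addrK.
apply: (mul_tc_inj apsi qx); rewrite L P mulmxDl -addrA; congr (_ + _).
by rewrite e /aff subrK.
Qed.

End AtPoint.

Definition aff_formula b x phi psi := forall v w : 'rV[R]_n,
  w *m ddir (mat phi psi b) (phi x) v =
  aff phi psi (phi x) (psi (ltgt (b x))) (lmat phi psi (b x)) v w.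

Lemma smooth_vf_diff Y phi x : smooth_vf Y -> atlas phi -> cdom phi x ->
  differentiable (vrep phi Y) (phi x).
Proof.
move=> sY aphi px; have /smoothE[_] := sY phi aphi; rewrite vf_repE => C.
by apply: mxsmooth_diff C _; exists x.
Qed.

Lemma affine11_jet1P U b x phi psi : local_bisection U b -> U x ->
  atlas phi -> atlas psi -> cdom phi x -> cdom psi (ltgt (b x)) ->
  affine11 s (jet1 x b) <->
  jac (bas phi psi b) (phi x) = lmat phi psi (b x) /\ aff_formula b x phi psi.
Proof.
move=> lb Ux aphi apsi px qx.
have [lc cx J] := jet_rep_jet1 lb Ux; have /(sjet_B1P lb lc Ux cx)[e J'] := J.
rewrite /affine11 jet1_src; set c := jet_rep (jet1 x b) in lc cx e J' *.
have qx' : cdom psi (ltgt (c.2 x)) by rewrite -e.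
have eb : jac (bas phi psi b) (phi x) = jac (bas phi psi c.2) (phi x).
  apply/jac_eqP; [exact: (bas_diff lb Ux)|exact: (bas_diff lc cx)|].
  by move=> v; have [] := J' phi psi aphi apsi px qx v.
rewrite -(semiholonomic_jet1 lb Ux aphi apsi px qx).
have sem' : jac (bas phi psi b) (phi x) = lmat phi psi (b x) ->
    jac (bas phi psi c.2) (phi x) = lmat phi psi (c.2 x) by rewrite -eb -e.
split=> -[sem H]; split=> //; move/(_ sem) in sem'.
  move=> v w; have [_ ->] := J' phi psi aphi apsi px qx v.
  (* The inverse of [tc] turns prescribed chart components w into a vector in the preferred
     frame. *)
  have [Y [sY Yx]] := vf_extension x (w *m invmx (tc phi x)).
  have /(_ (v *m invmx (tc phi x)) Y sY) := H.
  have dY := smooth_vf_diff sY aphi px.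
  move=> /(affine_condP lc cx aphi apsi px qx' sem' _ dY).
  have ux := tc_unit aphi px.
  by rewrite Yx (mulmxKV ux) (mulmxKV ux) -e.
move=> v Y sY.
apply/(affine_condP lc cx aphi apsi px qx' sem' _ (smooth_vf_diff sY aphi px)).
by have [_ <-] := J' phi psi aphi apsi px qx (v *m tc phi x); rewrite H -e.
Qed.

(** Passing from smooth fields to fields merely differentiable at x is possible because the
    condition is algebraic in the value of Y; it is applied below to nabla_Y Z. *)
Lemma affine11_apply U b x phi v Y : local_bisection U b -> U x ->
  affine11 s (jet1 x b) -> atlas phi -> cdom phi x ->
  differentiable (vrep phi Y) (phi x) ->
  app (b x) (nabla_at s x v Y) = nabla_at s (ltgt (b x)) (app (b x) v) (push U b Y).
Proof.
move=> lb Ux ab aphi px dY; set psi := chart_at (ltgt (b x)).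
have apsi : atlas psi by exact: chart_at_atlas.
have qx : cdom psi (ltgt (b x)) by exact: chart_at_dom.
have /(affine11_jet1P lb Ux aphi apsi px qx)[sem F] := ab.
by apply/(affine_condP lb Ux aphi apsi px qx sem _ dY); exact: F.
Qed.

Lemma affine11_unique (z z' : gsort (B11 M)) : affine11 s z -> affine11 s z' ->
  p11 z = p11 z' -> z = z'.
Proof.
move=> az az' e.
have [[[arrz _] _] [[arrz' _] _]] := (az, az').
have [lb Ux ez] := jet_repP arrz; have [lb' Ux' ez'] := jet_repP arrz'.
set b := (jet_rep z).2 in lb ez *; set b' := (jet_rep z').2 in lb' ez' *.
have ex : z.1 = z'.1.
  rewrite -(section_lsrc lb Ux) -(section_lsrc lb' Ux').
  exact: (congr1 (@lsrc R n M) e).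
have eb : b z.1 = b' z.1 by rewrite [in RHS]ex; exact: e.
rewrite ez ez' -ex in az az' *; rewrite -ex in Ux'.
apply: jet1_eq; apply/(sjet_B1P lb lb' Ux Ux').
split=> // phi psi aphi apsi px qx v.
have qx' : cdom psi (ltgt (b' z.1)) by rewrite -eb.
have /(affine11_jet1P lb Ux aphi apsi px qx)[sem F] := az.
have /(affine11_jet1P lb' Ux' aphi apsi px qx')[sem' F'] := az'.
split.
  rewrite -(mul_jac _ (bas_diff lb Ux aphi apsi px qx)).
  by rewrite -(mul_jac _ (bas_diff lb' Ux' aphi apsi px qx')) sem sem' eb.
by apply: mul_rV_eqP => w; rewrite F F' eb.
Qed.

End AffineJets.

(** * Local bisections of [B1] defined by a formula in a pair of charts *)

Section CoordinateBisections.
Context {R : realType} {n : nat} (M : manifold R n).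
Implicit Types (x y z : M) (phi psi : chart R n M) (O : set 'rV[R]_n).
Implicit Types (beta : 'rV[R]_n -> 'rV[R]_n) (B : 'rV[R]_n -> 'M[R]_n).

Definition coord_dom phi O : set M := cdom phi `&` phi @^-1` O.
Definition coord_map phi psi beta z : M := cinv psi (beta (phi z)).
(** The outer factors pass from chart components to the preferred frames, so that [lmat] gives back
    B. *)
Definition coord_bis phi psi beta B z : gsort (B1 M) :=
  Linmap z (coord_map phi psi beta z)
    (tc phi z *m B (phi z) *m invmx (tc psi (coord_map phi psi beta z))).

Lemma open_comap m l (O : set 'rV[R]_m) (O' : set 'rV[R]_l) (f : 'rV[R]_m -> 'rV[R]_l) :
  open O -> open O' -> mxsmooth O f -> open (O `&` f @^-1` O').
Proof.
move=> oO oO' sf; apply: open_within_preimage => // a Oa.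
by apply: differentiable_continuous; exact: mxsmooth_diff sf Oa.
Qed.

Section OnePair.
Variables (phi psi : chart R n M) (O : set 'rV[R]_n) (beta : 'rV[R]_n -> 'rV[R]_n).
Hypotheses (aphi : atlas phi) (apsi : atlas psi) (oO : open O)
  (sbeta : mxsmooth O beta) (Obeta : forall a, O a -> (psi @` cdom psi) (beta a)).

Lemma coord_mapP z : coord_dom phi O z ->
  cdom psi (coord_map phi psi beta z) /\ psi (coord_map phi psi beta z) = beta (phi z).
Proof. by move=> [_ Oz]; apply: cimgP; exact: Obeta. Qed.

Lemma open_coord_dom : open (coord_dom phi O).
Proof. exact: open_chart_preim. Qed.

Lemma open_coord_chart_dom phi' psi' :
  open (chart_dom (coord_dom phi O) (coord_map phi psi beta) phi' psi').
Proof.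
have oO' : open (O `&` beta @^-1` overlap psi psi').
  by apply: open_comap => //; exact: open_overlap.
rewrite (_ : chart_dom _ _ _ _ =
    coord_dom phi (O `&` beta @^-1` overlap psi psi') `&` cdom phi').
  by apply: openI; [exact: open_chart_preim|exact: cdom_open].
apply/seteqP; split=> z.
  move=> [[Uz pz'] qz']; have [qz e] := coord_mapP Uz; have [pz Oz] := Uz.
  split=> //; split=> //; split=> //=; rewrite -e; exact: overlapP.
move=> [[pz [Oz /overlapE[qz qz' _]]] pz']; split=> //.
Qed.

Lemma coord_chart_dom_img phi' psi' a :
  (phi' @` chart_dom (coord_dom phi O) (coord_map phi psi beta) phi' psi') a ->
  [/\ overlap phi' phi a, O (tr phi' phi a) & overlap psi psi' (beta (tr phi' phi a))].
Proof.
move=> [z [[Uz pz'] qz'] <-]; have [qz e] := coord_mapP Uz; have [pz Oz] := Uz.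
have -> : tr phi' phi (phi' z) = phi z by rewrite /tr chartK.
by split; [exact: overlapP|exact: Oz|rewrite -e; exact: overlapP].
Qed.

Lemma coord_map_smooth : smooth_map (coord_dom phi O) (coord_map phi psi beta).
Proof.
move=> phi' psi' aphi' apsi'.
have oW := open_coord_chart_dom phi' psi'; split; first exact: oW.
have oW' : open (phi' @` chart_dom (coord_dom phi O) (coord_map phi psi beta) phi' psi').
  by apply: open_chart_img => // z [[]].
apply/smoothE; split; first exact: oW'.
have st := mxsmooth_sub (fun a Wa => let: And3 h _ _ :=
  @coord_chart_dom_img phi' psi' a Wa in h)
  (tr_smooth aphi' aphi).
apply: (@mxsmooth_ext _ _ _ _ _ (fun a => tr psi psi' (beta (tr phi' phi a)))) => //.
apply: (mxsmooth_comp (U' := overlap psi psi') oW') (tr_smooth apsi apsi').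
  by move=> a /coord_chart_dom_img[].
by apply: (mxsmooth_comp (U' := O) oW') sbeta => // a /coord_chart_dom_img[].
Qed.

End OnePair.

(** The maps t and q are free functions of a parameter in any dimension, so that this covers a
    single bisection as well as the two-point family below. *)
Lemma mxsmooth_chart_change m (O : set 'rV[R]_m) phi phi' psi psi'
    (t q : 'rV[R]_m -> 'rV[R]_n) (B : 'rV[R]_m -> 'M[R]_n) :
  open O -> atlas phi -> atlas phi' -> atlas psi -> atlas psi' ->
  (forall a, O a -> overlap phi' phi (t a)) -> (forall a, O a -> overlap psi psi' (q a)) ->
  mxsmooth O t -> mxsmooth O q -> mxsmooth O B ->
  mxsmooth O (fun a => row_mx (tr psi psi' (q a))
    (mxvec (jac (tr phi' phi) (t a) *m B a *m jac (tr psi psi') (q a)))).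
Proof.
move=> oO aphi aphi' apsi apsi' Ot Oq st sq sB.
apply: mxsmooth_row_mx => //; first exact: mxsmooth_comp oO Oq sq (tr_smooth apsi apsi').
apply: (mxsmooth_lin mxvec oO); apply: mxsmoothM => //.
  apply: mxsmoothM => //; exact: mxsmooth_comp oO Ot st (mxsmooth_jtr aphi' aphi).
exact: mxsmooth_comp oO Oq sq (mxsmooth_jtr apsi apsi').
Qed.

Lemma srep_coord_bis phi psi beta B phi' psi' a :
  atlas phi -> atlas psi -> atlas phi' -> atlas psi' ->
  overlap phi' phi a -> overlap psi psi' (beta (tr phi' phi a)) ->
  srep phi' psi' (coord_bis phi psi beta B) a =
  row_mx (tr psi psi' (beta (tr phi' phi a)))
    (mxvec (jac (tr phi' phi) a *m B (tr phi' phi a) *m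
            jac (tr psi psi') (beta (tr phi' phi a)))).
Proof.
move=> aphi apsi aphi' apsi' /overlapE[pz' pz ea] /overlapE[qz qz' eb].
rewrite srep_B1 /bas /mat; congr (row_mx _ (mxvec _)).
rewrite /lmat /coord_bis [lsrc _]/= [lmx _]/= [ltgt _]/= /coord_map -/(tr phi' phi a).
set z := cinv phi' a in pz' pz ea *; set c := beta _ in qz qz' eb *.
rewrite !mulmxA (invmx_tc aphi' aphi pz' pz) -!mulmxA (invmx_tc apsi apsi' qz qz').
by rewrite /jtr eb ea mulmxA.
Qed.

Lemma lmat_coord_bis phi psi beta B z : atlas phi -> atlas psi -> cdom phi z ->
  (psi @` cdom psi) (beta (phi z)) -> lmat phi psi (coord_bis phi psi beta B z) = B (phi z).
Proof.
move=> aphi apsi pz /cimgP[qz e].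
rewrite /lmat /= -!mulmxA mulVmx ?tc_unit // mulmx1 mulmxA mulVmx ?tc_unit //.
by rewrite mul1mx.
Qed.

(** Since beta is affine with invertible linear part, its inverse [gam] is explicit and no inverse
    function theorem is called for; B may be any smooth invertible matrix function. *)
Lemma coord_local_bisection phi psi O (a0 c0 : 'rV[R]_n) (A : 'M[R]_n) B :
  let beta a := c0 + (a - a0) *m A in
  atlas phi -> atlas psi -> open O -> O `<=` phi @` cdom phi ->
  (forall a, O a -> (psi @` cdom psi) (beta a)) -> A \in unitmx ->
  mxsmooth O B -> (forall a, O a -> B a \in unitmx) ->
  local_bisection (coord_dom phi O) (coord_bis phi psi beta B).
Proof.
move=> beta aphi apsi oO OU Obeta uA sB uB.
have saff (O' : set 'rV[R]_n) (c d : 'rV[R]_n) (C : 'M[R]_n) : open O' ->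
    mxsmooth O' (fun a => c + (a - d) *m C).
  move=> oO'; apply: mxsmoothD => //; first exact: mxsmooth_cst.
  apply: mxsmoothM => //; last exact: mxsmooth_cst.
  by apply: mxsmoothB => //; [exact: mxsmooth_id|exact: mxsmooth_cst].
have sbeta : mxsmooth O beta by exact: saff.
pose gam c := a0 + (c - c0) *m invmx A.
have betaK a : gam (beta a) = a.
  by rewrite /gam /beta [c0 + _]addrC addrK mulmxK // addrC subrK.
have gamK c : beta (gam c) = c.
  by rewrite /gam /beta [a0 + _]addrC addrK mulmxKV // addrC subrK.
have sgam O' : open O' -> mxsmooth O' gam by exact: saff.
pose O2 := setT `&` gam @^-1` O.
have oO2 : open O2 by apply: open_comap => //; [exact: openT|apply: sgam; exact: openT].
have O2img c : O2 c -> (phi @` cdom phi) (gam c) by move=> [_ /OU].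
have eU : coord_map phi psi beta @` coord_dom phi O = coord_dom psi O2.
  apply/seteqP; split=> y.
    move=> [z [pz Oz] <-]; have [qy ey] := coord_mapP Obeta (conj pz Oz).
    by split=> //; split=> //=; rewrite ey betaK.
  move=> [qy [_ Oy]]; have [pz ez] := cimgP (OU _ Oy).
  exists (cinv phi (gam (psi y))); first by split=> //=; rewrite ez.
  by rewrite /coord_map ez gamK chartK.
split; last first.
  split.
  - exact: open_coord_dom.
  - rewrite -[X in open X]/(coord_map phi psi beta @` coord_dom phi O) eU.
    exact: open_coord_dom.
  - exact: (coord_map_smooth aphi apsi oO sbeta Obeta).
  exists (coord_map psi phi gam); split.
    move=> z; rewrite inE => Uz; have [_ e] := coord_mapP Obeta Uz.
    by rewrite /coord_map -/(coord_map phi psi beta z) e betaK chartK //; case: Uz.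
  rewrite -[X in smooth_map X]/(coord_map phi psi beta @` coord_dom phi O) eU.
  apply: coord_map_smooth => //; exact: sgam.
split.
- exact: open_coord_dom.
- move=> z [pz Oz]; split=> //=.
  have [qy ey] := coord_mapP Obeta (conj pz Oz).
  by rewrite !unitmx_mul unitmx_inv (tc_unit aphi pz) (tc_unit apsi qy) uB.
move=> phi' psi' aphi' apsi' W.
have eW : W = chart_dom (coord_dom phi O) (coord_map phi psi beta) phi' psi' by [].
have oW : open W by rewrite eW; exact: (open_coord_chart_dom phi oO sbeta Obeta).
split=> //; rewrite sec_repE; apply/smoothE.
have oW' : open (phi' @` W) by apply: open_chart_img => // z [[]].
split=> //.
have WP a : (phi' @` W) a ->
    [/\ overlap phi' phi a, O (tr phi' phi a) & overlap psi psi' (beta (tr phi' phi a))].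
  exact: (coord_chart_dom_img Obeta).
have WP1 a : (phi' @` W) a -> overlap phi' phi a by move=> /WP[].
have WP2 a : (phi' @` W) a -> O (tr phi' phi a) by move=> /WP[].
have WP3 a : (phi' @` W) a -> overlap psi psi' (beta (tr phi' phi a)) by move=> /WP[].
have st := mxsmooth_sub WP1 (tr_smooth aphi' aphi).
apply: (mxsmooth_ext oW') (mxsmooth_chart_change oW' aphi aphi' apsi apsi' WP1 WP3
   (@mxsmooth_id _ _ _) (mxsmooth_comp oW' WP2 st sbeta) (mxsmooth_comp oW' WP2 st sB)).
by move=> a /WP[? _ ?]; rewrite srep_coord_bis.
Qed.

End CoordinateBisections.

(** * The affine extension S and its formula in charts *)

Section AffineExtension.
Context {R : realType} {n : nat} (M : manifold R n).
Implicit Types (x y z : M) (phi psi : chart R n M) (U W : set M) (b : M -> gsort (B1 M)).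
Variables (s : M -> gsort (B11 M)) (hs : symmetry_jet s).

(** The matrix representing the map from w to [aff], written out so that it is visibly linear in v
    and smooth in all its data. *)
Definition affM phi psi (a c : 'rV[R]_n) (B : 'M[R]_n) (v : 'rV[R]_n) : 'M[R]_n :=
  B *m (2^-1 *: jet_mat (v *m B) (srep psi psi s c)) -
  (2^-1 *: jet_mat v (srep phi phi s a)) *m B.

Lemma mul_affM phi psi a c B v w : w *m affM phi psi a c B v = aff s phi psi a c B v w.
Proof.
rewrite /affM /aff /chris mulmxBr !mulmxA opprK addrC mulNmx.
by rewrite -!scalemxAr -!scalemxAl.
Qed.

Lemma affM_linear phi psi a c B k u v :
  affM phi psi a c B (k *: u + v) = k *: affM phi psi a c B u + affM phi psi a c B v.
Proof.
apply: mul_rV_eqP => w; rewrite mul_affM aff_linearl.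
by rewrite [RHS]mulmxDr -scalemxAr !mul_affM.
Qed.

HB.instance Definition _ phi psi a c B :=
  GRing.isLinear.Build R 'rV[R]_n 'M[R]_n _ (affM phi psi a c B)
    (fun k u v => affM_linear phi psi a c B k u v).

(** The Jacobian, base block and matrix block side by side, that an affine jet with matrix B from a
    to c must have; row i is its value on the i-th basis vector. *)
Definition affJ phi psi a c B : 'M[R]_(n, n + n * n) :=
  \matrix_(i < n) row_mx (row i B) (mxvec (affM phi psi a c B 'e_i)).

Lemma mul_affJ phi psi a c B v :
  v *m affJ phi psi a c B = row_mx (v *m B) (mxvec (affM phi psi a c B v)).
Proof.
rewrite mulmx_sum_row [in RHS](row_sum_delta v) mulmx_suml !linear_sum /=.
elim/big_rec3: _ => [|i A C D _ ->]; first by rewrite row_mx0.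
by rewrite rowK -scalemxAl !linearZ -rowE /= scale_row_mx add_row_mx.
Qed.

Lemma mxsmooth_jet_mat m (O : set 'rV[R]_m) (v : 'rV[R]_m -> 'rV[R]_n)
    (c : 'rV[R]_m -> 'rV[R]_(n + gdim (B11 M))) : open O ->
  mxsmooth O v -> mxsmooth O c -> mxsmooth O (fun t => jet_mat (v t) (c t)).
Proof.
move=> oO sv sc; apply: (mxsmooth_lin vec_mx oO); apply: (mxsmooth_lin rsubmx oO).
apply: mxsmoothM => //; apply: (mxsmooth_lin vec_mx oO).
exact: (mxsmooth_lin rsubmx oO (mxsmooth_lin rsubmx oO sc)).
Qed.

Lemma mxsmooth_affM m (O : set 'rV[R]_m) phi psi (a c v : 'rV[R]_m -> 'rV[R]_n)
    (B : 'rV[R]_m -> 'M[R]_n) : open O -> atlas phi -> atlas psi ->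
  (forall t, O t -> (phi @` cdom phi) (a t)) -> (forall t, O t -> (psi @` cdom psi) (c t)) ->
  mxsmooth O a -> mxsmooth O c -> mxsmooth O B -> mxsmooth O v ->
  mxsmooth O (fun t => affM phi psi (a t) (c t) (B t) (v t)).
Proof.
move=> oO aphi apsi Oa Oc sa sc sB sv.
have s1 := mxsmooth_comp oO Oa sa (symmetry_section_smooth hs aphi).
have s2 := mxsmooth_comp oO Oc sc (symmetry_section_smooth hs apsi).
apply: mxsmoothB => //; apply: mxsmoothM => //; apply: mxsmoothZ => //.
- exact: scalar_smooth_cst.
- by apply: mxsmooth_jet_mat => //; exact: mxsmoothM.
- exact: scalar_smooth_cst.
- exact: mxsmooth_jet_mat.
Qed.

Lemma mxsmooth_affJ m (O : set 'rV[R]_m) phi psi (a c : 'rV[R]_m -> 'rV[R]_n)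
    (B : 'rV[R]_m -> 'M[R]_n) : open O -> atlas phi -> atlas psi ->
  (forall t, O t -> (phi @` cdom phi) (a t)) -> (forall t, O t -> (psi @` cdom psi) (c t)) ->
  mxsmooth O a -> mxsmooth O c -> mxsmooth O B ->
  mxsmooth O (fun t => affJ phi psi (a t) (c t) (B t)).
Proof.
move=> oO aphi apsi Oa Oc sa sc sB i j.
have C : mxsmooth O (fun t => row_mx (row i (B t)) (mxvec (affM phi psi (a t) (c t) (B t) 'e_i))).
  apply: mxsmooth_row_mx => //; first exact: (mxsmooth_lin (row i) oO sB).
  apply: (mxsmooth_lin mxvec oO); apply: mxsmooth_affM => //; exact: mxsmooth_cst.
apply: scalar_smooth_ext (C 0 j) => // t _.
have -> : affJ phi psi (a t) (c t) (B t) i j = row i (affJ phi psi (a t) (c t) (B t)) 0 j.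
  by rewrite [RHS]mxE.
by rewrite rowK.
Qed.

(** Semiholonomy is the base block of the equation and [aff_formula] its matrix block. *)
Lemma affine_jac U b x phi psi : local_bisection U b -> U x ->
  atlas phi -> atlas psi -> cdom phi x -> cdom psi (ltgt (b x)) ->
  affine11 s (jet1 x b) <->
  jac (srep phi psi b) (phi x) =
  affJ phi psi (phi x) (psi (ltgt (b x))) (lmat phi psi (b x)).
Proof.
move=> lb Ux aphi apsi px qx.
rewrite (affine11_jet1P hs lb Ux aphi apsi px qx); split=> [[sem F]|J].
  apply: mul_rV_eqP => v; rewrite mul_affJ (mul_jac_srep _ lb Ux) //.
  rewrite -sem (mul_jac _ (bas_diff lb Ux aphi apsi px qx)); congr (row_mx _ (mxvec _)).
  by apply: mul_rV_eqP => w; rewrite mul_affM F sem.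
split.
  apply: mul_rV_eqP => v; rewrite (mul_jac _ (bas_diff lb Ux aphi apsi px qx)).
  have := congr1 (mulmx v) J; rewrite mul_affJ (mul_jac_srep _ lb Ux) //.
  by move=> /eq_row_mx[].
move=> v w; rewrite -mul_affM; congr (_ *m _).
have := congr1 (mulmx v) J; rewrite mul_affJ (mul_jac_srep _ lb Ux) //.
by move=> /eq_row_mx[_ /(can_inj mxvecK)].
Qed.

(* The local bisection with affine coordinates whose jet at a0 is affine. *)
Definition aff_base (a0 c0 : 'rV[R]_n) (B : 'M[R]_n) a : 'rV[R]_n := c0 + (a - a0) *m B.
Definition aff_mat phi psi a0 c0 B a : 'M[R]_n := B + affM phi psi a0 c0 B (a - a0).
Definition aff_bis phi psi a0 c0 B : M -> gsort (B1 M) :=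
  coord_bis phi psi (aff_base a0 c0 B) (aff_mat phi psi a0 c0 B).
Definition aff_dom phi psi a0 c0 B : set 'rV[R]_n :=
  [set a | [/\ (phi @` cdom phi) a, (psi @` cdom psi) (aff_base a0 c0 B a) &
               aff_mat phi psi a0 c0 B a \in unitmx]].

Lemma mxsmooth_aff_base m (O : set 'rV[R]_m) (a0 c0 a : 'rV[R]_m -> 'rV[R]_n)
    (B : 'rV[R]_m -> 'M[R]_n) : open O ->
  mxsmooth O a0 -> mxsmooth O c0 -> mxsmooth O B -> mxsmooth O a ->
  mxsmooth O (fun t => aff_base (a0 t) (c0 t) (B t) (a t)).
Proof.
move=> oO s0 sc sB sa; apply: mxsmoothD => //; apply: mxsmoothM => //.
exact: mxsmoothB.
Qed.

Lemma mxsmooth_aff_mat m (O : set 'rV[R]_m) phi psi (a0 c0 a : 'rV[R]_m -> 'rV[R]_n)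
    (B : 'rV[R]_m -> 'M[R]_n) : open O -> atlas phi -> atlas psi ->
  (forall t, O t -> (phi @` cdom phi) (a0 t)) -> (forall t, O t -> (psi @` cdom psi) (c0 t)) ->
  mxsmooth O a0 -> mxsmooth O c0 -> mxsmooth O B -> mxsmooth O a ->
  mxsmooth O (fun t => aff_mat phi psi (a0 t) (c0 t) (B t) (a t)).
Proof.
move=> oO aphi apsi O0 Oc s0 sc sB sa; apply: mxsmoothD => //.
by apply: mxsmooth_affM => //; exact: mxsmoothB.
Qed.

Section Model.
Variables (phi psi : chart R n M) (a0 c0 : 'rV[R]_n) (B : 'M[R]_n).
Hypotheses (aphi : atlas phi) (apsi : atlas psi) (pa0 : (phi @` cdom phi) a0)
  (qc0 : (psi @` cdom psi) c0) (uB : B \in unitmx).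

Let base_smooth O : open O -> mxsmooth O (aff_base a0 c0 B).
Proof.
move=> oO; apply: mxsmooth_aff_base => //; try exact: mxsmooth_cst.
exact: mxsmooth_id.
Qed.

Let mat_smooth O : open O -> mxsmooth O (aff_mat phi psi a0 c0 B).
Proof.
move=> oO; apply: mxsmooth_aff_mat => //; try exact: mxsmooth_cst.
exact: mxsmooth_id.
Qed.

Lemma open_aff_dom : open (aff_dom phi psi a0 c0 B).
Proof.
pose O1 := (phi @` cdom phi) `&` aff_base a0 c0 B @^-1` (psi @` cdom psi).
have o1 : open O1.
  apply: open_comap; [exact: cimg_open|exact: cimg_open|].
  by apply: base_smooth; exact: cimg_open.
have := open_unitmx o1 (mat_smooth o1).
congr open; apply/seteqP; split=> a; first by move=> [[? ?] ?]; split.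
by move=> [? ? ?]; split.
Qed.

Lemma aff_base0 : aff_base a0 c0 B a0 = c0.
Proof. by rewrite /aff_base subrr mul0mx addr0. Qed.

Lemma aff_mat0 : aff_mat phi psi a0 c0 B a0 = B.
Proof. by rewrite /aff_mat subrr linear0 addr0. Qed.

Lemma aff_dom0 : aff_dom phi psi a0 c0 B a0.
Proof. by split; rewrite ?aff_base0 ?aff_mat0. Qed.

Lemma aff_local_bisection :
  local_bisection (coord_dom phi (aff_dom phi psi a0 c0 B)) (aff_bis phi psi a0 c0 B).
Proof.
apply: coord_local_bisection => //.
- exact: open_aff_dom.
- by move=> a [].
- by move=> a [].
- by apply: mat_smooth; exact: open_aff_dom.
- by move=> a [].
Qed.

Lemma aff_bis_coord z : coord_dom phi (aff_dom phi psi a0 c0 B) z ->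
  [/\ cdom psi (ltgt (aff_bis phi psi a0 c0 B z)),
      psi (ltgt (aff_bis phi psi a0 c0 B z)) = aff_base a0 c0 B (phi z) &
      lmat phi psi (aff_bis phi psi a0 c0 B z) = aff_mat phi psi a0 c0 B (phi z)].
Proof.
move=> [pz [_ qz _]]; have [? ?] := cimgP qz; split=> //.
exact: lmat_coord_bis.
Qed.

(** Both coordinate maps are affine in a, so their derivatives at a0 are the linear parts B and
    [affM], which are the values required. *)
Lemma aff_bis_affine x : cdom phi x -> phi x = a0 ->
  affine11 s (jet1 x (aff_bis phi psi a0 c0 B)).
Proof.
move=> px ex; have Ux : coord_dom phi (aff_dom phi psi a0 c0 B) x.
  by split=> //; rewrite /preimage /= ex; exact: aff_dom0.
have lb := aff_local_bisection.
have [qx ey eB] := aff_bis_coord Ux; rewrite ex aff_base0 aff_mat0 in ey eB.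
apply/(affine11_jet1P hs lb Ux aphi apsi px qx); rewrite /aff_formula ey eB.
have N : \forall a \near phi x, aff_dom phi psi a0 c0 B a.
  by apply: open_nbhs_nbhs; split; [exact: open_aff_dom|rewrite ex; exact: aff_dom0].
have No a : aff_dom phi psi a0 c0 B a ->
    coord_dom phi (aff_dom phi psi a0 c0 B) (cinv phi a) /\ phi (cinv phi a) = a.
  move=> Oa; have /cimgP[p e] : (phi @` cdom phi) a by case: Oa.
  have Oe : aff_dom phi psi a0 c0 B (phi (cinv phi a)) by rewrite e; exact: Oa.
  exact: (conj (conj p Oe) e).
have Nb : \forall a \near phi x, aff_base a0 c0 B a = bas phi psi (aff_bis phi psi a0 c0 B) a.
  by apply: filterS N => a /No[/aff_bis_coord[_ e _] ea]; rewrite /bas e ea.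
have Nm : \forall a \near phi x, aff_mat phi psi a0 c0 B a = mat phi psi (aff_bis phi psi a0 c0 B) a.
  by apply: filterS N => a /No[/aff_bis_coord[_ _ e] ea]; rewrite /mat e ea.
have db : differentiable (fun a : 'rV[R]_n => a - a0) (phi x) by exact: differentiableB.
split.
  have dB := mxsmooth_diff (base_smooth openT) (I : setT (phi x)).
  rewrite -(jac_near Nb) //; apply: mul_rV_eqP => v; rewrite mul_jac //.
  rewrite /aff_base ddirD //; last exact: differentiable_mulmx.
  by rewrite ddir_cst add0r ddirM // ddirB // ddir_id !ddir_cst mulmx0 addr0 subr0.
move=> v w; rewrite -(ddir_near _ Nm) /aff_mat.
have dc : differentiable (fun=> B : 'M[R]_n) (phi x) by exact: differentiable_cst.
have dm := differentiable_lin_comp (affM phi psi a0 c0 B) db.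
rewrite (ddirD _ dc dm) ddir_cst add0r (ddir_lin (affM phi psi a0 c0 B) _ db).
by rewrite ddirB // ddir_id ddir_cst subr0 mul_affM -ex.
Qed.

End Model.

Lemma affine_ext_spec xi : garr (B1 M) xi ->
  affine11 s (affine_ext s xi) /\ p11 (affine_ext s xi) = xi.
Proof.
move=> uxi; rewrite /affine_ext.
apply: (@xgetPex {classic (gsort (B11 M))} _ [set z | affine11 s z /\ p11 z = xi]).
set phi := chart_at (lsrc xi); set psi := chart_at (ltgt xi).
have aphi : atlas phi by exact: chart_at_atlas.
have apsi : atlas psi by exact: chart_at_atlas.
have px : cdom phi (lsrc xi) by exact: chart_at_dom.
have qy : cdom psi (ltgt xi) by exact: chart_at_dom.
set B := lmat phi psi xi.
have uB : B \in unitmx by exact: lmat_unit.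
have pa0 : (phi @` cdom phi) (phi (lsrc xi)) by exists (lsrc xi).
have qc0 : (psi @` cdom psi) (psi (ltgt xi)) by exists (ltgt xi).
set b := aff_bis phi psi (phi (lsrc xi)) (psi (ltgt xi)) B.
exists (jet1 (lsrc xi) b); split; first exact: aff_bis_affine.
have Ux : coord_dom phi (aff_dom phi psi (phi (lsrc xi)) (psi (ltgt xi)) B) (lsrc xi).
  by split=> //; exact: aff_dom0.
rewrite /p11 (jet_val_jet1 (aff_local_bisection aphi apsi pa0 qc0 uB) Ux).
have [q1 q2 q3] := aff_bis_coord aphi apsi Ux.
apply: (lmat_inj aphi apsi) => //.
  by rewrite -(chartK q1) q2 aff_base0 chartK.
by rewrite q3 aff_mat0.
Qed.

End AffineExtension.

(** * Affine (1,1,1)-jets: existence *)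

Section AffineExtensionBisection.
Context {R : realType} {n : nat} (M : manifold R n).
Implicit Types (x y z : M) (phi psi : chart R n M) (U W : set M) (b : M -> gsort (B1 M)).
Variables (s : M -> gsort (B11 M)) (hs : symmetry_jet s).

Lemma smooth_map_ext U (f g : M -> M) : (forall z, U z -> f z = g z) ->
  smooth_map U f -> smooth_map U g.
Proof.
move=> fg sf phi psi aphi apsi.
have eW : U `&` cdom phi `&` f @^-1` cdom psi = U `&` cdom phi `&` g @^-1` cdom psi.
  apply/seteqP; split=> z [[Uz pz] qz]; split=> //; move: qz;
    by rewrite /preimage /= (fg z Uz).
have := sf phi psi aphi apsi; cbv zeta; rewrite eW => -[oW /smoothE[oW' sW]].
split=> //; apply/smoothE; split=> //; apply: mxsmooth_ext sW => // a [z [[Uz pz] _] <-].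
by rewrite /= chartK // fg.
Qed.

Lemma diffeo_ext U (f g : M -> M) : (forall z, U z -> f z = g z) ->
  diffeo_onto_open U f -> diffeo_onto_open U g.
Proof.
move=> fg [oU oI sf [h [hK sh]]].
have eI : f @` U = g @` U.
  by apply/seteqP; split=> _ [z Uz <-]; exists z; rewrite ?fg.
split; rewrite -?eI //; first exact: smooth_map_ext sf.
exists h; split; last by rewrite -?eI.
by move=> z Uz; rewrite -fg ?hK //; rewrite inE in Uz.
Qed.

(** Coordinate expression of S: the argument stacks the source, target and matrix of an arrow, and
    the value is its extension in the fibred coordinates of [B11]. *)
Definition affF phi psi (t : 'rV[R]_(n + (n + n * n))) : 'rV[R]_(n + gdim (B11 M)) :=
  row_mx (lsubmx (rsubmx t))
    (row_mx (rsubmx (rsubmx t))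
       (mxvec (affJ s phi psi (lsubmx t) (lsubmx (rsubmx t)) (vec_mx (rsubmx (rsubmx t)))))).

Definition affF_dom phi psi : set 'rV[R]_(n + (n + n * n)) :=
  [set t | (phi @` cdom phi) (lsubmx t) /\ (psi @` cdom psi) (lsubmx (rsubmx t))].

Lemma open_affF_dom phi psi : open (affF_dom phi psi).
Proof.
have sl : mxsmooth setT (@lsubmx R 1 n (n + n * n)).
  by apply: (mxsmooth_lin lsubmx openT); exact: mxsmooth_id.
have sr : mxsmooth setT (fun t : 'rV[R]_(n + (n + n * n)) => lsubmx (rsubmx t)).
  apply: (mxsmooth_lin lsubmx openT); apply: (mxsmooth_lin rsubmx openT).
  exact: mxsmooth_id.
have o1 := open_comap openT (@cimg_open _ _ _ phi) sl.
have o2 := open_comap openT (@cimg_open _ _ _ psi) sr.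
have := openI o1 o2; congr open; apply/seteqP; split=> t.
  by move=> [[_ ?] [_ ?]].
by move=> [? ?]; split; split.
Qed.

Lemma mxsmooth_affF phi psi : atlas phi -> atlas psi ->
  mxsmooth (affF_dom phi psi) (affF phi psi).
Proof.
move=> aphi apsi; have oO := @open_affF_dom phi psi.
have sr := mxsmooth_lin rsubmx oO (@mxsmooth_id R _ (affF_dom phi psi)).
have s1 := mxsmooth_lin lsubmx oO (@mxsmooth_id R _ (affF_dom phi psi)).
have s2 := mxsmooth_lin lsubmx oO sr; have s3 := mxsmooth_lin rsubmx oO sr.
apply: mxsmooth_row_mx => //; apply: mxsmooth_row_mx => //.
apply: (mxsmooth_lin mxvec oO); apply: (mxsmooth_affJ hs) => //.
- by move=> t [].
- by move=> t [].
- exact: (mxsmooth_lin vec_mx oO s3).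
Qed.

Lemma jet1_affine_ext U b z : local_bisection U b -> U z ->
  let c := jet_rep (affine_ext s (b z)) in
  [/\ local_bisection c.1 c.2, c.1 z, c.2 z = b z,
      affine_ext s (b z) = jet1 z c.2 & affine11 s (jet1 z c.2)].
Proof.
move=> lb Uz c; have [ae pe] := affine_ext_spec hs (section_unit lb Uz).
have [[arr _] _] := ae; have [lc cz ez] := jet_repP arr; rewrite -/c in lc cz ez.
have e1 : (affine_ext s (b z)).1 = z.
  rewrite -(section_lsrc lc cz) -[RHS](section_lsrc lb Uz).
  exact: (congr1 (@lsrc R n M) pe).
have ez' : affine_ext s (b z) = jet1 z c.2 by rewrite {1}ez e1.
have cz' : c.1 z by rewrite -e1.
have ec : c.2 z = b z by move: pe; rewrite /p11 /jet_val e1.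
have ac : affine11 s (jet1 z c.2) by rewrite -ez'.
exact: (And5 lc cz' ec ez' ac).
Qed.

Lemma srep_affine_ext U b z phi psi : local_bisection U b -> U z ->
  atlas phi -> atlas psi -> cdom phi z -> cdom psi (ltgt (b z)) ->
  srep phi psi (fun z => affine_ext s (b z)) (phi z) =
  affF phi psi (row_mx (phi z) (srep phi psi b (phi z))).
Proof.
move=> lb Uz aphi apsi pz qz.
have [lc cz ec ez ae] := jet1_affine_ext lb Uz.
move: lc cz ec ez ae; move: (jet_rep _) => c lc cz ec ez ae.
have qz' : cdom psi (ltgt (c.2 z)) by rewrite ec.
rewrite (srep_B11_jet1 aphi apsi lc cz ez pz qz').
have /(affine_jac hs lc cz aphi apsi pz qz') -> := ae.
rewrite /affF row_mxKl row_mxKr srep_B1 row_mxKl row_mxKr mxvecK.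
by rewrite (bas_at _ _ pz) (bas_at _ _ pz) (mat_at _ _ pz) (mat_at _ _ pz) ec.
Qed.

Lemma affine_ext_ltgt U b z : local_bisection U b -> U z ->
  gtgt (affine_ext s (b z)) = ltgt (b z).
Proof.
move=> lb Uz; have [_ pe] := affine_ext_spec hs (section_unit lb Uz).
exact: (congr1 (@ltgt R n M) pe).
Qed.

(** Composing with S keeps the base map, so only smoothness is at stake, and it follows from that of
    [affF]. *)
Lemma affine_ext_bisection U b : local_bisection U b ->
  local_bisection (G := B11 M) U (fun z => affine_ext s (b z)).
Proof.
move=> lb; have [[oU sb1 sb2] db] := lb.
have tg z (Uz : U z) := affine_ext_ltgt lb Uz.
split; last by apply: diffeo_ext db => z Uz; exact: (esym (tg z Uz)).
split=> // [z Uz|phi psi aphi apsi].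
  have [lc cz _ ez [[arr _] _]] := jet1_affine_ext lb Uz; rewrite -ez in arr.
  by split; [exact: arr|rewrite ez; exact: jet1_src].
set W := (X in let W := X in _); cbv zeta.
pose W' := chart_dom U (fun z => ltgt (b z)) phi psi.
have -> : W = W'.
  apply/seteqP; split=> z [[Uz pz] qz]; apply: conj (conj Uz pz) _.
    by change (cdom psi (ltgt (b z))); rewrite -(tg z Uz); exact: qz.
  by change (cdom psi (gtgt (affine_ext s (b z)))); rewrite (tg z Uz); exact: qz.
have [oW oW' sW] := section_smooth lb.1 aphi apsi.
split; first exact: oW.
rewrite sec_repE; apply/smoothE; split; first exact: oW'.
apply: (@mxsmooth_ext _ _ _ _ _ (fun a => affF phi psi (row_mx a (srep phi psi b a)))) => //.
  move=> a [z [[Uz pz] qz] <-]; rewrite (srep_affine_ext lb) //.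
apply: (mxsmooth_comp oW' _ _ (mxsmooth_affF aphi apsi)).
  move=> a [z [[Uz pz] qz] <-];
    rewrite /affF_dom /= row_mxKl row_mxKr srep_B1 row_mxKl bas_at //.
  by split; [exists z|exists (ltgt (b z))].
exact: mxsmooth_row_mx oW' (@mxsmooth_id _ _ _) sW.
Qed.

(** This makes [affine_ext2] independent of the bisection chosen in its definition: by the chain
    rule for [affF], the jet of S o b depends on the jet of b only. *)
Lemma sjet_affine_ext U W b c x : local_bisection U b -> local_bisection W c ->
  U x -> W x -> sjet x b c ->
  sjet (G := B11 M) x (fun z => affine_ext s (b z)) (fun z => affine_ext s (c z)).
Proof.
move=> lb lc Ux Wx bc; have /sjetE[e J] := bc; apply/sjetE.
split; first by rewrite e.
move=> phi psi aphi apsi px; rewrite (affine_ext_ltgt lb Ux) => qx.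
have qx' : cdom psi (ltgt (c x)) by rewrite -e.
have key V (d : M -> gsort (B1 M)) : local_bisection V d -> V x -> cdom psi (ltgt (d x)) ->
    forall v, v *m jac (srep (G := B11 M) phi psi (fun z => affine_ext s (d z))) (phi x) =
    ddir (affF phi psi) (row_mx (phi x) (srep phi psi d (phi x)))
      (row_mx v (v *m jac (srep phi psi d) (phi x))).
  move=> ld Vx rx v.
  have de := section_diff (affine_ext_bisection ld).1 aphi apsi Vx px.
  rewrite (affine_ext_ltgt ld Vx) in de; have {}de := de rx.
  have dd := section_diff ld.1 aphi apsi Vx px rx.
  have N := near_chart_dom ld.2 aphi apsi Vx px rx.
  have N' : \forall a \near phi x, affF phi psi (row_mx a (srep phi psi d a)) =
      srep (G := B11 M) phi psi (fun z => affine_ext s (d z)) a.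
    have Ni := near_cimg px; near=> a.
    have [_ ea] : cdom phi (cinv phi a) /\ phi (cinv phi a) = a by apply: cimgP; near: a.
    have [[Va pa] qa] : chart_dom V (fun z => ltgt (d z)) phi psi (cinv phi a) by near: a.
    by have := srep_affine_ext ld Va aphi apsi pa qa; rewrite ea.
  have dr : differentiable (fun a => row_mx a (srep phi psi d a)) (phi x).
    exact: differentiable_row_mx.
  have dF : differentiable (affF phi psi) (row_mx (phi x) (srep phi psi d (phi x))).
    apply: mxsmooth_diff (mxsmooth_affF aphi apsi) _.
    rewrite /affF_dom /= row_mxKl row_mxKr srep_B1 row_mxKl bas_at //.
    by split; [exists x|exists (ltgt (d x))].
  have er : ddir (fun a => row_mx a (srep phi psi d a)) (phi x) v =
      row_mx v (ddir (srep phi psi d) (phi x) v).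
    rewrite (ddir_row_mx (A := id)) //; congr row_mx; exact: ddir_id.
  by rewrite (mul_jac _ de) -(ddir_near _ N') (ddir_comp _ dr dF) er (mul_jac _ dd).
apply: mul_rV_eqP => v; rewrite (key U) // (key W) // (J phi psi aphi apsi px qx).
by rewrite !srep_B1 /bas /mat chartK // e.
Unshelve. all: by end_near. Qed.

End AffineExtensionBisection.

(** * The projections p, p_* and p_** of (1,1,1)-jets *)

Section ProjectedJets.
Context {R : realType} {n : nat} (M : manifold R n).
Implicit Types (x y z : M) (phi psi : chart R n M) (U W : set M) (b : M -> gsort (B1 M)).
Implicit Types (e c : M -> gsort (B11 M)).

Lemma sjet_near (G : groupoid M) U (b c : M -> gsort G) x : open U -> U x ->
  (forall z, U z -> b z = c z) ->
  (forall phi psi, atlas phi -> atlas psi -> cdom phi x -> cdom psi (gtgt (b x)) ->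
     differentiable (srep phi psi b) (phi x)) ->
  sjet x b c.
Proof.
move=> oU Ux bc db; apply/sjetE; split; first exact: bc.
move=> phi psi aphi apsi px qx; apply: jac_near; last exact: db.
have N := near_chart px (open_nbhs_nbhs (conj oU Ux)).
near=> a; rewrite -!sec_repE /sec_rep bc //; near: a; exact: N.
Unshelve. all: by end_near. Qed.

Lemma jac_proj k l (f g : 'rV[R]_n -> 'rV[R]_k) (F G : 'rV[R]_n -> 'rV[R]_l) L a :
  (forall v, differentiable f a /\ ddir f a v = L (ddir F a v)) ->
  (forall v, differentiable g a /\ ddir g a v = L (ddir G a v)) ->
  differentiable F a -> differentiable G a -> jac F a = jac G a -> jac f a = jac g a.
Proof.
move=> Hf Hg dF dG JFG; apply: mul_rV_eqP => v.
have [df ef] := Hf v; have [dg eg] := Hg v.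
by rewrite (mul_jac _ df) (mul_jac _ dg) ef eg -(mul_jac _ dF) -(mul_jac _ dG) JFG.
Qed.

(** In fibred coordinates p keeps the target and the matrix, p_* the target and the base block of
    the Jacobian. Both are linear and so commute with derivatives. *)
Definition proj_p (t : 'rV[R]_(n + gdim (B11 M))) : 'rV[R]_(n + n * n) :=
  row_mx (lsubmx t) (lsubmx (rsubmx t : 'rV[R]_(n * n + n * (n + n * n)))).
Definition proj_pstar (t : 'rV[R]_(n + gdim (B11 M))) : 'rV[R]_(n + n * n) :=
  row_mx (lsubmx t)
    (mxvec (lsubmx (vec_mx (rsubmx (rsubmx t : 'rV[R]_(n * n + n * (n + n * n))))))).

Lemma proj_p_linear : linear proj_p.
Proof. by move=> k u v; rewrite /proj_p !linearP /= scale_row_mx add_row_mx. Qed.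

Lemma proj_pstar_linear : linear proj_pstar.
Proof. by move=> k u v; rewrite /proj_pstar !linearP /= scale_row_mx add_row_mx. Qed.

HB.instance Definition _ := GRing.isLinear.Build R _ _ _ proj_p proj_p_linear.
HB.instance Definition _ := GRing.isLinear.Build R _ _ _ proj_pstar proj_pstar_linear.

Lemma srep_p11 phi psi e a : srep phi psi (fun z => p11 (e z)) a = proj_p (srep phi psi e a).
Proof. by rewrite srep_B11 /proj_p row_mxKl row_mxKr row_mxKl srep_B1. Qed.

Lemma srep_pstar11 phi psi e z : atlas phi -> atlas psi -> jet_arr (e z) -> (e z).1 = z ->
  cdom phi z -> cdom psi (gtgt (e z)) ->
  srep phi psi (fun z => pstar11 (e z)) (phi z) = proj_pstar (srep phi psi e (phi z)).
Proof.
move=> aphi apsi arr ez pz qz.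
rewrite srep_B11 /proj_pstar row_mxKl !row_mxKr mxvecK srep_B1 bas_at // mat_at // chartK //.
have [lc cz _] := jet_repP arr; rewrite ez in cz.
have qz' : cdom psi (ltgt ((jet_rep (e z)).2 z)) by move: qz; rewrite /gtgt /= /jet_val ez.
have := @lmat_pstar11 _ _ _ (e z) phi psi arr; cbv zeta; rewrite ez => -> //.
rewrite -[ltgt (pstar11 (e z))]/(ltgt ((jet_rep (e z)).2 (e z).1)) /jet_val ez.
congr (row_mx _ (mxvec _)); apply: mul_rV_eqP => v.
rewrite mulmx_lsub (mul_jac_srep _ lc cz) // row_mxKl.
by rewrite (mul_jac _ (bas_diff lc cz aphi apsi pz qz')).
Qed.

Section AtPoint.
Variables (U : set M) (e : M -> gsort (B11 M)) (x : M).
Hypotheses (le : local_bisection (G := B11 M) U e) (Ux : U x).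

Let arr z : U z -> jet_arr (e z) := section_arr le.1.
Let src z : U z -> (e z).1 = z := section_src le.1.

(** The formula for p_* asks that e(z) be a jet with source z, so it holds near x, whereas the one
    for p holds at all coordinates. *)
Lemma near_srep_pstar11 phi psi : atlas phi -> atlas psi -> cdom phi x ->
  cdom psi (gtgt (e x)) ->
  \forall a \near phi x, proj_pstar (srep phi psi e a) = srep phi psi (fun z => pstar11 (e z)) a.
Proof.
move=> aphi apsi px qx.
have N := near_chart_dom le.2 aphi apsi Ux px qx; have N' := near_cimg px.
near=> a.
have [_ ea] : cdom phi (cinv phi a) /\ phi (cinv phi a) = a by apply: cimgP; near: a.
have [[Ua pa] qa] : chart_dom U (fun z => gtgt (e z)) phi psi (cinv phi a) by near: a.
by rewrite -ea; apply/esym/srep_pstar11 => //; [exact: arr|exact: src].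
Unshelve. all: by end_near. Qed.

Lemma ddir_srep_p11 phi psi v : atlas phi -> atlas psi -> cdom phi x ->
  cdom psi (gtgt (e x)) ->
  differentiable (srep phi psi (fun z => p11 (e z))) (phi x) /\
  ddir (srep phi psi (fun z => p11 (e z))) (phi x) v = proj_p (ddir (srep phi psi e) (phi x) v).
Proof.
move=> aphi apsi px qx; have de := section_diff le.1 aphi apsi Ux px qx.
have -> : srep phi psi (fun z => p11 (e z)) = fun a => proj_p (srep phi psi e a).
  by apply/funext => a; rewrite srep_p11.
split; first exact: (differentiable_lin_comp proj_p de).
exact: (ddir_lin proj_p v de).
Qed.

Lemma ddir_srep_pstar11 phi psi v : atlas phi -> atlas psi -> cdom phi x ->
  cdom psi (gtgt (e x)) ->
  differentiable (srep phi psi (fun z => pstar11 (e z))) (phi x) /\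
  ddir (srep phi psi (fun z => pstar11 (e z))) (phi x) v =
  proj_pstar (ddir (srep phi psi e) (phi x) v).
Proof.
move=> aphi apsi px qx; have de := section_diff le.1 aphi apsi Ux px qx.
have N := near_srep_pstar11 aphi apsi px qx.
have dl := differentiable_lin_comp proj_pstar de.
split; first exact: differentiable_near N dl.
by rewrite -(ddir_near v N); exact: (ddir_lin proj_pstar v de).
Qed.

End AtPoint.

Lemma sjet_p11 U W e c x : local_bisection (G := B11 M) U e -> U x ->
  local_bisection (G := B11 M) W c -> W x -> sjet x e c ->
  sjet x (fun z => p11 (e z)) (fun z => p11 (c z)).
Proof.
move=> le Ux lc Wx /sjetE[ec J]; apply/sjetE; split; first by rewrite ec.
move=> phi psi aphi apsi px qx.
have qc : cdom psi (gtgt (c x)) by rewrite -ec.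
have Je := J phi psi aphi apsi px qx.
have de := section_diff le.1 aphi apsi Ux px qx.
have dc := section_diff lc.1 aphi apsi Wx px qc.
exact: (jac_proj (fun v => ddir_srep_p11 le Ux v aphi apsi px qx)
  (fun v => ddir_srep_p11 lc Wx v aphi apsi px qc) de dc Je).
Qed.

Lemma sjet_pstar11 U W e c x : local_bisection (G := B11 M) U e -> U x ->
  local_bisection (G := B11 M) W c -> W x -> sjet x e c ->
  sjet x (fun z => pstar11 (e z)) (fun z => pstar11 (c z)).
Proof.
move=> le Ux lc Wx /sjetE[ec J]; apply/sjetE; split; first by rewrite ec.
move=> phi psi aphi apsi px qx0.
have qx : cdom psi (gtgt (e x)).
  move: qx0; change (gtgt (pstar11 (e x))) with (ltgt ((jet_rep (e x)).2 (e x).1)).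
  exact.
have qc : cdom psi (gtgt (c x)) by rewrite -ec.
have Je := J phi psi aphi apsi px qx.
have de := section_diff le.1 aphi apsi Ux px qx.
have dc := section_diff lc.1 aphi apsi Wx px qc.
exact: (jac_proj (fun v => ddir_srep_pstar11 le Ux v aphi apsi px qx)
  (fun v => ddir_srep_pstar11 lc Wx v aphi apsi px qc) de dc Je).
Qed.

Section Projections.
Variables (U : set M) (e : M -> gsort (B11 M)) (x : M).
Hypotheses (le : local_bisection (G := B11 M) U e) (Ux : U x).

Lemma p111_jet1 : p111 (jet1 x e) = e x.
Proof. exact: jet_val_jet1 le Ux. Qed.

Lemma pstar111_jet1 : pstar111 (jet1 x e) = jet1 x (fun z => p11 (e z)).
Proof.
rewrite /pstar111 /jet_map j1E jet1_src.
have [lc cx J] := jet_rep_jet1 le Ux.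
by apply/esym/jet1_eq; exact: sjet_p11 le Ux lc cx J.
Qed.

Lemma pstarstar111_jet1 : pstarstar111 (jet1 x e) = jet1 x (fun z => pstar11 (e z)).
Proof.
rewrite /pstarstar111 /jet_map j1E jet1_src.
have [lc cx J] := jet_rep_jet1 le Ux.
by apply/esym/jet1_eq; exact: sjet_pstar11 le Ux lc cx J.
Qed.

End Projections.

End ProjectedJets.

(** * A smooth family of bisections with affine jets *)

Section ModelFamily.
Context {R : realType} {n : nat} (M : manifold R n).
Implicit Types (x y z : M) (U W : set M).
Variables (s : M -> gsort (B11 M)) (hs : symmetry_jet s).
Variables (phi psi : chart R n M) (a0 c0 : 'rV[R]_n) (B0 : 'M[R]_n).
Hypotheses (aphi : atlas phi) (apsi : atlas psi) (pa0 : (phi @` cdom phi) a0)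
  (qc0 : (psi @` cdom psi) c0) (uB : B0 \in unitmx).

Let beta := aff_base a0 c0 B0.
Let Bm := aff_mat s phi psi a0 c0 B0.
Let W := coord_dom phi (aff_dom s phi psi a0 c0 B0).

(** The member at x' is the model bisection started from the value at x' of the model at the centre
    a0; at the centre the family returns that model itself. *)
Definition fam_dom x' : set M :=
  coord_dom phi (aff_dom s phi psi (phi x') (beta (phi x')) (Bm (phi x'))).
Definition fam_bis x' : M -> gsort (B1 M) :=
  aff_bis s phi psi (phi x') (beta (phi x')) (Bm (phi x')).

Let bb (t : 'rV[R]_(n + n)) :=
  aff_base (lsubmx t) (beta (lsubmx t)) (Bm (lsubmx t)) (rsubmx t).
Let mm (t : 'rV[R]_(n + n)) :=
  aff_mat s phi psi (lsubmx t) (beta (lsubmx t)) (Bm (lsubmx t)) (rsubmx t).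
Let O1 : set 'rV[R]_(n + n) :=
  [set t | (phi @` cdom phi) (lsubmx t) /\ (psi @` cdom psi) (beta (lsubmx t))].

Let mxsmooth_lsub m (O : set 'rV[R]_m) k l (f : 'rV[R]_m -> 'rV[R]_(k + l)) :
  open O -> mxsmooth O f -> mxsmooth O (fun t => lsubmx (f t)).
Proof. by move=> oO sf; exact: (mxsmooth_lin lsubmx oO sf). Qed.

Let mxsmooth_rsub m (O : set 'rV[R]_m) k l (f : 'rV[R]_m -> 'rV[R]_(k + l)) :
  open O -> mxsmooth O f -> mxsmooth O (fun t => rsubmx (f t)).
Proof. by move=> oO sf; exact: (mxsmooth_lin rsubmx oO sf). Qed.

Let sbeta (O : set 'rV[R]_(n + n)) : open O -> mxsmooth O (fun t => beta (lsubmx t)).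
Proof.
move=> oO; apply: mxsmooth_aff_base => //; try exact: mxsmooth_cst.
by apply: mxsmooth_lsub => //; exact: mxsmooth_id.
Qed.

Let sBm (O : set 'rV[R]_(n + n)) : open O -> mxsmooth O (fun t => Bm (lsubmx t)).
Proof.
move=> oO; apply: (mxsmooth_aff_mat hs) => //; try exact: mxsmooth_cst.
by apply: mxsmooth_lsub => //; exact: mxsmooth_id.
Qed.

Let sl (O : set 'rV[R]_(n + n)) : open O -> mxsmooth O (fun t => lsubmx t : 'rV[R]_n).
Proof. by move=> oO; apply: mxsmooth_lsub => //; exact: mxsmooth_id. Qed.

Let sr (O : set 'rV[R]_(n + n)) : open O -> mxsmooth O (fun t => rsubmx t : 'rV[R]_n).
Proof. by move=> oO; apply: mxsmooth_rsub => //; exact: mxsmooth_id. Qed.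

Let oO1 : open O1.
Proof.
have o1 := open_comap openT (@cimg_open _ _ _ phi) (sl openT).
have o2 := open_comap openT (@cimg_open _ _ _ psi) (sbeta openT).
by have := openI o1 o2; congr open; apply/seteqP; split=> t [];
  [move=> [_ ?] [_ ?]|move=> ? ?; split; split].
Qed.

Let sbb (O : set 'rV[R]_(n + n)) : open O -> mxsmooth O bb.
Proof.
move=> oO; apply: mxsmooth_aff_base => //; [exact: sl|exact: sbeta|exact: sBm|exact: sr].
Qed.

Let smm (O : set 'rV[R]_(n + n)) : open O -> O `<=` O1 -> mxsmooth O mm.
Proof.
move=> oO OO; apply: (mxsmooth_aff_mat hs) => //.
- by move=> t /OO[].
- by move=> t /OO[].
- exact: sl.
- exact: sbeta.
- exact: sBm.
- exact: sr.
Qed.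

(* Pairs of points of the chart phi, in coordinates, over which the family is defined. *)
Let O2 : set 'rV[R]_(n + n) :=
  [set t | aff_dom s phi psi a0 c0 B0 (lsubmx t) /\
    aff_dom s phi psi (lsubmx t) (beta (lsubmx t)) (Bm (lsubmx t)) (rsubmx t)].

Let oO2 : open O2.
Proof.
have o1 := open_comap oO1 (@cimg_open _ _ _ phi) (sr oO1).
have o2 := open_comap oO1 (@cimg_open _ _ _ psi) (sbb oO1).
have o3 := open_unitmx oO1 (smm oO1 (@subset_refl _ O1)).
have o4 := open_unitmx oO1 (sBm oO1).
have := openI (openI o1 o2) (openI o3 o4); congr open; apply/seteqP; split=> t.
  by move=> [[[[? ?] ?] [_ ?]] [[_ ?] [_ ?]]]; split; split.
by move=> [[? ? ?] [? ? ?]]; do !split.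
Qed.

Let O2O1 : O2 `<=` O1.
Proof. by move=> t [[? ? _] _]; split. Qed.

Lemma continuous_row_mx_pair phi1 phi2 (q : M * M) : cdom phi1 q.1 -> cdom phi2 q.2 ->
  {for q, continuous (fun q : M * M => row_mx (phi1 q.1) (phi2 q.2) : 'rV[R]_(n + n))}.
Proof.
move=> p1 p2 S /nbhs_ballP[e e0 eS].
have N1 : nbhs q.1 [set z | ball (phi1 q.1) e (phi1 z)].
  by apply: (cmap_cts p1); exact: nbhsx_ballx.
have N2 : nbhs q.2 [set z | ball (phi2 q.2) e (phi2 z)].
  by apply: (cmap_cts p2); exact: nbhsx_ballx.
exists ([set z | ball (phi1 q.1) e (phi1 z)], [set z | ball (phi2 q.2) e (phi2 z)]) => //.
move=> [z1 z2] /= [[_ b1] [_ b2]]; apply: eS; split=> // i j.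
case: (splitP j) => k jk.
  by rewrite (_ : j = lshift _ k) ?row_mxEl //; exact: val_inj.
by rewrite (_ : j = rshift _ k) ?row_mxEr //; exact: val_inj.
Qed.

Lemma fam_smooth : smooth_family W fam_dom fam_bis.
Proof.
move=> phi1 phi2 psi1 aphi1 aphi2 apsi1 Omega.
pose O3 := O2 `&` bb @^-1` overlap psi psi1.
have oO3 : open O3 by apply: open_comap; [exact: oO2|exact: open_overlap|exact: sbb].
pose D := (cdom phi `&` cdom phi1) `*` (cdom phi `&` cdom phi2).
have oD : open D.
  rewrite openE => -[z1 z2] [/= [p1 p1'] [p2 p2']].
  exists (cdom phi `&` cdom phi1, cdom phi `&` cdom phi2) => //.
  by split; apply: open_nbhs_nbhs; split=> //; apply: openI; exact: cdom_open.
have tgtE z1 z2 : fam_dom z1 z2 -> cdom psi (ltgt (fam_bis z1 z2)) /\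
    psi (ltgt (fam_bis z1 z2)) = bb (row_mx (phi z1) (phi z2)).
  move=> [pz [_ qz _]]; rewrite /bb row_mxKl row_mxKr.
  exact: cimgP qz.
have O2E z1 z2 : cdom phi z1 -> cdom phi z2 ->
    O2 (row_mx (phi z1) (phi z2)) <-> W z1 /\ fam_dom z1 z2.
  move=> p1 p2; rewrite /O2 /= row_mxKl row_mxKr; split.
    by move=> [h1 h2]; split; split.
  by move=> [[_ h1] [_ h2]]; split.
(* Openness of Omega in M x M is pulled back from the joint chart given by [phi] on both factors. *)
have eO : Omega = D `&` (fun q : M * M => row_mx (phi q.1) (phi q.2)) @^-1` O3.
  apply/seteqP; split=> -[z1 z2].
    move=> [/= Wz Uz p1 p2 q1]; have [pz1 _] := Wz; have [pz2 _] := Uz.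
    have [qz eq] := tgtE z1 z2 Uz.
    split; first by split; split.
    split; first by apply/O2E.
    rewrite /preimage /= -eq; exact: overlapP.
  move=> [[/= [pz1 p1] [pz2 p2]] [/(O2E z1 z2 pz1 pz2)[Wz Uz] /overlapE[_ q1 _]]].
  have [qz eq] := tgtE z1 z2 Uz; have := q1; rewrite /= -eq (chartK qz) => q1'.
  exact: (And5 Wz Uz p1 p2 q1').
have oOmega : open Omega.
  rewrite eO; apply: open_within_preimage => // -[z1 z2] [/= [pz1 _] [pz2 _]].
  exact: (continuous_row_mx_pair (q := (z1, z2))).
split; first exact: oOmega.
pose S0 : set 'rV[R]_(n + n) :=
  [set t | overlap phi1 phi (lsubmx t) /\ overlap phi2 phi (rsubmx t)].
have oS0 : open S0.
  have o1 := open_comap openT (@open_overlap _ _ _ phi1 phi) (sl openT).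
  have o2 := open_comap openT (@open_overlap _ _ _ phi2 phi) (sr openT).
  by have := openI o1 o2; congr open; apply/seteqP; split=> t [];
    [move=> [_ ?] [_ ?]|move=> ? ?; split; split].
(* Change of coordinates from the pair ([phi1], [phi2]) to [phi] on both factors, in which the
   family has its explicit formula. *)
pose T (t : 'rV[R]_(n + n)) : 'rV[R]_(n + n) :=
  row_mx (tr phi1 phi (lsubmx t)) (tr phi2 phi (rsubmx t)).
have sT : mxsmooth S0 T.
  apply: mxsmooth_row_mx => //.
    apply: (mxsmooth_comp oS0) (sl oS0) (tr_smooth aphi1 aphi); by move=> t [].
  apply: (mxsmooth_comp oS0) (sr oS0) (tr_smooth aphi2 aphi); by move=> t [].
have eS : [set row_mx (phi1 q.1) (phi2 q.2) | q in Omega] = S0 `&` T @^-1` O3.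
  rewrite eO; apply/seteqP; split=> t.
    move=> [[z1 z2] [[/= [pz1 p1] [pz2 p2]] Oz] <-].
    rewrite /S0 /preimage /T /= row_mxKl row_mxKr /tr !chartK //.
    by split=> //; split; exact: overlapP.
  move=> [[/overlapE[p1 pz1 e1] /overlapE[p2 pz2 e2]] Ot].
  exists (cinv phi1 (lsubmx t), cinv phi2 (rsubmx t)) => /=; last by rewrite e1 e2 hsubmxK.
  by split=> //; split; split.
rewrite eS; set S := S0 `&` _.
have oS : open S by apply: open_comap.
apply/smoothE; split; first exact: oS.
have SS0 : S `<=` S0 by move=> t [].
have ST t : S t -> O2 (T t) by move=> [_ []].
have sTS := mxsmooth_sub SS0 sT.
have Sr t : S t -> overlap phi2 phi (rsubmx t) by move=> [[]].
have Sq t : S t -> overlap psi psi1 (bb (T t)) by move=> [_ []].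
apply: mxsmooth_ext oS _ (mxsmooth_chart_change oS aphi aphi2 apsi apsi1 Sr Sq (sr oS)
  (mxsmooth_comp oS ST sTS (sbb oO2)) (mxsmooth_comp oS ST sTS (smm oO2 O2O1))).
move=> t St; have [[/overlapE[p1 pz1 e1] Or] [_ Oq]] := St.
have Oq' : overlap psi psi1 (aff_base (tr phi1 phi (lsubmx t))
    (beta (tr phi1 phi (lsubmx t))) (Bm (tr phi1 phi (lsubmx t)))
    (tr phi2 phi (rsubmx t))).
  by move: Oq; rewrite /preimage /= /bb /T row_mxKl row_mxKr.
rewrite sec_repE /fam_bis /aff_bis (srep_coord_bis _ aphi apsi aphi2 apsi1 Or Oq').
by rewrite /bb /mm /T row_mxKl row_mxKr.
Qed.

End ModelFamily.

(** * Existence: the jet [affine_ext2] is affine *)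

Section ExistenceOrderThree.
Context {R : realType} {n : nat} (M : manifold R n).
Implicit Types (x y z : M) (phi psi : chart R n M) (U W : set M) (b : M -> gsort (B1 M)).
Implicit Types (X Y Z : M -> 'rV[R]_n).
Variables (s : M -> gsort (B11 M)) (hs : symmetry_jet s).

Lemma bisection_ext (G : groupoid M) U (b c : M -> gsort G) :
  (forall z, U z -> b z = c z) -> local_bisection U b -> local_bisection U c.
Proof.
move=> bc [[oU arr sb] db]; split; last first.
  by apply: diffeo_ext db => z Uz; rewrite /= bc.
split=> // [z Uz|phi psi aphi apsi]; first by rewrite -bc //; exact: arr.
have eW : U `&` cdom phi `&` (@gtgt R n M G \o b) @^-1` cdom psi =
          U `&` cdom phi `&` (@gtgt R n M G \o c) @^-1` cdom psi.
  apply/seteqP; split=> z [[Uz pz] qz]; apply: conj (conj Uz pz) _; move: qz;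
    by rewrite /preimage /mkset /comp (bc z Uz).
have := sb phi psi aphi apsi; cbv zeta; rewrite eW => -[oW /smoothE[oW' sW]].
split; first exact: oW.
apply/smoothE; split; first exact: oW'.
apply: mxsmooth_ext oW' _ sW => a [z [[Uz pz] _] <-].
by rewrite /sec_rep chartK // bc.
Qed.

Lemma sjet_ext (G : groupoid M) U (b c : M -> gsort G) x : local_bisection U b -> U x ->
  (forall z, U z -> b z = c z) -> sjet x b c.
Proof.
move=> lb Ux bc; have [[oU _ _] _] := lb.
apply: (sjet_near oU Ux bc) => phi psi aphi apsi px qx.
exact: (section_diff lb.1 aphi apsi Ux px qx).
Qed.

Lemma nabla_smooth Y Z phi : smooth_vf Y -> smooth_vf Z -> atlas phi ->
  mxsmooth (phi @` cdom phi) (vrep phi (nabla s Y Z)).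
Proof.
move=> sY sZ aphi; have oO := @cimg_open _ _ _ phi.
have /smoothE[_] := sY phi aphi; rewrite vf_repE => CY.
have /smoothE[_] := sZ phi aphi; rewrite vf_repE => CZ.
apply: (@mxsmooth_ext _ _ _ _ _ (fun a => ddir (vrep phi Z) a (vrep phi Y a) +
    chris s phi a (vrep phi Y a) (vrep phi Z a))) => //.
  move=> a [z pz <-]; rewrite !vrep_at // (nabla_coord hs) //.
  exact: smooth_vf_diff sZ aphi pz.
apply: mxsmoothD => //; first exact: mxsmooth_ddir_fun.
apply: (mxsmooth_chris hs) => //; exact: mxsmooth_id.
Qed.

Lemma nabla_at_pt Y Z x phi : atlas phi -> cdom phi x ->
  differentiable (vrep phi Z) (phi x) -> nabla_at s x (Y x) Z = nabla s Y Z x.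
Proof.
move=> aphi px dZ; apply: (mul_tc_inj aphi px).
have e1 := @nabla_at_coord _ _ _ s hs x (Y x) Z phi aphi px dZ.
have e2 := @nabla_coord _ _ _ s hs Y Z x phi aphi px dZ.
exact: (etrans e1 (esym e2)).
Qed.

Lemma nabla_at_vf Y Z x : smooth_vf Z -> nabla_at s x (Y x) Z = nabla s Y Z x.
Proof.
move=> sZ; have aphi := chart_at_atlas x; have px := chart_at_dom x.
exact: nabla_at_pt aphi px (smooth_vf_diff sZ aphi px).
Qed.

(** The field V of the third order condition is known only on the image of the base map; locality of
    the connection makes this enough. *)
Lemma nabla_at_near U y u (V V' : M -> 'rV[R]_n) psi : open U -> U y ->
  atlas psi -> cdom psi y -> (forall z, U z -> V z = V' z) ->
  differentiable (vrep psi V) (psi y) ->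
  differentiable (vrep psi V') (psi y) /\ nabla_at s y u V = nabla_at s y u V'.
Proof.
move=> oU Uy apsi qy VV dV.
have N : \forall a \near psi y, vrep psi V a = vrep psi V' a.
  have := near_chart qy (open_nbhs_nbhs (conj oU Uy)).
  by apply: filterS => a Ua; rewrite !vrepE VV.
have dV' := differentiable_near N dV; split; first exact: dV'.
apply: (mul_tc_inj apsi qy).
have e1 := @nabla_at_coord _ _ _ s hs y u V psi apsi qy dV.
have e2 := @nabla_at_coord _ _ _ s hs y u V' psi apsi qy dV'.
apply: (etrans e1); apply/esym/(etrans e2).
by rewrite (ddir_near _ N) VV.
Qed.

Lemma affine_ext2_jet1 xi : garr (B1 M) xi -> exists U b,
  [/\ local_bisection U b, U (lsrc xi), jet1 (lsrc xi) b = affine_ext s xi &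
      affine_ext2 s xi = jet1 (lsrc xi) (fun z => affine_ext s (b z))].
Proof.
move=> uxi; rewrite /affine_ext2.
set S := (X in xget _ X).
have [eta Seta] : exists eta, S eta.
  have [[[arr _] _] pe] := affine_ext_spec hs uxi.
  have [lc cx ec] := jet_repP arr; set c := jet_rep _ in lc cx ec.
  have ex : (affine_ext s xi).1 = lsrc xi.
    by rewrite -(section_lsrc lc cx) -[in RHS]pe.
  exists (@j1 _ _ _ (B11 M) (lsrc xi) (affine_ext s \o c.2)); exists c.1, c.2.
  have cx' : c.1 (lsrc xi) by rewrite -ex.
  have ec' : j1 (lsrc xi) c.2 = affine_ext s xi by rewrite j1E -ex -ec.
  exact: (And4 lc cx' ec' erefl).
have := @xgetPex {classic (gsort (B111 M))} (gunit (B111 M) (gsrc xi)) S (ex_intro _ eta Seta).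
move=> [U [b [lb Ub eb ->]]]; exists U, b; apply: (And4 lb Ub).
  by rewrite -eb j1E.
by rewrite j1E.
Qed.

Section Model.
Variables (xi : gsort (B1 M)) (uxi : garr (B1 M) xi).
Let x := lsrc xi.
Let y := ltgt xi.
Let phi := chart_at x.
Let psi := chart_at y.
Let B0 := lmat phi psi xi.
Let b0 := aff_bis s phi psi (phi x) (psi y) B0.
Let W := coord_dom phi (aff_dom s phi psi (phi x) (psi y) B0).
Let fU := fam_dom s phi psi (phi x) (psi y) B0.
Let fb := fam_bis s phi psi (phi x) (psi y) B0.

Let aphi : atlas phi := chart_at_atlas x.
Let apsi : atlas psi := chart_at_atlas y.
Let px : cdom phi x := chart_at_dom x.
Let qy : cdom psi y := chart_at_dom y.

Let pa0 : (phi @` cdom phi) (phi x). Proof. by exists x. Qed.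
Let qc0 : (psi @` cdom psi) (psi y). Proof. by exists y. Qed.

Let uB : B0 \in unitmx. Proof. exact: lmat_unit. Qed.

Let Wx : W x. Proof. by split=> //; exact: aff_dom0. Qed.

Let lb0 : local_bisection W b0. Proof. exact: aff_local_bisection. Qed.

Let b0x : b0 x = xi.
Proof.
have [q1 q2 q3] := aff_bis_coord aphi apsi Wx.
apply: (lmat_inj aphi apsi) => //.
  by rewrite -(chartK q1) q2 aff_base0 chartK.
by rewrite q3 aff_mat0.
Qed.

Let ab0 : affine11 s (jet1 x b0). Proof. exact: (aff_bis_affine hs). Qed.

Let eb0 : jet1 x b0 = affine_ext s xi.
Proof.
have [ae pe] := affine_ext_spec hs uxi.
apply: (affine11_unique hs) => //.
by rewrite pe /p11 (jet_val_jet1 lb0 Wx).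
Qed.

(** The bisection chosen in [affine_ext2] and the explicit model both have jet S(xi), so they give
    the same third order jet. *)
Lemma affine_ext2_model : affine_ext2 s xi = jet1 x (fun z => affine_ext s (b0 z)).
Proof.
have [U [b [lb Ux eb ->]]] := affine_ext2_jet1 uxi.
apply: jet1_eq; apply: (sjet_affine_ext hs lb lb0 Ux Wx).
by apply: (jet1_inj lb Ux); rewrite eb eb0.
Qed.

Let fUx : fU x = W. Proof. by rewrite /fU /fam_dom aff_base0 aff_mat0. Qed.
Let fbx : fb x = b0. Proof. by rewrite /fb /fam_bis aff_base0 aff_mat0. Qed.

Section FamilyAt.
Variables (x' : M) (Wx' : W x').

Let paff : (phi @` cdom phi) (phi x'). Proof. by case: Wx' => _ []. Qed.
Let qaff : (psi @` cdom psi) (aff_base (phi x) (psi y) B0 (phi x')).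
Proof. by case: Wx' => _ []. Qed.
Let uaff : aff_mat s phi psi (phi x) (psi y) B0 (phi x') \in unitmx.
Proof. by case: Wx' => _ []. Qed.

Lemma fam_local_bisection : local_bisection (fU x') (fb x').
Proof. exact: aff_local_bisection. Qed.

Lemma fam_dom_self : fU x' x'.
Proof. by split; [case: Wx'|exact: aff_dom0]. Qed.

Lemma fam_bis_self : fb x' x' = b0 x'.
Proof.
by rewrite /fb /b0 /fam_bis /aff_bis /coord_bis /coord_map aff_base0 aff_mat0.
Qed.

Lemma fam_affine : affine11 s (jet1 x' (fb x')).
Proof. by apply: (aff_bis_affine hs) => //; case: Wx'. Qed.

Lemma fam_affine_ext : affine_ext s (b0 x') = jet1 x' (fb x').
Proof.
have [ae pe] := affine_ext_spec hs (section_unit lb0 Wx').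
apply: (affine11_unique hs ae fam_affine).
by rewrite pe /p11 (jet_val_jet1 fam_local_bisection fam_dom_self) fam_bis_self.
Qed.

End FamilyAt.

(** S takes semiholonomic values, so S o b0 projects to b0 under p_* as well as under p; hence both
    p_* and p_** of the third order jet are the jet of b0. *)
Lemma pstar11_affine_ext z : W z -> pstar11 (affine_ext s (b0 z)) = b0 z.
Proof.
move=> Wz; have [[[_ <-] _] pe] := affine_ext_spec hs (section_unit lb0 Wz).
exact: pe.
Qed.

Lemma jets111_affine_ext2 : jets111 (affine_ext2 s xi).
Proof.
have le := affine_ext_bisection hs lb0.
rewrite affine_ext2_model.
have e1 : p111 (jet1 x (fun z => affine_ext s (b0 z))) = jet1 x b0.
  by rewrite (p111_jet1 le Wx) b0x eb0.
have [sem _] := ab0.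
apply: And4.
- exact: (jet_arr_jet1 le Wx).
- rewrite (pstar111_jet1 le Wx) e1; apply: jet1_eq.
  apply: (sjet_ext lb0 Wx) => z Wz.
  by have [_ ->] := affine_ext_spec hs (section_unit lb0 Wz).
- rewrite (pstarstar111_jet1 le Wx) e1; apply: jet1_eq.
  apply: (sjet_ext lb0 Wx) => z Wz; exact: (esym (pstar11_affine_ext Wz)).
- by rewrite e1.
Qed.

Lemma affine_ext2_affine : affine111 s (affine_ext2 s xi).
Proof.
have le := affine_ext_bisection hs lb0.
have ex : (affine_ext2 s xi).1 = x by rewrite affine_ext2_model jet1_src.
have e1 : p111 (affine_ext2 s xi) = jet1 x b0.
  by rewrite affine_ext2_model (p111_jet1 le Wx) b0x eb0.
have lfe : forall z, W z -> affine_ext s (b0 z) = j1 z (fb z).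
  by move=> z Wz; rewrite j1E; exact: fam_affine_ext.
rewrite /affine111 ex; apply: And3.
- exact: jets111_affine_ext2.
- by rewrite e1; exact: ab0.
exists W, fU, fb; apply: And5.
- by rewrite fUx; split=> //; exact: Wx.
- by move=> z Wz; split; [exact: fam_local_bisection|exact: fam_dom_self].
- split; last by move=> z Wz; rewrite fbx fam_bis_self.
  exact: (fam_smooth hs).
- split; first exact: bisection_ext lfe le.
  rewrite affine_ext2_model j1E; apply: jet1_eq; exact: (sjet_ext le Wx lfe).
move=> X Y Z sX sY sZ; rewrite fbx b0x.
cbv zeta; set V := (X in _ = nabla_at _ _ _ X).
have tgtx : ltgt (b0 x) = y by rewrite b0x.
(* The member of the family at z has affine jet there, so differentiating the pushed Z amounts to
   pushing nabla_Y Z by b0(z). *)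
have VE z : W z -> V (ltgt (b0 z)) = push W b0 (nabla s Y Z) (ltgt (b0 z)).
  move=> Wz; rewrite (push_at lb0 _ Wz) /V /=.
  set S := [set x' | _].
  have [Wz' ez'] : S (xget (ltgt (b0 z)) S) by apply: (@xgetI _ _ S z).
  rewrite (diffeo_inj lb0.2 Wz' Wz ez') => {Wz' ez' S}.
  have lz : local_bisection (fU z) (fb z) by exact: fam_local_bisection.
  have Uz : fU z z by exact: fam_dom_self.
  have az : affine11 s (jet1 z (fb z)) by exact: fam_affine.
  have H := affine11_apply hs (Y z) lz Uz az (chart_at_atlas z) (chart_at_dom z)
    (smooth_vf_diff sZ (chart_at_atlas z) (chart_at_dom z)).
  by rewrite -(nabla_at_vf Y z sZ); move: H; rewrite fam_bis_self => ->.
have dN : differentiable (vrep phi (nabla s Y Z)) (phi x).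
  by apply: mxsmooth_diff (nabla_smooth sY sZ aphi) _; exists x.
have H := affine11_apply hs (X x) lb0 Wx ab0 aphi px dN.
have qx : cdom psi (ltgt (b0 x)) by rewrite tgtx.
have [dP _] := push_ddir lb0 Wx aphi apsi px qx dN.
have [_ oI _ _] := lb0.2.
have Iy : ((@gtgt R n M (B1 M) \o b0) @` W) y by exists x => //; rewrite /= b0x.
have [_ <-] := @nabla_at_near _ y (app xi (X x)) (push W b0 (nabla s Y Z)) V psi oI Iy apsi qy
  (fun z Iz => let: ex_intro2 w Ww e := Iz in
     eq_ind (ltgt (b0 w)) (fun z => push W b0 (nabla s Y Z) z = V z) (esym (VE w Ww)) z e)
  (eq_ind _ (fun y => differentiable (vrep psi (push W b0 (nabla s Y Z))) (psi y)) dP _ tgtx).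
have eN := nabla_at_pt X aphi px dN.
rewrite b0x in H.
exact: (etrans (congr1 (app xi) (esym eN)) H).
Qed.

Lemma first_order_affine_ext2 : first_order_part (affine_ext2 s xi) = xi.
Proof.
have le := affine_ext_bisection hs lb0.
rewrite /first_order_part affine_ext2_model (p111_jet1 le Wx) b0x.
by have [] := affine_ext_spec hs uxi.
Qed.

End Model.

End ExistenceOrderThree.

(** * Affine (1,1,1)-jets: uniqueness *)

(** Bookkeeping for V minus the image of nabla_Y Z: t1 and t2 stem from the derivative of Z along Y
    and d, t3 and t4 from N(Y) and N(d), c and w from Gamma at target and source; w - c becomes the
    term in A. *)
Lemma zmod_regroup (V : zmodType) (t1 t2 t3 t4 c w : V) :
  t1 + t2 + (t3 + t4) + c - (t1 + w) = t2 + t4 + (t3 - (w - c)).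
Proof.
have -> : t1 + t2 + (t3 + t4) + c = t1 + (t2 + t4 + (t3 + c)).
  by rewrite -!addrA; congr (_ + (_ + _)); rewrite addrCA.
by rewrite opprD addrACA subrr add0r opprB -!addrA.
Qed.

Section UniquenessOrderThree.
Context {R : realType} {n : nat} (M : manifold R n).
Implicit Types (z : M).
Implicit Types (X Y Z : M -> 'rV[R]_n).
Variables (s : M -> gsort (B11 M)) (hs : symmetry_jet s).
Variables (x : M) (W : set M) (U : M -> set M) (b : M -> M -> gsort (B1 M)).
Let e z : gsort (B11 M) := jet1 z (b z).
Let f z : M := ltgt (b x z).
Hypotheses (Wx : W x) (WU : W `<=` U x)
  (lb : forall z, W z -> local_bisection (U z) (b z)) (Uz : forall z, W z -> U z z)
  (bE : forall z, W z -> b z z = b x z)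
  (le : local_bisection (G := B11 M) W e)
  (ab : affine11 s (jet1 x (b x)))
  (pss : jet1 x (b x) = jet1 x (fun z => pstar11 (e z))).

Definition third_order_field Y Z : M -> 'rV[R]_n := fun y' =>
  let x' := xget y' [set x' | W x' /\ gtgt (b x x') = y'] in
  nabla_at s y' (app (b x x') (Y x')) (push (U x') (b x') Z).

Hypothesis cond : forall X Y Z, smooth_vf X -> smooth_vf Y -> smooth_vf Z ->
  app (b x x) (nabla s X (nabla s Y Z) x) =
  nabla_at s (ltgt (b x x)) (app (b x x) (X x)) (third_order_field Y Z).

Variables (phi psi : chart R n M).
Hypotheses (aphi : atlas phi) (apsi : atlas psi) (px : cdom phi x)
  (qx : cdom psi (ltgt (b x x))).

Let lbx : local_bisection (U x) (b x) := lb Wx.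
Let Ux : U x x := Uz Wx.

Let gtgt_e z : W z -> gtgt (e z) = f z.
Proof.
move=> Wz; rewrite -[gtgt (e z)]/(ltgt (jet_val (e z))) /e.
by rewrite (jet_val_jet1 (lb Wz) (Uz Wz)) bE.
Qed.

Let df : diffeo_onto_open W f.
Proof. by apply: diffeo_ext le.2 => z Wz; exact: gtgt_e. Qed.

Let Wc := chart_dom W f phi psi.

Let oWc : open Wc. Proof. exact: (open_chart_dom df). Qed.
Let oI : open (phi @` Wc). Proof. by apply: open_chart_img => // z [[]]. Qed.
Let Ix : (phi @` Wc) (phi x). Proof. by exists x. Qed.

(** The Jacobian of b_z at z itself, as a function of the coordinates of z. [J1] and [N] are its two
    blocks; [AJ] and [A] are the affine counterparts. Being a coordinate block of [e], it is smooth
    in z. *)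
Let Je (a : 'rV[R]_n) : 'M[R]_(n, n + n * n) :=
  vec_mx (rsubmx (rsubmx (srep phi psi e a : 'rV[R]_(n + (n * n + n * (n + n * n)))))).
Let J1 a := lsubmx (Je a).
Let N a := rsubmx (Je a).
Let Bx a := mat phi psi (b x) a.
Let be a := bas phi psi (b x) a.
Let AJ a := affJ s phi psi a (be a) (Bx a).
Let A a := rsubmx (AJ a).

Let qz z : Wc z -> cdom psi (ltgt (b z z)).
Proof. by move=> [[Wz _] q]; rewrite bE. Qed.

Let srep_e z : Wc z -> srep phi psi e (phi z) =
  row_mx (be (phi z)) (row_mx (mxvec (Bx (phi z))) (mxvec (jac (srep phi psi (b z)) (phi z)))).
Proof.
move=> Wz; have [[W_z pz] _] := Wz.
rewrite (srep_B11_jet1 aphi apsi (lb W_z) (Uz W_z) erefl pz (qz Wz)).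
by rewrite /be /Bx (bas_at _ _ pz) (bas_at _ _ pz) (mat_at _ _ pz) (mat_at _ _ pz) bE.
Qed.

Let JeE z : Wc z -> Je (phi z) = jac (srep phi psi (b z)) (phi z).
Proof. by move=> Wz; rewrite /Je srep_e // !row_mxKr mxvecK. Qed.

Let J1E z : Wc z -> J1 (phi z) = jac (bas phi psi (b z)) (phi z).
Proof.
move=> Wz; have [[W_z pz] _] := Wz; apply: mul_rV_eqP => v.
rewrite /J1 JeE // mulmx_lsub (mul_jac_srep _ (lb W_z) (Uz W_z) aphi apsi pz (qz Wz)).
by rewrite row_mxKl (mul_jac _ (bas_diff (lb W_z) (Uz W_z) aphi apsi pz (qz Wz))).
Qed.

Let NE z v : Wc z -> vec_mx (v *m N (phi z)) = ddir (mat phi psi (b z)) (phi z) v.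
Proof.
move=> Wz; have [[W_z pz] _] := Wz.
rewrite /N JeE // mulmx_rsub (mul_jac_srep _ (lb W_z) (Uz W_z) aphi apsi pz (qz Wz)).
by rewrite row_mxKr mxvecK.
Qed.

Let AE a v w : w *m vec_mx (v *m A a) = aff s phi psi a (be a) (Bx a) v w.
Proof. by rewrite /A mulmx_rsub mul_affJ row_mxKr mxvecK mul_affM. Qed.

Let lsub_AJ a : lsubmx (AJ a) = Bx a.
Proof. by apply: mul_rV_eqP => v; rewrite mulmx_lsub mul_affJ row_mxKl. Qed.

Let se : mxsmooth (phi @` Wc) (srep phi psi e).
Proof.
have [_ _] := section_smooth le.1 aphi apsi.
by apply: mxsmooth_sub => a [z [[Wz pz] q] <-]; exists z => //; split=> //;
  rewrite /preimage /mkset gtgt_e.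
Qed.

Let sJe : mxsmooth (phi @` Wc) Je.
Proof.
exact: (mxsmooth_lin vec_mx oI (mxsmooth_lin rsubmx oI (mxsmooth_lin rsubmx oI se))).
Qed.

Let sJ1 : mxsmooth (phi @` Wc) J1.
Proof. exact: (mxsmooth_lin lsubmx oI sJe). Qed.

Let sN : mxsmooth (phi @` Wc) N.
Proof. exact: (mxsmooth_lin rsubmx oI sJe). Qed.

Let sbx : mxsmooth (phi @` Wc) be /\ mxsmooth (phi @` Wc) Bx.
Proof.
apply/mxsmooth_srep_B1 => //.
have [_ _] := section_smooth lbx.1 aphi apsi.
by apply: mxsmooth_sub => a [z [[Wz pz] q] <-]; exists z => //; split=> //; split=> //;
  exact: WU.
Qed.

Let sAJ : mxsmooth (phi @` Wc) AJ.
Proof.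
apply: (mxsmooth_affJ hs oI aphi apsi) sbx.1 sbx.2.
- by move=> a [z [[_ pz] _] <-]; exists z.
- by move=> a [z [[_ pz] q] <-]; exists (f z) => //; rewrite /be bas_at.
- exact: mxsmooth_id.
Qed.

Let sA : mxsmooth (phi @` Wc) A.
Proof. exact: (mxsmooth_lin rsubmx oI sAJ). Qed.

(** Each b_z is a bisection, so its base map has invertible derivative even where J differs from
    B. *)
Let uJ1 a : (phi @` Wc) a -> J1 a \in unitmx.
Proof.
move=> [z Wz <-]; have [[W_z pz] _] := Wz; rewrite J1E //.
have [G [_ dG GK _]] := diffeo_inverse (lb W_z).2 aphi apsi (Uz W_z) pz (qz Wz).
exact: (mulmx1_unit (diffeo_jac_inverse (lb W_z).2 aphi apsi (Uz W_z) pz (qz Wz) dG GK)).1.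
Qed.

Let Wcx : Wc x. Proof. by []. Qed.

Let bex : be (phi x) = psi (ltgt (b x x)). Proof. exact: bas_at. Qed.
Let Bxx : Bx (phi x) = lmat phi psi (b x x). Proof. exact: mat_at. Qed.

Let J1x : J1 (phi x) = Bx (phi x).
Proof.
rewrite J1E // Bxx.
by have /(affine11_jet1P hs lbx Ux aphi apsi px qx)[] := ab.
Qed.

Let Nx : N (phi x) = A (phi x).
Proof.
rewrite /N /A JeE //; have /(affine_jac hs lbx Ux aphi apsi px qx) -> := ab.
by rewrite /AJ bex Bxx.
Qed.

Let de : differentiable (srep phi psi e) (phi x) := mxsmooth_diff se Ix.

(* This is where the equality of p and p_** is used. *)
Let dJ1 v : ddir J1 (phi x) v = ddir Bx (phi x) v.
Proof.
have /sjetE[_ J] := jet1_inj lbx Ux pss.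
have qe : cdom psi (gtgt (e x)) by rewrite gtgt_e.
have [dp ep] := ddir_srep_pstar11 le Wx v aphi apsi px qe.
have := congr1 (mulmx v) (J phi psi aphi apsi px qx).
rewrite (mul_jac_srep v lbx Ux aphi apsi px qx) (mul_jac v dp) ep.
move=> /eq_row_mx[_ /(can_inj mxvecK) ->].
have d1 := differentiable_lin_comp rsubmx de.
have d2 := differentiable_lin_comp rsubmx d1.
have d3 := differentiable_lin_comp vec_mx d2.
have e1 := ddir_lin rsubmx v de; have e2 := ddir_lin rsubmx v d1.
have e3 := ddir_lin vec_mx v d2; have e4 := ddir_lin lsubmx v d3.
rewrite e3 e2 e1 in e4; exact: e4.
Qed.

Section Fields.
Variables (X Y Z : M -> 'rV[R]_n).
Hypotheses (sX : smooth_vf X) (sY : smooth_vf Y) (sZ : smooth_vf Z).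
Let V := third_order_field Y Z.
Let P := push (U x) (b x) (nabla s Y Z).
Let Yc := vrep phi Y.
Let Zc := vrep phi Z.
(** Defined by (Y + d) J = Y B: the correction that writes the direction b_x(z) Y as an image under
    the base derivative of b_z. *)
Let d a := Yc a *m (Bx a - J1 a) *m invmx (J1 a).
Let Delta a : 'rV[R]_n := d a *m jac Zc a *m Bx a + Zc a *m vec_mx (d a *m N a) +
  Zc a *m vec_mx (Yc a *m (N a - A a)).

Let img_sub : phi @` Wc `<=` phi @` cdom phi.
Proof. by move=> a [z [[_ pz] _] <-]; exists z. Qed.

Let sYc : mxsmooth (phi @` Wc) Yc.
Proof.
by have /smoothE[_] := sY aphi; rewrite vf_repE; apply: mxsmooth_sub.
Qed.

Let sZc : mxsmooth (phi @` Wc) Zc.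
Proof.
by have /smoothE[_] := sZ aphi; rewrite vf_repE; apply: mxsmooth_sub.
Qed.

Let sd : mxsmooth (phi @` Wc) d.
Proof.
apply: mxsmoothM => //; last exact: mxsmooth_inv.
by apply: mxsmoothM => //; apply: mxsmoothB => //; exact: sbx.2.
Qed.

Let dx : d (phi x) = 0.
Proof. by rewrite /d J1x subrr mulmx0 mul0mx. Qed.

Let ddx v : ddir d (phi x) v = 0.
Proof.
have dY := mxsmooth_diff sYc Ix; have dJ := mxsmooth_diff sJ1 Ix.
have dB := mxsmooth_diff sbx.2 Ix.
have dBJ := differentiableB dB dJ.
have dI := mxsmooth_diff (mxsmooth_inv oI uJ1 sJ1) Ix.
rewrite /d ddirM //; last exact: differentiable_mulmx.
rewrite ddirM // ddirB // dJ1 subrr mulmx0 J1x subrr !mulmx0.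
by rewrite !(mul0mx, addr0).
Qed.

Let VE z : Wc z -> vrep psi V (psi (f z)) - vrep psi P (psi (f z)) = Delta (phi z).
Proof.
move=> Wz; have [[W_z pz] q] := Wz.
rewrite vrep_at // vrep_at // /V /third_order_field.
set S := [set x' | _].
have [Wg eg] : S (xget (f z) S) by apply: (@xgetI _ _ S z).
rewrite (diffeo_inj df Wg W_z eg) => {Wg eg S}.
have aZ : differentiable Zc (phi z) by apply: mxsmooth_diff sZc _; exists z.
have bz := bE W_z.
have uz : J1 (phi z) \in unitmx by apply: uJ1; exists z.
(* [nabla_at_push] wants the direction in the form v J; by the choice of d, v = Y + d has this
   property. *)
have E : app (b x z) (Y z) *m tc psi (ltgt (b z z)) =
    (Yc (phi z) + d (phi z)) *m jac (bas phi psi (b z)) (phi z).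
  rewrite -J1E // mulmxDl /d mulmxKV // -mulmxDr addrC subrK.
  rewrite -bz (app_tc psi (lb W_z) (Uz W_z) aphi pz) /Yc vrep_at //.
  by rewrite /Bx mat_at // bz.
have := nabla_at_push hs (lb W_z) (Uz W_z) aphi apsi pz (qz Wz) aZ E.
rewrite bz => ->.
rewrite /P (push_at lbx _ (WU W_z)) !(app_tc psi lbx (WU W_z) aphi pz).
rewrite (nabla_coord hs Y aphi pz aZ).
have -> : lmat phi psi (b x z) = Bx (phi z) by rewrite /Bx mat_at.
rewrite -(NE _ Wz) -!(vrep_at _ pz) -/Yc -/Zc.
rewrite /Delta -(mul_jac _ aZ) -(mul_jac _ aZ) mulmxBr linearB /= mulmxBr AE /aff.
have -> : be (phi z) = psi (ltgt (b x z)) by rewrite /be bas_at.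
rewrite !mulmxDl linearD /= mulmxDr.
exact: zmod_regroup.
Qed.

Let sDelta : mxsmooth (phi @` Wc) Delta.
Proof.
have sBx := sbx.2; have sJZ := mxsmooth_jac oI sZc.
have sNA := mxsmoothB oI sN sA.
apply: mxsmoothD => //; first apply: mxsmoothD => //.
- by apply: mxsmoothM => //; exact: mxsmoothM.
- by apply: mxsmoothM => //; apply: (mxsmooth_lin vec_mx oI); exact: mxsmoothM.
- by apply: mxsmoothM => //; apply: (mxsmooth_lin vec_mx oI); exact: mxsmoothM.
Qed.

(** Terms containing d disappear by [dx] and [ddx]; in the last one N - A vanishes at x, so that
    only its derivative survives. *)
Let dDelta v : ddir Delta (phi x) v =
  Zc (phi x) *m vec_mx (Yc (phi x) *m ddir (fun a => N a - A a) (phi x) v).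
Proof.
have sBx := sbx.2; have sJZ := mxsmooth_jac oI sZc.
have sNA := mxsmoothB oI sN sA.
have s1 := mxsmoothM oI (mxsmoothM oI sd sJZ) sBx.
have sdN := mxsmoothM oI sd sN; have sYNA := mxsmoothM oI sYc sNA.
have svd := mxsmooth_lin vec_mx oI sdN; have svY := mxsmooth_lin vec_mx oI sYNA.
have s2 := mxsmoothM oI sZc svd; have s3 := mxsmoothM oI sZc svY.
have D p q (F : 'rV[R]_n -> 'M[R]_(p, q)) (sF : mxsmooth (phi @` Wc) F) := mxsmooth_diff sF Ix.
have e1 : ddir (fun a => d a *m jac Zc a *m Bx a) (phi x) v = 0.
  rewrite (ddirM _ (D _ _ _ (mxsmoothM oI sd sJZ)) (D _ _ _ sBx)).
  by rewrite (ddirM _ (D _ _ _ sd) (D _ _ _ sJZ)) ddx dx !(mul0mx, addr0).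
have e2 : ddir (fun a => Zc a *m vec_mx (d a *m N a)) (phi x) v = 0.
  rewrite (ddirM _ (D _ _ _ sZc) (D _ _ _ svd)) (ddir_lin vec_mx _ (D _ _ _ sdN)).
  rewrite (ddirM _ (D _ _ _ sd) (D _ _ _ sN)) ddx dx !(mul0mx, addr0) linear0.
  by rewrite !mulmx0 addr0.
rewrite /Delta (ddirD _ (D _ _ _ (mxsmoothD oI s1 s2)) (D _ _ _ s3)).
rewrite (ddirD _ (D _ _ _ s1) (D _ _ _ s2)) e1 e2 !add0r.
rewrite (ddirM _ (D _ _ _ sZc) (D _ _ _ svY)) (ddir_lin vec_mx _ (D _ _ _ sYNA)).
rewrite (ddirM _ (D _ _ _ sYc) (D _ _ _ sNA)) Nx subrr !mulmx0 linear0 mulmx0 !add0r.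
by [].
Qed.

Let Delta_x : Delta (phi x) = 0.
Proof. by rewrite /Delta dx Nx subrr !(mul0mx, mulmx0, linear0, addr0). Qed.

Let ddir_Delta : ddir Delta (phi x) (X x *m tc phi x) = 0.
Proof.
have dN : differentiable (vrep phi (nabla s Y Z)) (phi x).
  by apply: mxsmooth_diff (nabla_smooth hs sY sZ aphi) _; exists x.
have [dP _] := push_ddir lbx Ux aphi apsi px qx dN.
have [dK DK] := diffeo_transport Wx aphi apsi px
  (H := Delta) (K := fun c => vrep psi V c - vrep psi P c) df qx
  (fun z Wz pz q => VE (conj (conj Wz pz) q)) (mxsmooth_diff sDelta Ix).
rewrite -DK.
(* V is defined pointwise and its differentiability is not given; it is recovered from that of V -
   P, transported from Delta, and of P. *)
have dV : differentiable (vrep psi V) (psi (f x)).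
  rewrite (_ : vrep psi V = fun c => (vrep psi V c - vrep psi P c) + vrep psi P c).
    exact: differentiableD dK dP.
  by apply/funext => c; rewrite subrK.
have eVx : V (f x) = P (f x).
  apply: (mul_tc_inj apsi qx); apply/subr0_eq.
  by have := VE Wcx; rewrite Delta_x !vrep_at.
set w := _ *m jac _ _.
have ew : w = app (b x x) (X x) *m tc psi (f x).
  rewrite (app_tc psi lbx Ux aphi px) /w; congr (_ *m _).
  by have /(affine11_jet1P hs lbx Ux aphi apsi px qx)[] := ab.
rewrite (ddirB _ dV dP).
(* The third order condition and the affineness of b_x applied to nabla_Y Z have the same left-hand
   side, so V and P have equal covariant derivatives. They agree at f(x), hence the Christoffel
   terms cancel and the derivative of V - P is zero. *)
have c1 := cond sX sY sZ.
have c2 := affine11_apply hs (X x) lbx Ux ab aphi px dN.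
rewrite -(nabla_at_pt hs X aphi px dN) c2 in c1.
have e1 := nabla_at_coord hs (app (b x x) (X x)) apsi qx dV.
have e2 := nabla_at_coord hs (app (b x x) (X x)) apsi qx dP.
have := etrans (esym e1) (etrans (congr1 (fun u => u *m tc psi (f x)) (esym c1)) e2).
rewrite -ew -/(f x) eVx => /addIr ->.
by rewrite subrr.
Qed.

Lemma third_order_test :
  Z x *m tc phi x *m
    vec_mx (Y x *m tc phi x *m ddir (fun a => N a - A a) (phi x) (X x *m tc phi x)) = 0.
Proof. by have := ddir_Delta; rewrite dDelta /Zc /Yc !vrep_at. Qed.

End Fields.

(** Three arbitrary vectors are extended to fields X, Y, Z; removing the vectors one by one leaves
    an equality of matrices. *)
Let dNA v : ddir N (phi x) v = ddir A (phi x) v.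
Proof.
have dN := mxsmooth_diff sN Ix; have dA := mxsmooth_diff sA Ix.
apply/subr0_eq; rewrite -(ddirB _ dN dA); apply: mul_rV_eqP => w; rewrite mulmx0.
apply: (can_inj vec_mxK); rewrite linear0; apply: mul_rV_eqP => u; rewrite mulmx0.
have ut := tc_unit aphi px.
have [X [sX Xx]] := vf_extension x (v *m invmx (tc phi x)).
have [Y [sY Yx]] := vf_extension x (w *m invmx (tc phi x)).
have [Z [sZ Zx]] := vf_extension x (u *m invmx (tc phi x)).
have := third_order_test sX sY sZ.
by rewrite Xx Yx Zx (mulmxKV ut) (mulmxKV ut) (mulmxKV ut).
Qed.

Let dJeAJ v : ddir Je (phi x) v = ddir AJ (phi x) v.
Proof.
have dJ := mxsmooth_diff sJe Ix; have dA := mxsmooth_diff sAJ Ix.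
rewrite -(hsubmxK (ddir Je (phi x) v)) -(hsubmxK (ddir AJ (phi x) v)).
rewrite -(ddir_lin lsubmx v dJ) -(ddir_lin rsubmx v dJ).
rewrite -(ddir_lin lsubmx v dA) -(ddir_lin rsubmx v dA).
congr row_mx; last exact: dNA.
apply: (etrans (dJ1 v)); congr (ddir _ (phi x) v).
by apply/funext => a; exact: (esym (lsub_AJ a)).
Qed.

(** Near x the coordinates of S o b_x and of [e] share the target and the matrix, because b_z(z) =
    b_x(z); they differ only in the Jacobian block, settled by [dJeAJ]. *)
Lemma third_order_jac :
  jac (srep phi psi (fun z => affine_ext s (b x z))) (phi x) = jac (srep phi psi e) (phi x).
Proof.
have sm := mxsmooth_lin mxvec oI sbx.2.
pose F (J : 'rV[R]_n -> 'M[R]_(n, n + n * n)) a :=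
  row_mx (be a) (row_mx (mxvec (Bx a)) (mxvec (J a))).
have sF J : mxsmooth (phi @` Wc) J -> mxsmooth (phi @` Wc) (F J).
  move=> sJ; apply: (mxsmooth_row_mx oI sbx.1).
  exact: (mxsmooth_row_mx oI sm (mxsmooth_lin mxvec oI sJ)).
have dF J v : mxsmooth (phi @` Wc) J -> ddir (F J) (phi x) v =
    row_mx (ddir be (phi x) v) (row_mx (mxvec (ddir Bx (phi x) v)) (mxvec (ddir J (phi x) v))).
  move=> sJ; have sJ' := mxsmooth_lin mxvec oI sJ.
  rewrite (ddir_row_mx _ (mxsmooth_diff sbx.1 Ix)
    (mxsmooth_diff (mxsmooth_row_mx oI sm sJ') Ix)).
  rewrite (ddir_row_mx _ (mxsmooth_diff sm Ix) (mxsmooth_diff sJ' Ix)).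
  by rewrite (ddir_lin mxvec _ (mxsmooth_diff sbx.2 Ix)) (ddir_lin mxvec _ (mxsmooth_diff sJ Ix)).
have NI : \forall a \near phi x, (phi @` Wc) a by exact: open_nbhs_nbhs.
have N1 : \forall a \near phi x, F AJ a = srep phi psi (fun z => affine_ext s (b x z)) a.
  apply: filterS NI => a [z Wz <-]; have [[W_z pz] q] := Wz.
  rewrite (srep_affine_ext hs lbx (WU W_z) aphi apsi pz q) /affF.
  by rewrite row_mxKl row_mxKr srep_B1 row_mxKl row_mxKr mxvecK.
have N2 : \forall a \near phi x, F Je a = srep phi psi e a.
  by apply: filterS NI => a [z Wz <-]; rewrite (srep_e Wz) /F (JeE Wz).
rewrite -(jac_near N1 (mxsmooth_diff (sF _ sAJ) Ix)).
rewrite -(jac_near N2 (mxsmooth_diff (sF _ sJe) Ix)).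
apply/(jac_eqP (mxsmooth_diff (sF _ sAJ) Ix) (mxsmooth_diff (sF _ sJe) Ix)) => v.
by rewrite (dF _ v sAJ) (dF _ v sJe) dJeAJ.
Qed.

End UniquenessOrderThree.

Theorem proposition6p4 (R : realType) (n : nat) (M : manifold R n)
    (s : M -> gsort (B11 M)) (hs : symmetry_jet s)
    (xi : gsort (B1 M)) (hxi : garr (B1 M) xi) :
  unique (fun eta : gsort (B111 M) =>
            affine111 s eta /\ first_order_part eta = xi)
         (affine_ext2 s xi).
Proof.
split; first by split; [exact: affine_ext2_affine|exact: first_order_affine_ext2].
move=> eta [[jeta aeta [W [U [b [[Wx WU] HU [_ bE] [le eeta] cond]]]]] fo].
set x := eta.1 in Wx WU HU bE le eeta cond.
have lb z : W z -> local_bisection (U z) (b z) by move=> /HU[].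
have Uz z : W z -> U z z by move=> /HU[].
have lbx := lb x Wx; have Ux := Uz x Wx.
have eE : (fun z => j1 z (b z)) = (fun z => jet1 z (b z)).
  by apply/funext => z; rewrite j1E.
rewrite eE in le eeta; rewrite j1E in eeta.
have pE : p111 eta = jet1 x (b x) by rewrite eeta (p111_jet1 le Wx).
have fx : b x x = xi.
  by rewrite -fo /first_order_part pE /p11 (jet_val_jet1 lbx Ux).
rewrite pE in aeta.
(* The equality of p and p_** in [jets111], expressed through the family. *)
have pss : jet1 x (b x) = jet1 x (fun z => pstar11 (jet1 z (b z))).
  have [_ _ e _] := jeta; rewrite -pE e [in LHS]eeta.
  exact: (pstarstar111_jet1 le Wx).
have [ae pe] := affine_ext_spec hs hxi.
have eb : jet1 x (b x) = affine_ext s xi.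
  apply: (affine11_unique hs aeta ae).
  by rewrite pe /p11 (jet_val_jet1 lbx Ux).
have ex : lsrc xi = x by rewrite -fx (section_lsrc lbx Ux).
have [U' [a [la Ua ea ->]]] := affine_ext2_jet1 hs hxi.
rewrite ex in Ua ea *.
(* Both a and b_x have jet S(xi) at x, the latter by uniqueness in order two, so b_x may stand for
   a. *)
have -> : jet1 x (fun z => affine_ext s (a z)) = jet1 x (fun z => affine_ext s (b x z)).
  apply: jet1_eq; apply: (sjet_affine_ext hs la lbx Ua Ux).
  by apply: (jet1_inj la Ua); rewrite ea eb.
rewrite eeta; apply: jet1_eq; apply/sjetE; split; first by rewrite fx eb.
move=> phi psi aphi apsi px; rewrite (affine_ext_ltgt hs lbx Ux) => qx.
exact: (third_order_jac hs Wx WU lb Uz bE le aeta pss cond aphi apsi px qx).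
Qed.
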